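(* Let $A\in\mathbb{R}^{m\times n}$ be a matrix such that every column of $A$ has $\ell_1$-norm at most $t$, i.e. $\max_{j\in[n]}\sum_{i\in[m]}|a_{ij}|\le t$, and let $x\in[0,1]^n$. For any $0\le\delta<1$ there is a polynomial-time randomized algorithm that returns $X\in\{0,1\}^n$ such that, with probability $1$, $\|A(X-x)\|_\infty\le t/(1-\delta)$; moreover $\mathbb{E}[X_i]=x_i$ for all $i$, and, when $\delta>0$, $X$ is $\beta$-concentrated around $x$ with $\beta=C/\delta$ for an absolute constant $C$.
   Context: $\beta$-concentration: for $\beta\ge 1$, a random vector $X=(X_1,\dots,X_n)$ of (possibly dependent) $0$-$1$ random variables with $x_i=\mathbb{E}[X_i]$ is $\beta$-concentrated around $x$ if for every $a\in\mathbb{R}^n$ and every $s>0$, $\Pr[a\cdot X-\mathbb{E}[a\cdot X]\ge s]\le \exp\left(-\frac{s^2/\beta}{2(\sum_i a_i^2(x_i-x_i^2)+Ms/3)}\right)$, where $M=\max_i|a_i|$. *)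

(* Defs.v *)
From mathcomp Require Import all_boot all_order all_algebra.
From mathcomp Require Import reals normedtype sequences exp.

Set Implicit Arguments.
Unset Strict Implicit.
Unset Printing Implicit Defensive.

Import Order.TTheory GRing.Theory Num.Theory.

Local Open Scope ring_scope.

(** * Random 0-1 vectors

    A random vector X in {0,1}^n is given by its law, the probability mass
    function [mu] on {0,1}^n. *)

Section RandomVectors.
Variables (R : realType) (n : nat).
Implicit Types (mu : {ffun 'I_n -> bool} -> R) (X : {ffun 'I_n -> bool}).

Definition is_law mu : Prop :=
  (forall X, 0 <= mu X) /\ \sum_X mu X = 1.

Definition Pr mu (E : pred {ffun 'I_n -> bool}) : R := \sum_(X | E X) mu X.

Definition Ex mu (f : {ffun 'I_n -> bool} -> R) : R := \sum_X mu X * f X.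

Definition vec01 X : 'cV[R]_n := \col_i (X i)%:R.

Definition dot (a b : 'cV[R]_n) : R := \sum_i a i 0 * b i 0.

(* [mx_norm a] is max_i |a_i| (0 if n = 0).  The denominator vanishes only
   for a = 0, where the event is empty since s > 0. *)
Definition beta_concentrated mu (beta : R) (x : 'cV[R]_n) : Prop :=
  [/\ 1 <= beta,
      forall i, Ex mu (fun X => vec01 X i 0) = x i 0 &
      forall (a : 'cV[R]_n) (s : R), 0 < s ->
        Pr mu (fun X => s <= dot a (vec01 X)
                             - Ex mu (fun Y => dot a (vec01 Y)))
        <= expR (- ((s ^+ 2 / beta) /
             (2 * (\sum_i a i 0 ^+ 2 * (x i 0 - x i 0 ^+ 2)
                   + mx_norm a * s / 3))))].

End RandomVectors.

Definition max_col_l1 (R : realType) (m n : nat) (A : 'M[R]_(m, n)) : R :=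
  \big[Num.max/0]_(j < n) \sum_(i < m) `|A i j|.

(** * Randomized algorithms over the reals

    As the data are real, the model is a randomized real RAM with unit costs:
    a finite program, independent of the size of the input and with integer
    constants only, works on natural-number registers (for counters and
    addresses; only addition and truncated subtraction, so that they keep
    polynomially many bits in polynomial time) and on arrays of real numbers
    with exact field operations and comparisons.  There is no rounding from
    reals to integers.  Randomness comes from independent coins with a
    computed bias: fair coins alone would only produce dyadic expectations. *)

Inductive iexp :=
| ICst of nat
| IVar of nat
| IAdd of iexp & iexp
| ISub of iexp & iexp.

Inductive rexp :=
| ROfI of iexp
| RGet of nat & iexp & iexp          (* array name, row, column *)
| RAdd of rexp & rexp
| ROpp of rexp
| RMul of rexp & rexp
| RInv of rexp.

Inductive bexp :=
| ILe of iexp & iexp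
| RLe of rexp & rexp
| BNot of bexp
| BAnd of bexp & bexp.

Inductive cmd :=
| Skip
| ISet of nat & iexp
| RSet of nat & iexp & iexp & rexp
| Flip of nat & rexp                 (* register := 1 with probability p,
                                        0 with probability 1 - p *)
| Seq of cmd & cmd
| If of bexp & cmd & cmd
| While of bexp & cmd.

Section Machine.
Variable R : realType.

Record state := State {
  reg : nat -> nat;
  arr : nat -> nat -> nat -> R }.

Definition set_reg (s : state) (v k : nat) : state :=
  State (fun v' => if v' == v then k else reg s v') (arr s).

Definition set_arr (s : state) (a i j : nat) (r : R) : state :=
  State (reg s) (fun a' i' j' =>
    if [&& a' == a, i' == i & j' == j] then r else arr s a' i' j').

Fixpoint ieval (s : state) (e : iexp) : nat :=
  match e with
  | ICst k => k
  | IVar v => reg s v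
  | IAdd e1 e2 => (ieval s e1 + ieval s e2)%N
  | ISub e1 e2 => (ieval s e1 - ieval s e2)%N
  end.

Fixpoint reval (s : state) (e : rexp) : R :=
  match e with
  | ROfI i => (ieval s i)%:R
  | RGet a i j => arr s a (ieval s i) (ieval s j)
  | RAdd e1 e2 => reval s e1 + reval s e2
  | ROpp e1 => - reval s e1
  | RMul e1 e2 => reval s e1 * reval s e2
  | RInv e1 => (reval s e1)^-1
  end.

Fixpoint beval (s : state) (b : bexp) : bool :=
  match b with
  | ILe e1 e2 => (ieval s e1 <= ieval s e2)%N
  | RLe e1 e2 => reval s e1 <= reval s e2
  | BNot b1 => ~~ beval s b1
  | BAnd b1 b2 => beval s b1 && beval s b2
  end.

Definition clamp01 (p : R) : R := Num.max 0 (Num.min 1 p).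

(* [expect T k s f] runs the list [k] of pending commands from state [s] for
   at most [T] steps, and returns the expected value of [f] at the outcome,
   which is [Some] of the final state if the run has halted and [None] if it
   has exceeded its time.  The program being fixed, its expressions have
   bounded size, so evaluating one is part of a single step. *)
Fixpoint expect (T : nat) (k : seq cmd) (s : state) (f : option state -> R)
    {struct T} : R :=
  match k with
  | [::] => f (Some s)
  | c :: k' =>
    match T with
    | 0%N => f None
    | T'.+1 =>
      match c with
      | Skip => expect T' k' s f
      | ISet v e => expect T' k' (set_reg s v (ieval s e)) f
      | RSet a i j e =>
          expect T' k' (set_arr s a (ieval s i) (ieval s j) (reval s e)) f
      | Flip v e =>
          let p := clamp01 (reval s e) in
          p * expect T' k' (set_reg s v 1) f
          + (1 - p) * expect T' k' (set_reg s v 0) f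
      | Seq c1 c2 => expect T' (c1 :: c2 :: k') s f
      | If b c1 c2 => expect T' ((if beval s b then c1 else c2) :: k') s f
      | While b c1 =>
          expect T' (if beval s b then c1 :: c :: k' else k') s f
      end
    end
  end.

(* Registers 0 and 1 hold the dimensions; arrays 0, 1, 2, 3 hold
   A, x, t and delta; everything else is 0. *)
Definition input (m n : nat) (A : 'M[R]_(m, n)) (x : 'cV[R]_n) (t delta : R)
    : state :=
  State
    (fun v => match v with 0%N => m | 1%N => n | _ => 0%N end)
    (fun a i j =>
       match a with
       | 0%N => match (insub i : option 'I_m), (insub j : option 'I_n) with
                | Some i', Some j' => A i' j'
                | _, _ => 0
                end
       | 1%N => match (insub i : option 'I_n), j with
                | Some i', 0%N => x i' 0
                | _, _ => 0
                end
       | 2%N => match i, j with 0%N, 0%N => t | _, _ => 0 end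
       | 3%N => match i, j with 0%N, 0%N => delta | _, _ => 0 end
       | _ => 0
       end).

(* The output is read in column 0 of array 4. *)
Definition returns (n : nat) (o : option state) (X : {ffun 'I_n -> bool})
    : bool :=
  if o is Some s then [forall i : 'I_n, arr s 4 i 0 == (X i)%:R] else false.

(* Probability that the program halts within [T] steps and returns [X].  Its
   total mass is 1 iff, with probability 1, the program halts within [T] steps
   and its output belongs to {0,1}^n. *)
Definition output_law (n T : nat) (prog : cmd) (s : state)
    (X : {ffun 'I_n -> bool}) : R :=
  expect T [:: prog] s (fun o => (returns o X)%:R).

End Machine.

(* Main.v *)
(** The walk starts at [x] and stays in the cube; coordinates in (0,1) are alive.
    Rows whose mass on the alive coordinates exceeds [t / (1 - delta)] are kept
    constant, and steps are orthogonal to [x - 1/2] while more than [K ~ 4 / delta]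
    coordinates are alive.  A step either freezes a coordinate or has l1-norm [K],
    and then moves away from the centre of the cube by Pythagoras, so a quadratic
    number of steps suffices on every run.

    A step must have a covariance [U] on the remaining space [V] with
    [U <= (4 / delta) diag U], up to a negligible multiple of the variances
    [d_i = x_i (1 - x_i)].  Take for [U] the projection [P] onto [V] that is
    orthogonal for weights [w_i], where [P <= diag (1 / w)]: if every leverage
    [w_i P_ii] is at least [delta / 4] we are done.  Otherwise raise the weights of
    the coordinates violating this, starting from [1 / d_i] and up to a polynomial
    factor.  A raised coordinate has leverage below [delta / 2] forever, while the
    average leverage is larger, so some coordinate keeps its initial weight, which
    bounds the scale of [U] from below.  As [P w P = P], the columns of [P] are the
    possible directions.  Going along one of them until the boundary (or the l1
    cap) in either direction gives a step of variance [fwd * bwd]; choosing the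
    direction with probability proportional to [w_k / (fwd * bwd)] restores [P].

    Concentration: for [c_l] of order [K], slightly increasing with the number [l]
    of remaining steps, [exp (theta a.x + theta^2 c_l sum_i a_i^2 d_i)] is a
    supermartingale. *)

Require Import Defs.
From mathcomp Require Import all_boot all_order all_algebra.
From mathcomp Require Import reals normedtype sequences exp.
From mathcomp Require Import interval_inference ring lra zify.

Set Implicit Arguments.
Unset Strict Implicit.
Unset Printing Implicit Defensive.

Import Order.TTheory GRing.Theory Num.Theory.

Local Open Scope ring_scope.

(** * Structured programs and their expectation transformers *)

(** The machine has only field operations and comparisons, so the covariance of a step must be a
    rational expression of the data; iterated reweighting takes the place of an optimisation. The
    initial weight [1 / d_i] is dictated by the geometry: a two-point step that stays in the cube
    moves coordinate [i] with variance at most [d_i], so the total rate is at least [P_ii / d_i],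
    which is exactly the leverage of a coordinate whose weight was never raised. A coordinate stuck
    at the maximal multiplicity may violate the domination, but only by [d_i] divided by the cap.
    The cap equals the number [n (n + 1)] of steps, so over a whole run these errors keep the order
    of [c_l], whose growth absorbs them. Concentration rests on the term [- y_i^2] in the change of
    the variance [d_i] under a move [y]: its mean pays for the second moment of [a.y]. For
    [delta = 0] one only needs a nonzero direction, which follows from the strict inequality in the
    count of constrained rows. *)

(* [PFor v r c b] runs [b] with register [v] ranging over [0, reg r + c). *)
Inductive prg :=
| PNop
| PInt of nat & iexp
| PReal of nat & iexp & iexp & rexp
| PFlip of nat & rexp
| PSeq of prg & prg
| PIf of bexp & prg & prg
| PFor of nat & nat & nat & prg.

Fixpoint compile (p : prg) : cmd :=
  match p with
  | PNop => Skip
  | PInt v e => ISet v e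
  | PReal a i j e => RSet a i j e
  | PFlip v e => Flip v e
  | PSeq p1 p2 => Seq (compile p1) (compile p2)
  | PIf b p1 p2 => If b (compile p1) (compile p2)
  | PFor v r c b =>
      Seq (ISet v (ICst 0))
          (While (BNot (ILe (IAdd (IVar r) (ICst c)) (IVar v)))
             (Seq (compile b) (ISet v (IAdd (IVar v) (ICst 1)))))
  end.

Fixpoint mod_reg (p : prg) : seq nat :=
  match p with
  | PInt v _ | PFlip v _ => [:: v]
  | PSeq p1 p2 | PIf _ p1 p2 => mod_reg p1 ++ mod_reg p2
  | PFor v _ _ b => v :: mod_reg b
  | _ => [::]
  end.

Fixpoint mod_arr (p : prg) : seq nat :=
  match p with
  | PReal a _ _ _ => [:: a]
  | PSeq p1 p2 | PIf _ p1 p2 => mod_arr p1 ++ mod_arr p2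
  | PFor _ _ _ b => mod_arr b
  | _ => [::]
  end.

Fixpoint det (p : prg) : bool :=
  match p with
  | PFlip _ _ => false
  | PSeq p1 p2 | PIf _ p1 p2 => det p1 && det p2
  | PFor _ _ _ b => det b
  | _ => true
  end.

(** Registers 0 and 1 hold the dimensions and may not be assigned, loop bounds are read from them
    only, and no body changes its own loop variable: the number of iterations is known on entry,
    which gives termination and the bound [cost]. *)
Fixpoint wf (p : prg) : bool :=
  match p with
  | PInt v _ | PFlip v _ => (1 < v)%N
  | PSeq p1 p2 | PIf _ p1 p2 => wf p1 && wf p2
  | PFor v r _ b => [&& (1 < v)%N, (r <= 1)%N, v \notin mod_reg b & wf b]
  | _ => true
  end.

(* A bound on the running time when registers 0 and 1 are at most [M]. *)
Fixpoint cost (p : prg) (M : nat) : nat :=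
  match p with
  | PSeq p1 p2 | PIf _ p1 p2 => (cost p1 M + cost p2 M).+1
  | PFor _ _ c b => (M + c) * (cost b M + 3) + 3
  | _ => 1
  end.

Fixpoint cost_poly (p : prg) : {poly nat} :=
  match p with
  | PSeq p1 p2 | PIf _ p1 p2 => cost_poly p1 + cost_poly p2 + 1
  | PFor _ _ c b => ('X + c%:P) * (cost_poly b + 3%:P) + 3%:P
  | _ => 1
  end.

Lemma cost_polyE p M : (cost_poly p).[M] = cost p M.
Proof.
elim: p => [|v e|a i j e|v e|p1 IH1 p2 IH2|b p1 IH1 p2 IH2|v r c b IH];
  rewrite /cost_poly -/cost_poly /cost -/cost ?(hornerD, hornerM, hornerX, hornerC) //.
- by rewrite IH1 IH2 -[GRing.add _ _]/(addn (addn _ _) 1) addn1.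
- by rewrite IH1 IH2 -[GRing.add _ _]/(addn (addn _ _) 1) addn1.
- by rewrite IH.
Qed.

(** * Expected values, frames and correctness of compilation *)

Section Semantics.
Variable R : realType.
Implicit Types (s : state R) (g h : state R -> R).

Definition next_iter v s := set_reg s v (reg s v).+1.

(** The expected value of [g] at the final state. A loop is an iterate of the transformer of its
    body, since its length is fixed on entry. *)
Fixpoint wp (p : prg) g s : R :=
  match p with
  | PNop => g s
  | PInt v e => g (set_reg s v (ieval s e))
  | PReal a i j e => g (set_arr s a (ieval s i) (ieval s j) (reval s e))
  | PFlip v e => let q := clamp01 (reval s e) in
      q * g (set_reg s v 1) + (1 - q) * g (set_reg s v 0)
  | PSeq p1 p2 => wp p1 (wp p2 g) s
  | PIf b p1 p2 => if beval s b then wp p1 g s else wp p2 g s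
  | PFor v r c b =>
      iter (reg s r + c) (fun h s' => wp b (fun s2 => h (next_iter v s2)) s') g
        (set_reg s v 0)
  end.

(** The final state of a program without coins. The value at [PFlip] is arbitrary, chosen so that
    [den_frame] holds for all programs. *)
Fixpoint den (p : prg) s : state R :=
  match p with
  | PNop => s
  | PInt v e => set_reg s v (ieval s e)
  | PReal a i j e => set_arr s a (ieval s i) (ieval s j) (reval s e)
  | PFlip v e => set_reg s v 0
  | PSeq p1 p2 => den p2 (den p1 s)
  | PIf b p1 p2 => if beval s b then den p1 s else den p2 s
  | PFor v r c b =>
      iter (reg s r + c) (fun s' => next_iter v (den b s')) (set_reg s v 0)
  end.

Definition frame (rs ars : seq nat) s s' : Prop :=
  (forall r, r \notin rs -> reg s' r = reg s r) /\
  (forall a, a \notin ars -> arr s' a = arr s a).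

Lemma frame_trans rs ars s1 s2 s3 :
  frame rs ars s1 s2 -> frame rs ars s2 s3 -> frame rs ars s1 s3.
Proof.
move=> [h1 k1] [h2 k2]; split=> [r hr | a ha]; first by rewrite h2 ?h1.
by rewrite k2 ?k1.
Qed.

Lemma frame_sub rs rs' ars ars' s1 s2 :
  {subset rs <= rs'} -> {subset ars <= ars'} ->
  frame rs ars s1 s2 -> frame rs' ars' s1 s2.
Proof.
move=> sr sa [h k]; split=> [r hr | a ha].
  by apply: h; apply: contra hr => /sr.
by apply: k; apply: contra ha => /sa.
Qed.

Lemma frame_reg rs ars s v k : v \in rs -> frame rs ars s (set_reg s v k).
Proof.
move=> vi; split=> // r hr /=; case: eqP => // e.
by move: hr; rewrite e vi.
Qed.

Lemma frame_arr rs ars s a i j x : a \in ars -> frame rs ars s (set_arr s a i j x).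
Proof.
move=> ai; split=> // a' ha; rewrite /set_arr /=.
have -> : (a' == a) = false by apply/eqP => e; move: ha; rewrite e ai.
by [].
Qed.

Lemma den_frame p s : frame (mod_reg p) (mod_arr p) s (den p s).
Proof.
elim: p s => [|v e|a i j e|v e|p1 IH1 p2 IH2|b p1 IH1 p2 IH2|v r c b IH] s //=.
- by apply: frame_reg; rewrite inE.
- by apply: frame_arr; rewrite inE.
- by apply: frame_reg; rewrite inE.
- by apply: (frame_trans (frame_sub _ _ (IH1 s)) (frame_sub _ _ (IH2 _))) => q /=;
    rewrite mem_cat => ->; rewrite ?orbT.
- by case: ifP => _; [apply: frame_sub (IH1 s) | apply: frame_sub (IH2 s)] => q /=;
    rewrite mem_cat => ->; rewrite ?orbT.
- have f0 : frame (v :: mod_reg b) (mod_arr b) s (set_reg s v 0).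
    by apply: frame_reg; rewrite inE eqxx.
  elim: (reg s r + c)%N => [|N IHN] //=; apply: (frame_trans IHN).
  set s1 := iter _ _ _.
  apply: (@frame_trans _ _ _ (den b s1)).
    by apply: frame_sub (IH s1) => // q; rewrite inE => ->; rewrite orbT.
  by apply: frame_reg; rewrite inE eqxx.
Qed.

Lemma den_reg p s r : r \notin mod_reg p -> reg (den p s) r = reg s r.
Proof. by move=> h; case: (den_frame p s) => H _; apply: H. Qed.

Lemma den_arr p s a : a \notin mod_arr p -> arr (den p s) a = arr s a.
Proof. by move=> h; case: (den_frame p s) => _ H; apply: H. Qed.

Lemma wp_det p g s : det p -> wp p g s = g (den p s).
Proof.
elim: p g s => [|v e|a i j e|v e|p1 IH1 p2 IH2|b p1 IH1 p2 IH2|v r c b IH] g s //=.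
- by case/andP=> h1 h2; rewrite IH1 // IH2.
- by case/andP=> h1 h2; case: ifP => _; [apply: IH1 | apply: IH2].
- move=> hb; elim: (reg s r + c)%N (set_reg s v 0) => [|N IHN] s0 //.
  by rewrite iterS IH // IHN -iterSr.
Qed.

(** Invariant rule. The body also receives the frame from the state before the loop, so [P] need
    only speak of what the loop modifies. *)
Lemma den_for (P : nat -> state R -> Prop) v r c b s :
  v \notin mod_reg b ->
  P 0%N (set_reg s v 0) ->
  (forall k s', (k < reg s r + c)%N -> frame (v :: mod_reg b) (mod_arr b) s s' ->
     reg s' v = k -> P k s' -> P k.+1 (set_reg (den b s') v k.+1)) ->
  P (reg s r + c)%N (den (PFor v r c b) s).
Proof.
move=> hv P0 Pstep.
have f0 : frame (v :: mod_reg b) (mod_arr b) s (set_reg s v 0).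
  by apply: frame_reg; rewrite inE eqxx.
have key k : (k <= reg s r + c)%N ->
  let s' := iter k (fun s' => next_iter v (den b s')) (set_reg s v 0) in
  [/\ P k s', reg s' v = k & frame (v :: mod_reg b) (mod_arr b) s s'].
  elim: k => [|k IH] lk /=; first by rewrite eqxx.
  have [Pk rk fk] := IH (ltnW lk); set s' := iter k _ _ in Pk rk fk *.
  have rb : reg (den b s') v = k by rewrite den_reg.
  rewrite /next_iter rb /= eqxx; split=> //; first exact: Pstep.
  apply: (frame_trans fk); apply: (@frame_trans _ _ _ (den b s')).
    by apply: frame_sub (den_frame b s') => // q; rewrite inE => ->; rewrite orbT.
  by apply: frame_reg; rewrite inE eqxx.
by have [] := key _ (leqnn _).
Qed.

Lemma wf_mod_reg p r : wf p -> (r <= 1)%N -> r \notin mod_reg p.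
Proof.
elim: p => [|v e|a i j e|v e|p1 IH1 p2 IH2|b p1 IH1 p2 IH2|v r' c b IH] //=.
- by move=> h1 h2; rewrite inE; apply/eqP => e'; move: h1 h2; rewrite e'; lia.
- by move=> h1 h2; rewrite inE; apply/eqP => e'; move: h1 h2; rewrite e'; lia.
- by move=> /andP[h1 h2] h; rewrite mem_cat negb_or IH1 ?IH2.
- by move=> /andP[h1 h2] h; rewrite mem_cat negb_or IH1 ?IH2.
- case/and4P=> h1 h2 h3 h4 h; rewrite inE negb_or IH // andbT.
  by apply/eqP => e'; move: h1 h; rewrite e'; lia.
Qed.

(** [expect] runs a stack of pending commands, so the induction carries the continuation [k], which
    yields [g] whenever at least [N] steps are left; the time of [p] is added to [N]. *)
Lemma compile_correct p (M N : nat) (k : seq cmd) f g s :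
  wf p -> (reg s 0 <= M)%N -> (reg s 1 <= M)%N ->
  (forall s', frame (mod_reg p) (mod_arr p) s s' ->
     forall T, (N <= T)%N -> expect T k s' f = g s') ->
  forall T, (cost p M + N <= T)%N -> expect T (compile p :: k) s f = wp p g s.
Proof.
elim: p N k g s => [|v e|a i j e|v e|p1 IH1 p2 IH2|b p1 IH1 p2 IH2|v r c b IH]
  N k g s /=.
- by move=> _ _ _ H [|T] // hT /=; apply: H.
- move=> _ _ _ H [|T] // hT /=; apply: H => //.
  by apply: frame_reg; rewrite inE.
- move=> _ _ _ H [|T] // hT /=; apply: H => //.
  by apply: frame_arr; rewrite inE.
- move=> _ _ _ H [|T] // hT /=.
  by rewrite !H //; apply: frame_reg; rewrite inE.
- case/andP=> w1 w2 r0 r1 H [|T] // hT /=.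
  apply: (IH1 (cost p2 M + N)%N) => //; last by lia.
  move=> s1 f1; apply: IH2 => //.
  + by case: f1 => -> //; exact: wf_mod_reg.
  + by case: f1 => -> //; exact: wf_mod_reg.
  move=> s2 f2; apply: H.
  by apply: (frame_trans (frame_sub _ _ f1) (frame_sub _ _ f2)) => q /=;
    rewrite mem_cat => ->; rewrite ?orbT.
- case/andP=> w1 w2 r0 r1 H [|T] // hT /=.
  case: ifP => _; [apply: (IH1 N) | apply: (IH2 N)] => //; try lia;
    move=> s' f'; apply: H; apply: frame_sub f' => q /=;
    by rewrite mem_cat => ->; rewrite ?orbT.
case/and4P=> v1 hr vb wb r0 r1 H; case=> [|[|T]] hT; try lia.
have rM : (reg s r <= M)%N by case: r hr {H hT} => [|[|]].
have rv : r != v by apply/eqP => e; move: hr v1; rewrite e; lia.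
rewrite /=; set W := While _ _; set L := (reg s r + c)%N.
set F := fun (h : state R -> R) s' => _.
(* [i] iterations remain and [q] is the loop variable. Besides its body, an iteration takes three
   steps: the test, the sequence and the increment. The extra 1 is the final test. *)
suff key i q s0 T' : frame (v :: mod_reg b) (mod_arr b) s s0 -> reg s0 v = q ->
    (i + q)%N = L -> (i * (cost b M + 3) + 1 + N <= T')%N ->
    expect T' (W :: k) s0 f = iter i F g s0.
  apply: (key _ 0%N) => //.
  - by apply: frame_reg; rewrite inE eqxx.
  - by rewrite /= eqxx.
  - exact: addn0.
  have : (L * (cost b M + 3) <= (M + c) * (cost b M + 3))%N.
    by apply: leq_mul => //; rewrite /L; lia.
  by lia.
elim: i q s0 T' => [|i IHi] q s0 [|T'] f0 rq eL hT'; try lia.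
  rewrite /= rq; have -> : reg s0 r = reg s r.
    by case: f0 => -> //; rewrite inE negb_or rv wf_mod_reg.
  have -> : (reg s r + c <= q)%N by rewrite -/L; lia.
  by apply: H => //; lia.
rewrite /= rq; have -> : reg s0 r = reg s r.
  by case: f0 => -> //; rewrite inE negb_or rv wf_mod_reg.
have -> : (reg s r + c <= q)%N = false by apply/negbTE; rewrite -/L; lia.
case: T' hT' => [|T'] hT' /=; first by lia.
apply: (IH (i * (cost b M + 3) + 2 + N)%N) => //.
- by case: f0 => -> //; rewrite inE negb_or wf_mod_reg // andbT; apply/eqP; lia.
- by case: f0 => -> //; rewrite inE negb_or wf_mod_reg // andbT; apply/eqP; lia.
- move=> s1 f1 [|T1] hT1; first by lia.
  have r1q : reg s1 v = q by case: f1 => ->.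
  rewrite /= addn1; apply: (IHi q.+1); [|by rewrite /= eqxx r1q|by lia|by lia].
  apply: (frame_trans f0); apply: (@frame_trans _ _ _ s1).
    by apply: frame_sub f1 => // z; rewrite inE => ->; rewrite orbT.
  by apply: frame_reg; rewrite inE eqxx.
by lia.
Qed.
End Semantics.

(** * Weighted projections *)

Section WeightedProjection.
Variables (R : realFieldType) (n : nat).
Implicit Types (w : 'I_n -> R) (C : nat -> 'cV[R]_n) (P : 'M[R]_n) (r y b : 'cV[R]_n).

Definition wmx w : 'M[R]_n := diag_mx (\row_i w i).

(** One Gram-Schmidt step: it removes from the range of [P] the line of [P *m r], so that the result
    kills [r]. If the quadratic form of [P] vanishes at [r], the convention [0^-1 = 0] leaves [P]
    unchanged. *)
Definition downdate P r : 'M[R]_n :=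
  P - ((r^T *m P *m r) 0 0)^-1 *: (P *m r *m (P *m r)^T).

(* The projection onto the common kernel of [C 0], ..., [C k.-1], orthogonal
   for the inner product [sum_i w_i u_i v_i], times the inverse of the weights;
   coordinates of weight 0 are killed because [0^-1 = 0]. *)
Fixpoint ker_proj w (C : nat -> 'cV[R]_n) k : 'M[R]_n :=
  if k is k'.+1 then downdate (ker_proj w C k') (C k')
  else wmx (fun i => (w i)^-1).

(** [P W], with [W] the diagonal matrix of the weights, is then a projection, self-adjoint for the
    weighted inner product. The third clause makes up for [W] being possibly singular. *)
Definition is_wproj w P :=
  [/\ P^T = P, P *m wmx w *m P = P & forall i j, w i = 0 -> P i j = 0].

Lemma wmxE w (y z : 'cV[R]_n) :
  (y^T *m wmx w *m z) 0 0 = \sum_i w i * (y i 0 * z i 0).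
Proof.
rewrite /wmx mul_mx_diag !mxE; apply: eq_bigr => i _; rewrite !mxE; ring.
Qed.

Lemma wproj_quad w P (y z : 'cV[R]_n) : is_wproj w P ->
  (y^T *m P *m z) 0 0 = \sum_i w i * ((P *m y) i 0 * (P *m z) i 0).
Proof.
case=> sP iP _; rewrite -wmxE trmx_mul sP -[in LHS]iP; congr (_ 0 0).
by rewrite !mulmxA.
Qed.

Lemma wproj_quad_eq0 w P y : (forall i, 0 <= w i) -> is_wproj w P ->
  (y^T *m P *m y) 0 0 = 0 -> P *m y = 0.
Proof.
move=> w0 hP; rewrite (wproj_quad _ _ hP) => /eqP.
rewrite psumr_eq0 => [/allP h|i _]; last by rewrite mulr_ge0 // -expr2 sqr_ge0.
apply/matrixP => i j; rewrite ord1 [RHS]mxE.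
have := h i; rewrite mem_index_enum => /(_ isT) /=.
rewrite mulf_eq0 mulf_eq0 orbb => /orP[/eqP w_i0|/eqP //].
by case: hP => _ _ h0; rewrite mxE big1 // => k _; rewrite h0 // mul0r.
Qed.

Lemma wproj_quad_mx w P y : is_wproj w P ->
  (P *m y)^T *m wmx w *m (P *m y) = ((y^T *m P *m y) 0 0)%:M.
Proof.
case=> sP iP _; rewrite trmx_mul sP -mx11_scalar -[in RHS]iP.
by rewrite !mulmxA.
Qed.

(** With [y = P r] one has [P W y = y] and [y^T W y = s]. Unless [s = 0], the subtracted matrix is
    thus itself a weighted projection, onto a line inside the range of [P], and a difference of
    nested projections is a projection. *)
Lemma downdate_wproj w P r : (forall i, 0 <= w i) -> is_wproj w P ->
  is_wproj w (downdate P r).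
Proof.
move=> w0 hP; have [sP iP h0] := hP; rewrite /downdate.
set s := (r^T *m P *m r) 0 0; set y := P *m r.
have [s0|s_neq0] := eqVneq s 0.
  by rewrite s0 invr0 scale0r subr0.
have Wy : P *m wmx w *m y = y by rewrite /y mulmxA iP.
have yW : y^T *m wmx w *m P = y^T.
  by rewrite -[RHS](congr1 trmx Wy) !trmx_mul sP tr_diag_mx mulmxA.
split.
- by rewrite linearB linearZ /= sP trmx_mul trmxK.
- have e1 : P *m wmx w *m (y *m y^T) = y *m y^T by rewrite mulmxA Wy.
  have e2 : y *m y^T *m wmx w *m P = y *m y^T by rewrite -!mulmxA (mulmxA y^T) yW.
  have e3 : y *m y^T *m wmx w *m (y *m y^T) = s *: (y *m y^T).
    have -> : y *m y^T *m wmx w *m (y *m y^T) = y *m (y^T *m wmx w *m y) *m y^T.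
      by rewrite !mulmxA.
    by rewrite (wproj_quad_mx _ hP) -/s mul_mx_scalar -scalemxAl.
  rewrite mulmxBl mulmxBl !mulmxBr iP -!scalemxAl -!scalemxAr e1 e2 e3 !scalerA.
  by rewrite ?mulrA divfK //; apply/matrixP => i j; rewrite !mxE; ring.
- move=> i j wi0; have yi : y i 0 = 0.
    by rewrite mxE big1 // => k _; rewrite h0 // mul0r.
  rewrite mxE h0 // !mxE big1 ?mulr0 ?oppr0 ?addr0 // => k _.
  by rewrite ord1 yi mul0r.
Qed.

Lemma diag_wproj w : is_wproj w (wmx (fun i => (w i)^-1)).
Proof.
split; first by rewrite /wmx tr_diag_mx.
- rewrite /wmx !mulmx_diag; congr diag_mx; apply/rowP => i; rewrite !mxE.
  by have [->|h] := eqVneq (w i) 0; rewrite ?invr0 ?mul0r // mulVf // mul1r.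
- by move=> i j wi0; rewrite !mxE wi0 invr0; case: eqP; rewrite ?mulr0n.
Qed.

Lemma ker_proj_wproj w C k : (forall i, 0 <= w i) -> is_wproj w (ker_proj w C k).
Proof.
by move=> w0; elim: k => [|k IH] /=; [apply: diag_wproj | apply: downdate_wproj].
Qed.

Lemma ker_proj_ker w C k l : (forall i, 0 <= w i) -> (l < k)%N ->
  ker_proj w C k *m C l = 0.
Proof.
move=> w0; elim: k => [//|k IH]; rewrite ltnS leq_eqVlt => /orP[/eqP ->|lk] /=.
  have hP := ker_proj_wproj C k w0; rewrite /downdate; set P := ker_proj w C k.
  have [s0|s0] := eqVneq (((C k)^T *m P *m C k) 0 0) 0.
    by rewrite s0 invr0 scale0r subr0 (wproj_quad_eq0 w0 hP).
  have [sP _ _] := hP.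
  have e : (P *m C k)^T *m C k = (((C k)^T *m P *m C k) 0 0)%:M.
    by rewrite trmx_mul sP -mx11_scalar.
  by rewrite mulmxBl -scalemxAl -(mulmxA (P *m _)) e mul_mx_scalar scalerA mulVf // scale1r subrr.
have [sP _ _] := ker_proj_wproj C k w0.
rewrite /downdate mulmxBl IH // -scalemxAl -(mulmxA (_ *m C k)) trmx_mul sP.
by rewrite -(mulmxA _ _ (C l)) IH // !mulmx0 scaler0 subr0.
Qed.

(** No direction is lost: the range is the whole common kernel within the support of [w]. With
    [ker_proj_ker] this allows the projections for two weights to be compared. *)
Lemma ker_proj_id w C k y : (forall i, 0 <= w i) ->
  (forall i, w i = 0 -> y i 0 = 0) -> (forall l, (l < k)%N -> (C l)^T *m y = 0) ->
  ker_proj w C k *m wmx w *m y = y.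
Proof.
move=> w0 y0; elim: k => [|k IH] hC /=.
  rewrite mulmx_diag; apply/colP => i; rewrite mul_diag_mx !mxE.
  have [w_i0|h] := eqVneq (w i) 0; first by rewrite y0 // mulr0.
  by rewrite mulVf // mul1r.
have IHk : ker_proj w C k *m wmx w *m y = y.
  by apply: IH => l lk; apply: hC; rewrite ltnS ltnW.
have [sP _ _] := ker_proj_wproj C k w0.
rewrite /downdate mulmxBl mulmxBl IHk -!scalemxAl.
have -> : ker_proj w C k *m C k *m (ker_proj w C k *m C k)^T *m wmx w *m y =
    ker_proj w C k *m C k *m ((C k)^T *m (ker_proj w C k *m wmx w *m y)).
  by rewrite [in (_ *m C k)^T]trmx_mul sP !mulmxA.
by rewrite IHk hC // !mulmx0 scaler0 subr0.
Qed.

(** The sum is the trace of the projection [P W], hence its rank. Each downdate lowers it by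
    [s^-1 * s], which is 0 or 1, and is 0 for a null constraint. *)
Lemma ker_proj_trace w C k : (forall i, 0 <= w i) ->
  \sum_i w i * ker_proj w C k i i >=
    (\sum_i (w i != 0)%:R) - (\sum_(l < k) (C l != 0)%:R).
Proof.
move=> w0; elim: k => [|k IH] /=.
  rewrite big_ord0 subr0; apply: ler_sum => i _; rewrite !mxE eqxx mulr1n.
  by have [->|h] := eqVneq (w i) 0; rewrite ?mul0r // mulfV.
rewrite big_ord_recr /= opprD addrA.
suff h : \sum_i w i * ker_proj w C k i i - (C k != 0)%:R <=
   \sum_i w i * downdate (ker_proj w C k) (C k) i i.
  by apply: le_trans h; rewrite lerD2r.
have hP := ker_proj_wproj C k w0; set P := ker_proj w C k in hP *.
set s := ((C k)^T *m P *m C k) 0 0.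
have -> : \sum_i w i * downdate P (C k) i i = \sum_i w i * P i i - s^-1 * s.
  rewrite [X in s^-1 * X](wproj_quad _ _ hP) mulr_sumr -sumrB.
  apply: eq_bigr => i _; rewrite /downdate -/s.
  have -> : (P - s^-1 *: (P *m C k *m (P *m C k)^T)) i i =
      P i i - s^-1 * ((P *m C k) i 0 * (P *m C k) i 0).
    have -> (M : 'M[R]_n) : (P - s^-1 *: M) i i = P i i - s^-1 * M i i by rewrite !mxE.
    by rewrite mxE big_ord1 [_^T _ _]mxE.
  ring.
rewrite lerD2l lerN2; have [C0|_] := eqVneq (C k) 0.
  by rewrite /s C0 mulmx0 !mxE mulr0.
by have [->|s0] := eqVneq s 0; rewrite ?mulr0 // mulVf.
Qed.

(** The inequality [P <= W^-1], obtained by expanding the weighted squared norm of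
    [W^-1 b - P b]. *)
Lemma wproj_bessel w P b : (forall i, 0 <= w i) -> is_wproj w P ->
  (b^T *m P *m b) 0 0 <= \sum_i b i 0 ^+ 2 / w i.
Proof.
move=> w0 hP.
have h0 : 0 <= \sum_i w i * (b i 0 / w i - (P *m b) i 0) ^+ 2.
  by apply: sumr_ge0 => i _; rewrite mulr_ge0 // sqr_ge0.
have e1 : (b^T *m P *m b) 0 0 = \sum_i b i 0 * (P *m b) i 0.
  by rewrite -mulmxA mxE; apply: eq_bigr => i _; rewrite mxE.
suff e : \sum_i w i * (b i 0 / w i - (P *m b) i 0) ^+ 2 =
    (\sum_i b i 0 ^+ 2 / w i) - (b^T *m P *m b) 0 0 by rewrite -subr_ge0 -e.
have -> : (b^T *m P *m b) 0 0 =
    2 * (\sum_i b i 0 * (P *m b) i 0) -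
    \sum_i w i * ((P *m b) i 0 * (P *m b) i 0).
  by rewrite -(wproj_quad _ _ hP) -e1; ring.
rewrite mulr_sumr -!sumrB; apply: eq_bigr => i _.
have [wi0|h] := eqVneq (w i) 0; last by field.
have -> : (P *m b) i 0 = 0.
  by case: hP => _ _ hz; rewrite mxE big1 // => k _; rewrite hz // mul0r.
by rewrite wi0 invr0; ring.
Qed.

Lemma wproj_diagE w P k : is_wproj w P -> P k k = \sum_i w i * P i k ^+ 2.
Proof.
move=> hP; have [sP iP _] := hP; rewrite -[LHS](congr1 (fun M : 'M_n => M k k) iP).
rewrite /wmx mul_mx_diag mxE; apply: eq_bigr => i _; rewrite !mxE.
by rewrite -[P k i](congr1 (fun M : 'M_n => M k i) sP) mxE; ring.
Qed.

(** The column [Q e_i] of the second projection lies in the range of the first, so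
    [P W Q e_i = Q e_i]. Expanding the [w]-norm of [P e_i - Q e_i] and using [w <= w'] gives
    [0 <= P_ii - 2 Q_ii + Q_ii]. *)
Lemma ker_proj_mono w w' C k i : (forall i, 0 <= w i <= w' i) ->
  (forall i, w i = 0 -> w' i = 0) ->
  ker_proj w' C k i i <= ker_proj w C k i i.
Proof.
move=> ww h0; have w0 j : 0 <= w j by case/andP: (ww j).
have w'0 j : 0 <= w' j by case/andP: (ww j) => /le_trans; apply.
have hP := ker_proj_wproj C k w0; have hQ := ker_proj_wproj C k w'0.
have kQ l : (l < k)%N -> ker_proj w' C k *m C l = 0 by apply: ker_proj_ker.
set P := ker_proj w C k in hP *; set Q := ker_proj w' C k in hQ kQ *.
have [sP iP zP] := hP; have [sQ iQ zQ] := hQ.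
pose y := col i Q.
have Py : P *m wmx w *m y = y.
  apply: ker_proj_id => // [j wj|l lk]; first by rewrite mxE zQ // h0.
  apply: trmx_inj; rewrite trmx_mul trmxK trmx0.
  by rewrite tr_col sQ -row_mul kQ // row0.
have Pyi : \sum_j w j * (P i j * Q j i) = Q i i.
  transitivity ((P *m wmx w *m y) i 0); last by rewrite Py mxE.
  rewrite /wmx mul_mx_diag mxE; apply: eq_bigr => j _; rewrite !mxE; ring.
have : 0 <= \sum_j w j * (P j i - Q j i) ^+ 2.
  by apply: sumr_ge0 => j _; rewrite mulr_ge0 // sqr_ge0.
have -> : \sum_j w j * (P j i - Q j i) ^+ 2 =
    \sum_j w j * P j i ^+ 2 - 2 * (\sum_j w j * (P i j * Q j i)) +
    \sum_j w j * Q j i ^+ 2.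
  rewrite mulr_sumr -sumrB -big_split /=; apply: eq_bigr => j _.
  by rewrite -[P i j](congr1 (fun M : 'M_n => M i j) sP) mxE; ring.
have le2 : \sum_j w j * Q j i ^+ 2 <= \sum_j w' j * Q j i ^+ 2.
  by apply: ler_sum => j _; rewrite ler_wpM2r ?sqr_ge0 //; case/andP: (ww j).
rewrite Pyi -(wproj_diagE _ hP) => le1.
by move: le2; rewrite -(wproj_diagE _ hQ); lra.
Qed.

End WeightedProjection.

(** * The random step *)

Section StepSize.
Variables (R : realFieldType) (n : nat).
Implicit Types (x v : 'cV[R]_n) (k : R).

Definition cube x := forall i, 0 <= x i 0 <= 1.
Definition alive x i := 0 < x i 0 < 1.
Definition l1norm v : R := \sum_i `|v i 0|.

Definition hit_time x v i : R :=
  if 0 < v i 0 then (1 - x i 0) / v i 0 else - (x i 0 / v i 0).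

(** The minimum starts from the time [k / l1norm v] at which the l1 cap is met. It is 0 for [v = 0],
    which makes a step along a null direction void. *)
Definition step_size k x v : R :=
  \big[Num.min/k / l1norm v]_(i | v i 0 != 0) hit_time x v i.

Lemma step_size_le_cap k x v : step_size k x v <= k / l1norm v.
Proof. exact: bigmin_le_id. Qed.

Lemma step_size_le k x v i : v i 0 != 0 -> step_size k x v <= hit_time x v i.
Proof. by move=> h; apply: bigmin_le_cond. Qed.

Lemma step_size_attained k x v :
  step_size k x v = k / l1norm v \/
  exists2 i, v i 0 != 0 & step_size k x v = hit_time x v i.
Proof.
rewrite /step_size; elim/big_rec: _ => [|i y hi IH]; first by left.
case: (leP (hit_time x v i) y) => _; first by right; exists i.
exact: IH.
Qed.

(** Recognises the result of a running minimum; the program computes the step sizes that way. *)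
Lemma step_size_unique k x v s : s <= k / l1norm v ->
  (forall i, v i 0 != 0 -> s <= hit_time x v i) ->
  (s = k / l1norm v \/ exists2 i, v i 0 != 0 & s = hit_time x v i) ->
  s = step_size k x v.
Proof.
move=> h1 h2 h3; apply/eqP; rewrite eq_le; apply/andP; split.
  by case: (step_size_attained k x v) => [->|[i hi ->]] //; apply: h2.
by case: h3 => [->|[i hi ->]]; [apply: step_size_le_cap | apply: step_size_le].
Qed.

Lemma l1norm_ge0 v : 0 <= l1norm v.
Proof. by apply: sumr_ge0. Qed.

Lemma l1norm_gt0 v : v != 0 -> 0 < l1norm v.
Proof.
move=> v0; rewrite lt_neqAle l1norm_ge0 andbT eq_sym; apply: contra v0.
rewrite psumr_eq0 // => /allP h; apply/eqP/colP => i; rewrite mxE.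
by apply/eqP; rewrite -normr_eq0; apply: h; rewrite mem_index_enum.
Qed.

Lemma l1normN v : l1norm (- v) = l1norm v.
Proof. by apply: eq_bigr => i _; rewrite mxE normrN. Qed.

Variables (x v : 'cV[R]_n) (k : R).
Hypotheses (xc : cube x) (k0 : 0 < k).
Hypothesis dead0 : forall i, ~~ alive x i -> v i 0 = 0.

Lemma hit_time_gt0 i : v i 0 != 0 -> 0 < hit_time x v i.
Proof.
move=> vi; have /andP[x0 x1] : alive x i by apply: contraNT vi => /dead0 ->.
rewrite /hit_time; case: (ltrgt0P (v i 0)) vi => // h _.
  by rewrite divr_gt0 // subr_gt0.
by rewrite oppr_gt0 pmulr_rlt0 // invr_lt0.
Qed.

Lemma step_size_ge0 : 0 <= step_size k x v.
Proof.
case: (step_size_attained k x v) => [->|[i hi ->]].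
  by rewrite divr_ge0 ?l1norm_ge0 ?ltW.
exact/ltW/hit_time_gt0.
Qed.

Lemma step_size_gt0 : v != 0 -> 0 < step_size k x v.
Proof.
move=> v0; case: (step_size_attained k x v) => [->|[i hi ->]].
  by rewrite divr_gt0 ?l1norm_gt0.
exact: hit_time_gt0.
Qed.

Lemma step_size0 : v = 0 -> step_size k x v = 0.
Proof.
move=> v0; case: (step_size_attained k x v) => [->|[i hi _]].
  by rewrite v0 /l1norm big1 ?invr0 ?mulr0 // => i _; rewrite mxE normr0.
by move: hi; rewrite v0 mxE eqxx.
Qed.

Lemma step_size_l1 : step_size k x v * l1norm v <= k.
Proof.
case: (eqVneq v 0) => v0; first by rewrite step_size0 // mul0r ltW.
by rewrite -ler_pdivlMr ?l1norm_gt0 // step_size_le_cap.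
Qed.

Lemma step_size_cube : cube (x + step_size k x v *: v).
Proof.
move=> i; rewrite !mxE; have /andP[x0 x1] := xc i.
have s0 := step_size_ge0.
have [vi|vi|->] := ltrgt0P (v i 0); last by rewrite mulr0 addr0 x0.
- have := @step_size_le k x v i; rewrite /hit_time vi gt_eqF // => /(_ isT).
  rewrite ler_pdivlMr // => h; apply/andP; split; last lra.
  by rewrite addr_ge0 // mulr_ge0 // ltW.
- have := @step_size_le k x v i; rewrite /hit_time (lt_gtF vi) lt_eqF // => /(_ isT).
  rewrite -mulrN -invrN ler_pdivlMr ?oppr_gt0 // => h; apply/andP; split; first lra.
  have : step_size k x v * v i 0 <= 0 by rewrite mulr_ge0_le0 // ltW.
  lra.
Qed.

Lemma step_size_tight : v != 0 ->
  step_size k x v * l1norm v = k \/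
  exists2 i, alive x i & ~~ alive (x + step_size k x v *: v) i.
Proof.
move=> v0; case: (step_size_attained k x v) => [->|[i hi e]].
  by left; rewrite divfK // gt_eqF // l1norm_gt0.
right; exists i; first by apply: contraNT hi => /dead0 ->.
rewrite /alive !mxE e /hit_time; case: ifP => _.
  by rewrite divfK // addrCA subrr addr0 ltxx andbF.
by rewrite mulNr divfK // subrr ltxx.
Qed.

End StepSize.

(** * The multiplicities, the projection and the random direction at a point *)

Section Step.
Variables (R : realType) (m n : nat) (a : nat -> 'cV[R]_n) (t delta : R).
Variables (K cap : nat).
Implicit Types (x : 'cV[R]_n) (c : {ffun 'I_n -> nat}).

Definition nalive x : nat := (\sum_i alive x i)%N.

(** Index [m] stands for the radial constraint. A constraint that does not apply is the null vector,
    which leaves the projection unchanged. *)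
Definition constraint x r : 'cV[R]_n :=
  if (r < m)%N then
    if (\sum_(i | alive x i) `|a r i 0|) * (1 - delta) <= t then 0 else a r
  else if (nalive x <= K)%N then 0 else \col_i (x i 0 - 2^-1).

Definition variance x i : R := x i 0 * (1 - x i 0).
(** A frozen coordinate has variance 0, hence weight 0 by [0^-1 = 0], and the projection never moves
    it. *)
Definition weight x c i : R := (c i)%:R / variance x i.
Definition proj x c : 'M[R]_n := ker_proj (weight x c) (constraint x) m.+1.

Definition sweep x c : {ffun 'I_n -> nat} :=
  [ffun i => if (weight x c i * proj x c i i < delta / 4) && (c i < cap)%N
             then (c i).+1 else c i].

Definition mult x := iter (n * cap) (sweep x) [ffun=> 1%N].

Definition dir x k : 'cV[R]_n := col k (proj x (mult x)).
Definition fwd x k := step_size K%:R x (dir x k).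
Definition bwd x k := step_size K%:R x (- dir x k).
Definition rate x k := weight x (mult x) k / (fwd x k * bwd x k).
Definition total_rate x := \sum_k rate x k.

(* Direction [dir x k] is chosen with probability [rate x k / total_rate x]. *)
Definition step_avg (G : 'cV[R]_n -> R) x : R :=
  if total_rate x == 0 then G x else
  \sum_k rate x k / total_rate x *
    (bwd x k / (fwd x k + bwd x k) * G (x + fwd x k *: dir x k) +
     fwd x k / (fwd x k + bwd x k) * G (x - bwd x k *: dir x k)).

Hypotheses (delta0 : 0 <= delta) (delta1 : delta < 1) (K0 : (0 < K)%N).
Hypothesis cap0 : (0 < n)%N -> (0 < cap)%N.
Hypothesis col_a : forall i, \sum_(r < m) `|a r i 0| <= t.

Lemma variance_gt0 x i : alive x i -> 0 < variance x i.
Proof. by case/andP=> h0 h1; rewrite mulr_gt0 // subr_gt0. Qed.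

Lemma variance_ge0 x i : cube x -> 0 <= variance x i.
Proof. by move=> /(_ i) /andP[h0 h1]; rewrite mulr_ge0 // subr_ge0. Qed.

Lemma variance_dead x i : cube x -> ~~ alive x i -> variance x i = 0.
Proof.
move=> /(_ i); rewrite /alive /variance => /andP[]; rewrite !le_eqVlt.
by case/orP=> [/eqP <-|->]; [rewrite mul0r | case/orP=> [/eqP ->|->] //; rewrite subrr mulr0].
Qed.

Section AtPoint.
Variable x : 'cV[R]_n.
Hypothesis xc : cube x.

Lemma mult_gt0 i : (0 < mult x i)%N.
Proof.
rewrite /mult; elim: (n * cap)%N i => [|k IH] i /=; first by rewrite ffunE.
by rewrite ffunE; case: ifP.
Qed.

Lemma mult_le_cap i : (mult x i <= maxn 1 cap)%N.
Proof.
rewrite /mult; elim: (n * cap)%N i => [|k IH] i /=; first by rewrite ffunE leq_maxl.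
by rewrite ffunE; case: ifP => // /andP[_ h]; rewrite leq_max h orbT.
Qed.

(** Every sweep that changes something raises the sum of the multiplicities, which starts at [n] and
    never exceeds [n * cap]; so [n * cap] sweeps reach a fixed point. *)
Lemma sweep_mult : sweep x (mult x) = mult x.
Proof.
pose sumc (c : {ffun 'I_n -> nat}) := (\sum_i c i)%N.
have inc c i : (c i <= sweep x c i)%N by rewrite ffunE; case: ifP.
have key k : let c := iter k (sweep x) [ffun=> 1%N] in
   sweep x c = c \/ (k + n <= sumc c)%N.
  elim: k => [|k [IH|IH]] /=.
  - right; rewrite /sumc (eq_bigr (fun=> 1%N)); last by move=> i _; rewrite ffunE.
    by rewrite sum_nat_const card_ord muln1.
  - by left; rewrite !IH.
  set c := iter k _ _ in IH *; have [e|/eqP ne] := eqVneq (sweep x c) c.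
    by left; rewrite !e.
  right; rewrite addSn; apply: (leq_ltn_trans IH).
  have /existsP[i hi] : [exists i, sweep x c i != c i].
    apply: contra_notT ne; rewrite negb_exists => /forallP h.
    by apply/ffunP => i; apply/eqP; rewrite -[_ == _]negbK h.
  rewrite /sumc (bigD1 i) //= [X in (_ < X)%N](bigD1 i) //= -addSn.
  by apply: leq_add; [rewrite ltn_neqAle eq_sym hi inc | apply: leq_sum].
have [n0|n_gt0] := posnP n.
  by apply/ffunP => i; exfalso; have := ltn_ord i; lia.
have [//|h] := key (n * cap)%N; exfalso.
have : (sumc (mult x) <= n * cap)%N.
  rewrite -[X in (_ <= X * _)%N](card_ord n) -sum_nat_const.
  apply: leq_sum => i _; apply: leq_trans (mult_le_cap i) _.
  by rewrite geq_max leqnn cap0.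
by rewrite -/(mult x) in h; lia.
Qed.

Lemma weight_ge0 c i : 0 <= weight x c i.
Proof. by rewrite divr_ge0 // variance_ge0. Qed.

Lemma weight_eq0 i : (weight x (mult x) i == 0) = ~~ alive x i.
Proof.
rewrite mulf_eq0 pnatr_eq0 eqn0Ngt mult_gt0 invr_eq0 /=.
have [h|h] := boolP (alive x i); last by rewrite variance_dead // eqxx.
by rewrite gt_eqF // variance_gt0.
Qed.

Let w := weight x (mult x).
Let P := proj x (mult x).

Lemma proj_wproj c : is_wproj (weight x c) (proj x c).
Proof. by apply: ker_proj_wproj => i; apply: weight_ge0. Qed.

Lemma dirE k i : dir x k i 0 = P i k.
Proof. by rewrite [LHS]mxE. Qed.

Lemma proj_sym i j : P i j = P j i.
Proof.
have [sP _ _] := proj_wproj (mult x).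
by rewrite -[LHS](congr1 (fun M : 'M_n => M i j) sP) [LHS]mxE.
Qed.

Lemma dir_dead k i : ~~ alive x i -> dir x k i 0 = 0.
Proof.
rewrite -weight_eq0 => /eqP h; rewrite dirE /P.
by have [_ _ ->] := proj_wproj (mult x).
Qed.

Lemma mult_saturated i :
  delta / 4 <= w i * P i i \/ (cap <= mult x i)%N.
Proof.
have := congr1 (fun f : {ffun 'I_n -> nat} => f i) sweep_mult.
rewrite ffunE; case: ifP => [_|/negbT]; first by lia.
by rewrite negb_and -leNgt -leqNgt => /orP.
Qed.

(* Raising a multiplicity at most doubles the leverage [weight i * proj i i] of
   its coordinate, and can only lower the other leverages. *)
Lemma mult_gt1 i : (1 < mult x i)%N -> w i * P i i < delta / 2.
Proof.
rewrite /w /P /mult; elim: (n * cap)%N i => [|k IH] i /=; first by rewrite ffunE.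
have c0 : forall i, (0 < iter k (sweep x) [ffun=> 1%N] i)%N.
  by elim: (k) => [|k' IH'] j /=; rewrite ffunE //; case: ifP.
set c := iter k _ _ in c0 IH *; move=> h1.
have mono : proj x (sweep x c) i i <= proj x c i i.
  apply: ker_proj_mono => j.
    rewrite weight_ge0 ler_wpM2r ?invr_ge0 ?variance_ge0 // ler_nat ffunE.
    by case: ifP.
  move/eqP; rewrite mulf_eq0 pnatr_eq0 eqn0Ngt c0 /= => /eqP h.
  by rewrite /weight h mulr0.
have P0 : 0 <= proj x (sweep x c) i i.
  rewrite (wproj_diagE _ (proj_wproj _)); apply: sumr_ge0 => j _.
  by rewrite mulr_ge0 ?weight_ge0 ?sqr_ge0.
have := weight_ge0 c i; have := weight_ge0 (sweep x c) i.
move: h1; rewrite /weight [sweep x c i]ffunE; case: ifP => [/andP[h2 _]|_] h1 w1 w2.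
  have h3 : (c i).+1%:R / variance x i <= 2 * weight x c i.
    rewrite mulrA ler_wpM2r ?invr_ge0 ?variance_ge0 // -natrM ler_nat.
    by have := c0 i; lia.
  have h4 : (c i).+1%:R / variance x i * proj x (sweep x c) i i <=
    2 * weight x c i * proj x c i i.
    by apply: ler_pM.
  by move: h2; rewrite -mulrA in h4; lra.
by apply: le_lt_trans (IH i h1); rewrite ler_wpM2l.
Qed.

Lemma dir_constraint k r : (r <= m)%N -> (constraint x r)^T *m dir x k = 0.
Proof.
move=> rm; apply: trmx_inj; rewrite trmx_mul trmxK trmx0 /dir tr_col.
have [-> _ _] := proj_wproj (mult x).
by rewrite -row_mul ker_proj_ker ?row0 // => i; apply: weight_ge0.
Qed.

Definition big x r : bool :=
  ~~ ((\sum_(i | alive x i) `|a r i 0|) * (1 - delta) <= t).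

Lemma dir_big k r : (r < m)%N -> big x r -> (a r)^T *m dir x k = 0.
Proof.
move=> rm /negbTE br; have := dir_constraint k (ltnW rm).
by rewrite /constraint rm br.
Qed.

Lemma dir_radial k : (K < nalive x)%N ->
  \sum_i (x i 0 - 2^-1) * dir x k i 0 = 0.
Proof.
rewrite ltnNge => /negbTE h; have := dir_constraint k (leqnn m).
rewrite /constraint ltnn h => /matrixP/(_ 0 0); rewrite mxE [RHS]mxE => {2}<-.
by apply: eq_bigr => i _; rewrite !mxE.
Qed.

(** Double counting of the mass on alive columns: a big row carries more than [t / (1 - delta)], all
    columns together at most [t * nalive x]. Strictness is what leaves a direction when
    [delta = 0]. *)
Lemma big_count : (0 < nalive x)%N ->
  \sum_(r < m) (big x r)%:R < (1 - delta) * (nalive x)%:R :> R.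
Proof.
move=> na; have d1 : 0 < 1 - delta by rewrite subr_gt0.
have na0 : 0 < (nalive x)%:R :> R by rewrite ltr0n.
have [i0] : exists i, alive x i.
  apply/existsP; apply: contraTT na; rewrite negb_exists -eqn0Ngt => /forallP h.
  by rewrite /nalive big1 // => i _; rewrite (negbTE (h i)).
move=> _; have t0 : 0 <= t by apply: le_trans (col_a i0); apply: sumr_ge0.
pose S r := \sum_(i | alive x i) `|a r i 0|.
have S0 r : 0 <= S r by apply: sumr_ge0.
have sumS : \sum_(r < m) S r <= t * (nalive x)%:R.
  rewrite /S exchange_big /= natr_sum mulr_sumr [X in X <= _]big_mkcond /=.
  apply: ler_sum => i _; case: ifP => _; last by rewrite mulr0.
  by rewrite mulr1 col_a.
have [/existsP[r0 br0]|/existsPn nb] := boolP [exists r : 'I_m, big x r]; last first.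
  by rewrite big1 ?mulr_gt0 // => r _; rewrite (negbTE (nb r)).
have lt1 : (\sum_(r < m) (big x r)%:R) * t < (\sum_(r < m) S r) * (1 - delta).
  rewrite !mulr_suml (bigD1 r0) //= [X in _ < X](bigD1 r0) //= br0 mul1r.
  apply: ltr_leD; first by move: br0; rewrite /big -ltNge.
  apply: ler_sum => r _; case: (boolP (big x r)); last first.
    by move=> _; rewrite mul0r mulr_ge0 // ltW.
  by rewrite /big -ltNge mul1r => /ltW.
have lt2 : (\sum_(r < m) S r) * (1 - delta) <= t * (nalive x)%:R * (1 - delta).
  by rewrite ler_wpM2r // ltW.
have tp : 0 < t.
  rewrite lt_neqAle t0 andbT eq_sym; apply/eqP => te.
  rewrite te mulr0 in lt1; rewrite te !mul0r in lt2.
  by have := lt_le_trans lt1 lt2; rewrite ltxx.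
rewrite -(ltr_pM2r tp); apply: lt_le_trans lt1 _; apply: le_trans lt2 _.
by rewrite le_eqVlt; apply/orP; left; apply/eqP; ring.
Qed.

Hypothesis K_large : forall q, (K < q <= n)%N -> 4 <= delta * q%:R.

Lemma nalive_le : (nalive x <= n)%N.
Proof.
rewrite /nalive -[X in (_ <= X)%N]card_ord -sum1_card.
by apply: leq_sum => i _; case: alive.
Qed.

(** The trace bound: [nalive x] dimensions, minus the big rows, minus one for the radial constraint
    when it is active. *)
Lemma leverage_gt : (0 < nalive x)%N ->
  delta * (nalive x)%:R - (K < nalive x)%N%:R < \sum_i w i * P i i.
Proof.
move=> na; apply: lt_le_trans (ker_proj_trace (constraint x) m.+1 (weight_ge0 _)).
have -> : \sum_i (w i != 0)%:R = (nalive x)%:R :> R.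
  by rewrite natr_sum; apply: eq_bigr => i _; rewrite weight_eq0 negbK.
rewrite big_ord_recr /=.
have h1 : \sum_(r < m) (constraint x r != 0)%:R <= \sum_(r < m) (big x r)%:R :> R.
  apply: ler_sum => r _; rewrite /constraint ltn_ord /big.
  by case: ifP => _ /=; rewrite ?eqxx // ler_nat; case: (_ != _).
have h2 : (constraint x m != 0)%:R <= (K < nalive x)%N%:R :> R.
  rewrite /constraint ltnn ltnNge; case: ifP => _ /=; rewrite ?eqxx // ler_nat.
  by case: (_ != _).
have := big_count na; lra.
Qed.

Lemma leverage_gt0 : (0 < nalive x)%N -> 0 < \sum_i w i * P i i.
Proof.
move=> na; apply: le_lt_trans (leverage_gt na).
case: ltnP => h /=; last by rewrite subr0 mulr_ge0.
by have := K_large (q := nalive x); rewrite h nalive_le => /(_ isT); lra.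
Qed.

Lemma proj_diag_ge0 i : 0 <= P i i.
Proof.
rewrite (wproj_diagE _ (proj_wproj _)); apply: sumr_ge0 => j _.
by rewrite mulr_ge0 ?weight_ge0 ?sqr_ge0.
Qed.

Lemma dir_alive k : dir x k != 0 -> alive x k.
Proof.
apply: contraNT; rewrite -weight_eq0 => /eqP h; apply/eqP/colP => i.
rewrite dirE proj_sym [RHS]mxE; have [_ _ h0] := proj_wproj (mult x).
exact: h0.
Qed.

Lemma dirN_dead k i : ~~ alive x i -> (- dir x k) i 0 = 0.
Proof. by move=> /dir_dead h; rewrite mxE h oppr0. Qed.

Let KR0 : 0 < K%:R :> R. Proof. by rewrite ltr0n. Qed.

Lemma fwd_ge0 k : 0 <= fwd x k.
Proof. exact: step_size_ge0 KR0 (dir_dead k). Qed.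

Lemma bwd_ge0 k : 0 <= bwd x k.
Proof. exact: step_size_ge0 KR0 (dirN_dead k). Qed.

Lemma fwd_gt0 k : dir x k != 0 -> 0 < fwd x k.
Proof. exact: step_size_gt0 KR0 (dir_dead k). Qed.

Lemma bwd_gt0 k : dir x k != 0 -> 0 < bwd x k.
Proof. by move=> h; apply: (step_size_gt0 KR0 (dirN_dead k)); rewrite oppr_eq0. Qed.

Lemma rate_ge0 k : 0 <= rate x k.
Proof.
apply: divr_ge0; first exact: weight_ge0.
by apply: mulr_ge0; [apply: fwd_ge0 | apply: bwd_ge0].
Qed.

Lemma rate_gt0 k : dir x k != 0 -> 0 < rate x k.
Proof.
move=> h; apply: divr_gt0; last first.
  by apply: mulr_gt0; [apply: fwd_gt0 | apply: bwd_gt0].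
by rewrite lt_neqAle weight_ge0 andbT eq_sym weight_eq0 negbK dir_alive.
Qed.

Lemma rate_eq0 k : dir x k = 0 -> rate x k = 0.
Proof. by move=> h; rewrite /rate /fwd step_size0 // mul0r invr0 mulr0. Qed.

Lemma total_ge0 : 0 <= total_rate x.
Proof. by apply: sumr_ge0 => k _; apply: rate_ge0. Qed.

(** [fwd * bwd] is the variance factor of the two-point step along a direction. The division in
    [rate] cancels it, so that direction [k] contributes with weight [w k]. *)
Lemma dir_sqr_rate k (g : 'cV[R]_n) :
  rate x k * (fwd x k * bwd x k * dot g (dir x k) ^+ 2) = w k * dot g (dir x k) ^+ 2.
Proof.
have [h|h] := eqVneq (dir x k) 0.
  by rewrite h /dot big1 ?expr0n ?mulr0 // => i _; rewrite mxE mulr0.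
rewrite /rate -/w; field.
by rewrite !gt_eqF ?fwd_gt0 ?bwd_gt0.
Qed.

Lemma total_gt0 : (0 < nalive x)%N -> 0 < total_rate x.
Proof.
move=> na; rewrite lt_neqAle total_ge0 andbT.
have := leverage_gt0 na; apply: contraTN => /eqP z; rewrite -leNgt.
have r0 k : rate x k = 0.
  apply/eqP; have /eqP := esym z; rewrite psumr_eq0 => [|i _]; last exact: rate_ge0.
  by move/allP/(_ k); rewrite mem_index_enum; apply.
apply: sumr_le0 => k _; have h : dir x k = 0.
  by apply/eqP; apply: contraT => /rate_gt0; rewrite r0 ltxx.
by rewrite -dirE h mxE mulr0.
Qed.

Lemma total_eq0 : nalive x = 0%N -> total_rate x = 0.
Proof.
move=> na; apply: big1 => k _; apply: rate_eq0; apply/eqP; apply: contraT => /dir_alive h.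
by move: na; rewrite /nalive (bigD1 k) //= h.
Qed.

(** * Moments and possible outcomes of a step *)

Definition step_mean (F : 'cV[R]_n -> R) :=
  \sum_k rate x k / total_rate x *
    (bwd x k / (fwd x k + bwd x k) * F (fwd x k *: dir x k) +
     fwd x k / (fwd x k + bwd x k) * F (- (bwd x k *: dir x k))).

Lemma step_avgE G : total_rate x != 0 -> step_avg G x = step_mean (fun y => G (x + y)).
Proof. by move=> /negbTE h; rewrite /step_avg h. Qed.

Definition outcome (y : 'cV[R]_n) := exists2 k, dir x k != 0 &
  y = fwd x k *: dir x k \/ y = - (bwd x k *: dir x k).

Lemma step_mean_le F H : (forall y, outcome y -> F y <= H y) ->
  step_mean F <= step_mean H.
Proof.
move=> h; apply: ler_sum => k _; have [d0|d0] := eqVneq (dir x k) 0.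
  by rewrite rate_eq0 // !mul0r.
have f0 := fwd_gt0 d0; have b0 := bwd_gt0 d0.
apply: ler_wpM2l; first by rewrite divr_ge0 ?total_ge0 ?rate_ge0.
apply: lerD; apply: ler_wpM2l; rewrite ?divr_ge0 ?addr_ge0 ?(ltW f0) ?(ltW b0) //;
  by apply: h; exists k => //; by [left|right].
Qed.

Lemma eq_step_mean F H : (forall y, outcome y -> F y = H y) ->
  step_mean F = step_mean H.
Proof. by move=> h; apply/eqP; rewrite eq_le !step_mean_le // => y /h ->. Qed.

Lemma step_meanD F H : step_mean (fun y => F y + H y) = step_mean F + step_mean H.
Proof. by rewrite -big_split /=; apply: eq_bigr => k _; ring. Qed.

Lemma step_meanZ r F : step_mean (fun y => r * F y) = r * step_mean F.
Proof. by rewrite mulr_sumr; apply: eq_bigr => k _; ring. Qed.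

Lemma step_mean_sum (I : finType) (F : I -> 'cV[R]_n -> R) :
  step_mean (fun y => \sum_i F i y) = \sum_i step_mean (F i).
Proof.
rewrite /step_mean exchange_big /=; apply: eq_bigr => k _.
by rewrite -mulr_sumr big_split /= !mulr_sumr.
Qed.

Lemma step_mean_cst r : total_rate x != 0 -> step_mean (fun=> r) = r.
Proof.
move=> z; transitivity (\sum_k rate x k / total_rate x * r); last first.
  by rewrite -mulr_suml -mulr_suml mulfV // mul1r.
apply: eq_bigr => k _; have [d0|d0] := eqVneq (dir x k) 0.
  by rewrite rate_eq0 // !mul0r.
have f0 := fwd_gt0 d0; have b0 := bwd_gt0 d0.
by field; rewrite z gt_eqF // addr_gt0.
Qed.

Lemma dotZr (g y : 'cV[R]_n) r : dot g (r *: y) = r * dot g y.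
Proof. by rewrite /dot mulr_sumr; apply: eq_bigr => i _; rewrite mxE; ring. Qed.

Lemma dotNr (g y : 'cV[R]_n) : dot g (- y) = - dot g y.
Proof. by rewrite -scaleN1r dotZr mulN1r. Qed.

Lemma step_mean_lin g : step_mean (dot g) = 0.
Proof.
apply: big1 => k _; rewrite dotNr !dotZr.
have -> : bwd x k / (fwd x k + bwd x k) * (fwd x k * dot g (dir x k)) +
  fwd x k / (fwd x k + bwd x k) * - (bwd x k * dot g (dir x k)) = 0 by ring.
by rewrite mulr0.
Qed.

(** The columns of [P], weighted by [w k], have the sum of outer products [P W P = P]: the step has
    covariance [P / total_rate x]. *)
Lemma step_mean_sqr g :
  step_mean (fun y => dot g y ^+ 2) = (g^T *m P *m g) 0 0 / total_rate x.
Proof.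
rewrite (wproj_quad _ _ (proj_wproj _)) mulr_suml; apply: eq_bigr => k _.
have -> : (P *m g) k 0 = dot g (dir x k).
  by rewrite mxE; apply: eq_bigr => i _; rewrite dirE proj_sym mulrC.
rewrite -expr2 -/w -dir_sqr_rate dotNr !dotZr.
have [d0|d0] := eqVneq (dir x k) 0; first by rewrite rate_eq0 // !mul0r.
have f0 := fwd_gt0 d0; have b0 := bwd_gt0 d0.
have s0 : fwd x k + bwd x k != 0 by rewrite gt_eqF // addr_gt0.
set D := dot g (dir x k).
have -> : bwd x k / (fwd x k + bwd x k) * (fwd x k * D) ^+ 2 +
  fwd x k / (fwd x k + bwd x k) * (- (bwd x k * D)) ^+ 2 =
  fwd x k * bwd x k * D ^+ 2 by field.
by ring.
Qed.

Lemma step_mean_coord_sqr i : step_mean (fun y => y i 0 ^+ 2) = P i i / total_rate x.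
Proof.
pose e : 'cV[R]_n := delta_mx i 0.
have ee y : dot e y = y i 0.
  rewrite /dot (bigD1 i) //= big1 => [|j /negbTE ji]; rewrite !mxE ?ji ?mul0r //.
  by rewrite !eqxx mul1r addr0.
rewrite (eq_step_mean (H := fun y => dot e y ^+ 2)); last by move=> y _; rewrite ee.
rewrite step_mean_sqr -mulmxA; congr (_ / _).
by rewrite trmx_delta -rowE -colE [LHS]mxE [LHS]mxE.
Qed.

Lemma outcome_cube y : outcome y -> cube (x + y).
Proof.
case=> k d0 [->|->]; first exact: step_size_cube xc KR0 (dir_dead k).
by rewrite -scalerN; apply: step_size_cube xc KR0 (dirN_dead k).
Qed.

Lemma outcome_dead y i : outcome y -> ~~ alive x i -> y i 0 = 0.
Proof.
case=> k d0 [->|->] h; first by rewrite mxE dir_dead ?mulr0.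
by rewrite -scalerN mxE dirN_dead ?mulr0.
Qed.

Lemma l1normZ r (v : 'cV[R]_n) : 0 <= r -> l1norm (r *: v) = r * l1norm v.
Proof.
move=> r0; rewrite /l1norm mulr_sumr; apply: eq_bigr => i _.
by rewrite mxE normrM ger0_norm.
Qed.

Lemma outcome_l1 y : outcome y -> l1norm y <= K%:R.
Proof.
case=> k d0 [->|->]; first by rewrite l1normZ ?fwd_ge0 // step_size_l1.
by rewrite -scalerN l1normZ ?bwd_ge0 // step_size_l1.
Qed.

Lemma outcome_tight y : outcome y ->
  l1norm y = K%:R \/ exists2 i, alive x i & ~~ alive (x + y) i.
Proof.
case=> k d0 [->|->].
  by rewrite l1normZ ?fwd_ge0 //; apply: step_size_tight (dir_dead k) d0.
rewrite -scalerN l1normZ ?bwd_ge0 //.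
by apply: (step_size_tight _ (dirN_dead k)); rewrite oppr_eq0.
Qed.

Lemma outcome_big y r : outcome y -> (r < m)%N -> big x r -> dot (a r) y = 0.
Proof.
move=> [k d0 h] rm br; have : dot (a r) (dir x k) = 0.
  have /matrixP/(_ 0 0) := dir_big k rm br; rewrite mxE [RHS]mxE => h0; rewrite -[RHS]h0.
  by apply: eq_bigr => i _; rewrite [(a r)^T _ _]mxE.
by case: h => ->; rewrite ?dotNr !dotZr => ->; rewrite mulr0 ?oppr0.
Qed.

Lemma outcome_radial y : outcome y -> (K < nalive x)%N ->
  \sum_i (x i 0 - 2^-1) * y i 0 = 0.
Proof.
move=> [k d0 h] lK; pose g : 'cV[R]_n := \col_i (x i 0 - 2^-1).
have e (z : 'cV[R]_n) : \sum_i (x i 0 - 2^-1) * z i 0 = dot g z.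
  by apply: eq_bigr => i _; rewrite mxE.
have : dot g (dir x k) = 0 by rewrite -e dir_radial.
by rewrite e; case: h => ->; rewrite ?dotNr !dotZr => ->; rewrite mulr0 ?oppr0.
Qed.

Lemma outcome_nalive y : outcome y -> (nalive (x + y) <= nalive x)%N.
Proof.
move=> oy; apply: leq_sum => i _; have [h|h] := boolP (alive x i); first by case: alive.
by rewrite /alive mxE (outcome_dead oy h) addr0 -/(alive x i) (negbTE h).
Qed.

Lemma outcome_freeze y i : outcome y -> alive x i -> ~~ alive (x + y) i ->
  (nalive (x + y) < nalive x)%N.
Proof.
move=> oy h1 h2; rewrite /nalive (bigD1 i) //= [X in (_ < X)%N](bigD1 i) //=.
rewrite h1 (negbTE h2) add0n add1n ltnS; apply: leq_sum => j _.
have [h|h] := boolP (alive x j); first by case: alive.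
by rewrite /alive mxE (outcome_dead oy h) addr0 -/(alive x j) (negbTE h).
Qed.

(** Both end points stay in the cube, on opposite sides of [x]: one of the two displacements of
    coordinate [i] is at most [x_i], the other at most [1 - x_i]. *)
Lemma dir_sqr_le_variance k i : fwd x k * bwd x k * dir x k i 0 ^+ 2 <= variance x i.
Proof.
have /andP[] := step_size_cube xc KR0 (dir_dead k) i; rewrite -/(fwd x k).
have /andP[] := step_size_cube xc KR0 (dirN_dead k) i; rewrite -/(bwd x k).
have colE (z v : 'cV[R]_n) r : (z + r *: v) i 0 = z i 0 + r * v i 0 by rewrite !mxE.
have oppE : (- dir x k) i 0 = - dir x k i 0 by rewrite [LHS]mxE.
rewrite !colE oppE mulrN; have := fwd_ge0 k; have := bwd_ge0 k; rewrite /variance.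
set f := fwd x k; set b := bwd x k; set v := dir x k i 0; set z := x i 0.
have /andP[z0 z1] := xc i; rewrite -/z in z0 z1 * => b0 f0 h1 h2 h3 h4.
have -> : f * b * v ^+ 2 = (f * v) * (b * v) by ring.
have [v0|v0] := leP 0 v.
  rewrite mulrC; apply: ler_pM; rewrite ?mulr_ge0 //; lra.
have -> : f * v * (b * v) = (f * - v) * (b * - v) by ring.
by apply: ler_pM; rewrite ?mulr_ge0 ?oppr_ge0 ?(ltW v0) //; lra.
Qed.

(** The average leverage exceeds [delta / 2], so some coordinate reaches it, and by [mult_gt1] its
    multiplicity is 1. There [P_ii] is a sum of rates times [fwd * bwd * dir_i^2], hence at most
    [total_rate x * variance x i], while [P_ii / variance x i] is the leverage. *)
Lemma total_ge : 0 < delta -> (K < nalive x)%N -> delta / 2 <= total_rate x.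
Proof.
move=> d0 lK; have na : (0 < nalive x)%N by apply: leq_ltn_trans lK.
have [i hi] : exists i, delta / 2 <= w i * P i i.
  apply/existsP; apply: contraT; rewrite negb_exists => /forallP h.
  have : \sum_i w i * P i i <= \sum_(i | alive x i) delta / 2.
    rewrite [X in _ <= X]big_mkcond; apply: ler_sum => i _; case: ifP => al.
      by move: (h i); rewrite -ltNge => /ltW.
    by move/negbT: al; rewrite -weight_eq0 -/w => /eqP ->; rewrite mul0r.
  have -> : \sum_(i | alive x i) delta / 2 = (nalive x)%:R * (delta / 2).
    rewrite natr_sum mulr_suml big_mkcond; apply: eq_bigr => i _.
    by case: ifP; rewrite ?mul1r ?mul0r.
  (* As [delta * nalive x >= 4], subtracting 1 for the radial constraint still leaves more than
     [delta * nalive x / 2]. *)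
  have := leverage_gt na; rewrite lK /=.
  by have := K_large (q := nalive x); rewrite lK nalive_le => /(_ isT); lra.
have ci : mult x i = 1%N.
  apply/eqP; rewrite eqn_leq mult_gt0 andbT leqNgt; apply/negP => /mult_gt1.
  by rewrite ltNge hi.
have vi : 0 < variance x i.
  apply: variance_gt0; apply: contraLR hi; rewrite -weight_eq0 -/w => /eqP ->.
  by rewrite mul0r -ltNge divr_gt0.
have : P i i <= total_rate x * variance x i.
  rewrite (wproj_diagE _ (proj_wproj _)) mulr_suml; apply: ler_sum => k _.
  have := dir_sqr_rate k (delta_mx i 0).
  have -> : dot (delta_mx i 0) (dir x k) = dir x k i 0.
    rewrite /dot (bigD1 i) //= big1 => [|j /negbTE ji]; last by rewrite mxE ji mul0r.
    by rewrite [delta_mx _ _ _ _]mxE !eqxx mul1r addr0.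
  rewrite -/P proj_sym -dirE -/w => <-.
  by rewrite ler_wpM2l ?rate_ge0 // dir_sqr_le_variance.
move: hi; rewrite /w /weight ci mul1r => hi hP.
rewrite -(ler_pM2r vi); apply: le_trans hP.
by rewrite [leLHS]mulrC -ler_pdivlMl.
Qed.

Lemma sqr_sum_le (p : pred 'I_n) (f : 'I_n -> R) :
  (\sum_(i | p i) f i) ^+ 2 <= (\sum_i p i)%N%:R * \sum_(i | p i) f i ^+ 2.
Proof.
set N := (\sum_i p i)%N; set S := \sum_(i | p i) f i.
have cardN : N%:R = \sum_(i | p i) 1 :> R.
  by rewrite natr_sum [RHS]big_mkcond; apply: eq_bigr => i _; case: (p i).
have [N0|Npos] := posnP N.
  have pF i : p i = false.
    by apply/negbTE; apply: contra_eqN N0 => h; rewrite /N (bigD1 i) //= h.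
  by rewrite /S big_pred0 // expr0n N0 mul0r.
have N_gt0 : 0 < N%:R :> R by rewrite ltr0n.
have : 0 <= \sum_(i | p i) (N%:R * f i - S) ^+ 2 by apply: sumr_ge0 => i _; apply: sqr_ge0.
have alg (c z : R) : \sum_(i | p i) (c * f i - z) ^+ 2 =
    c ^+ 2 * (\sum_(i | p i) f i ^+ 2) - 2 * c * z * (\sum_(i | p i) f i) +
    z ^+ 2 * (\sum_(i | p i) 1).
  by rewrite !mulr_sumr -sumrB -big_split /=; apply: eq_bigr => i _; ring.
rewrite alg -cardN -/S.
move=> h; rewrite -(ler_pM2l N_gt0); nra.
Qed.

(** With at most [K] alive coordinates this is Cauchy-Schwarz, outcome by outcome. Otherwise the
    Bessel bound replaces [P] by the inverse weights, each of which is at most [4 / delta * P i i],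
    or at most [variance x i / cap] if the multiplicity is at the cap. The factor 1/2 in the last
    term comes from [1 / total_rate <= 2 / delta <= K / 2]. *)
Lemma step_mean_sqr_le g : 0 < delta -> 4 / delta <= K%:R -> (0 < nalive x)%N ->
  step_mean (fun y => dot g y ^+ 2) <=
    K%:R * (\sum_i g i 0 ^+ 2 * step_mean (fun y => y i 0 ^+ 2)) +
    K%:R / (2 * cap%:R) * (\sum_i g i 0 ^+ 2 * variance x i).
Proof.
move=> d0 Kd na; have n0 : (0 < n)%N by apply: leq_trans na nalive_le.
have cap_gt0 : 0 < cap%:R :> R by rewrite ltr0n cap0.
have var0 i := variance_ge0 i xc.
have [hK|lK] := leqP (nalive x) K.
  have slack : 0 <= K%:R / (2 * cap%:R) * (\sum_i g i 0 ^+ 2 * variance x i).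
    rewrite mulr_ge0 ?divr_ge0 ?mulr_ge0 ?(ltW cap_gt0) //; apply: sumr_ge0 => i _.
    by rewrite mulr_ge0 ?sqr_ge0.
  rewrite -[leLHS]addr0; apply: lerD; last exact: slack.
  have -> : K%:R * (\sum_i g i 0 ^+ 2 * step_mean (fun y => y i 0 ^+ 2)) =
     step_mean (fun y => \sum_i K%:R * (g i 0 ^+ 2 * y i 0 ^+ 2)).
    rewrite step_mean_sum mulr_sumr; apply: eq_bigr => i _.
    by rewrite !step_meanZ.
  apply: step_mean_le => y oy.
  have -> : dot g y = \sum_(i | alive x i) g i 0 * y i 0.
    rewrite /dot [RHS]big_mkcond; apply: eq_bigr => i _; case: ifP => // /negbT al.
    by rewrite (outcome_dead oy al) mulr0.
  apply: le_trans (sqr_sum_le _ _) _.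
  rewrite -mulr_sumr; apply: ler_pM => //; first by apply: sumr_ge0 => i _; apply: sqr_ge0.
    by rewrite ler_nat.
  rewrite [X in X <= _]big_mkcond; apply: ler_sum => i _; rewrite -exprMn.
  by case: ifP => // _; rewrite sqr_ge0.
have tot := total_ge d0 lK; have tot0 : 0 < total_rate x by apply: total_gt0.
rewrite step_mean_sqr.
have hb := wproj_bessel g (weight_ge0 (mult x)) (proj_wproj (mult x)).
rewrite -/w -/P in hb.
have var_cap i : 0 <= variance x i / cap%:R.
  by apply: divr_ge0; [apply: var0 | apply: ltW].
have P_d i : 0 <= 4 / delta * P i i.
  by apply: mulr_ge0; [rewrite divr_ge0 ?ltW | apply: proj_diag_ge0].
have inv_w i : (w i)^-1 <= 4 / delta * P i i + variance x i / cap%:R.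
  have [al|al] := boolP (alive x i); last first.
    have /eqP -> : w i == 0 by rewrite weight_eq0.
    by rewrite invr0; apply: addr_ge0.
  have wi : 0 < w i by rewrite lt_neqAle weight_ge0 andbT eq_sym weight_eq0 negbK.
  have [h|h] := mult_saturated i.
    apply: (@le_trans _ _ (4 / delta * P i i)); last by rewrite lerDl.
    rewrite -(ler_pM2l wi) mulfV ?gt_eqF // mulrCA -ler_pdivrMl ?divr_gt0 //.
    by rewrite mulr1 invf_div.
  apply: (@le_trans _ _ (variance x i / cap%:R)); last first.
    by rewrite lerDr.
  rewrite /w /weight invf_div ler_wpM2l ?var0 // lef_pV2 ?posrE ?ltr0n ?mult_gt0 ?ler_nat //.
  by rewrite -(ltr0n R).
apply: (@le_trans _ _ ((\sum_i g i 0 ^+ 2 * (4 / delta * P i i + variance x i / cap%:R))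
   / total_rate x)).
  rewrite ler_pM2r ?invr_gt0 //; apply: le_trans hb _; apply: ler_sum => i _.
  by rewrite ler_wpM2l ?sqr_ge0.
rewrite mulr_suml !mulr_sumr -big_split /=; apply: ler_sum => i _.
rewrite step_mean_coord_sqr mulrDr mulrDl; apply: lerD.
  have -> : g i 0 ^+ 2 * (4 / delta * P i i) / total_rate x =
    4 / delta * (g i 0 ^+ 2 * (P i i / total_rate x)) by ring.
  by rewrite ler_wpM2r // mulr_ge0 ?sqr_ge0 // divr_ge0 ?proj_diag_ge0 ?ltW.
have -> : g i 0 ^+ 2 * (variance x i / cap%:R) / total_rate x =
  (total_rate x)^-1 / cap%:R * (g i 0 ^+ 2 * variance x i) by ring.
apply: ler_wpM2r; first by apply: mulr_ge0; [apply: sqr_ge0 | apply: var0].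
rewrite invfM mulrA; apply: ler_wpM2r; first by rewrite invr_ge0 ltW.
have : (total_rate x)^-1 <= (delta / 2)^-1 by rewrite lef_pV2 ?posrE ?divr_gt0.
have -> : (delta / 2)^-1 = 4 / delta / 2 by field; rewrite gt_eqF.
move=> h; lra.
Qed.

End AtPoint.

(** * Iterating the step: termination and discrepancy *)

Section Iteration.
Hypothesis K_large : forall q, (K < q <= n)%N -> 4 <= delta * q%:R.
Hypothesis t0 : 0 <= t.
Variable x0 : 'cV[R]_n.

Definition energy x : R := \sum_i (x i 0 - 2^-1) ^+ 2.

(** An upper bound on the number of moves still possible: freezing steps are charged to [nalive],
    the others to the distance of [energy] from its maximum [n / 4], scaled so that such a step
    costs at least 1. *)
Definition remaining x : R := (nalive x)%:R +
  (if (nalive x <= K)%N then 0 else n%:R * (n%:R / 4 - energy x)).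

(* Either the row has been constrained so far, or it has been free only since
   some point [y] at which its mass on the alive coordinates was small. *)
Definition row_ok r x := dot (a r) (x - x0) = 0 \/
  exists y, [/\ cube y, dot (a r) (y - x0) = 0, ~~ big y r &
    forall i, ~~ alive y i -> x i 0 = y i 0].

Definition walk_inv l x :=
  [/\ cube x, remaining x <= l%:R & forall r, (r < m)%N -> row_ok r x].

Lemma dotDr (g y z : 'cV[R]_n) : dot g (y + z) = dot g y + dot g z.
Proof. by rewrite /dot -big_split /=; apply: eq_bigr => i _; rewrite mxE mulrDr. Qed.

Lemma energy_le x : cube x -> energy x <= n%:R / 4.
Proof.
move=> xc; have -> : n%:R / 4 = \sum_(i < n) 4^-1 :> R.
  by rewrite sumr_const card_ord mulr_natl.
by apply: ler_sum => i _; have /andP[h1 h2] := xc i; nra.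
Qed.

Lemma energyD x y : energy (x + y) =
  energy x + 2 * (\sum_i (x i 0 - 2^-1) * y i 0) + \sum_i y i 0 ^+ 2.
Proof.
rewrite /energy mulr_sumr -!big_split /=; apply: eq_bigr => i _; rewrite mxE; ring.
Qed.

Lemma outcome_lt1 x y i : cube x -> outcome x y -> alive x i -> `|y i 0| < 1.
Proof.
move=> xc oy /andP[h1 h2]; have := outcome_cube xc oy i; rewrite mxE => /andP[h3 h4].
by rewrite ltr_norml; apply/andP; split; lra.
Qed.

Lemma outcome_l1_lt x y : cube x -> outcome x y -> (0 < nalive x)%N ->
  l1norm y < (nalive x)%:R.
Proof.
move=> xc oy na; have [i0 al] : exists i, alive x i.
  apply/existsP; apply: contraTT na; rewrite negb_exists -eqn0Ngt => /forallP h.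
  by rewrite /nalive big1 // => i _; rewrite (negbTE (h i)).
rewrite /nalive natr_sum /l1norm (bigD1 i0) //= [X in _ < X](bigD1 i0) //= al.
apply: ltr_leD; first exact: outcome_lt1 oy al.
apply: ler_sum => i _; have [h|h] := boolP (alive x i).
  by rewrite ltW // (outcome_lt1 xc oy h).
by rewrite (outcome_dead xc oy h) normr0.
Qed.

Lemma nalive_gt0 x : total_rate x != 0 -> cube x -> (0 < nalive x)%N.
Proof.
by move=> h xc; rewrite lt0n; apply: contra h => /eqP h; rewrite total_eq0.
Qed.

(** A step of l1-norm [K] needs more than [K] alive coordinates, as each moves by less than 1. It is
    then orthogonal to [x - 1/2], so [energy] grows by its squared length, at least
    [K^2 / n >= 1 / n] by Cauchy-Schwarz. *)
Lemma outcome_remaining x y : cube x -> total_rate x != 0 -> outcome x y ->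
  remaining (x + y) <= remaining x - 1.
Proof.
move=> xc tx oy; have na := nalive_gt0 tx xc.
have xyc := outcome_cube xc oy; have le' := outcome_nalive xc oy.
have lt1 q q' : (q < q')%N -> q%:R <= q'%:R - 1 :> R.
  by move=> h; rewrite lerBrDr natr1 ler_nat.
rewrite /remaining; have [hK|lK] := leqP (nalive x) K.
  rewrite (leq_trans le' hK) !addr0; apply: lt1.
  have [e|[i h1 h2]] := outcome_tight xc oy; last exact: outcome_freeze oy h1 h2.
  have := outcome_l1_lt xc oy na; rewrite e ltr_nat; lia.
have rad := outcome_radial xc oy lK.
have n0 : 0 <= n%:R :> R by [].
have slack : 0 <= n%:R * (n%:R / 4 - energy x).
  by rewrite mulr_ge0 // subr_ge0 energy_le.
have [hK'|lK'] := leqP (nalive (x + y)) K.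
  have := lt1 _ _ (leq_ltn_trans hK' lK); lra.
rewrite energyD rad mulr0 addr0.
have y2 : 0 <= n%:R * \sum_i y i 0 ^+ 2 :> R.
  by rewrite mulr_ge0 //; apply: sumr_ge0 => i _; apply: sqr_ge0.
have [e|[i h1 h2]] := outcome_tight xc oy; last first.
  by have := lt1 _ _ (outcome_freeze xc oy h1 h2); lra.
have : 1 <= n%:R * \sum_i y i 0 ^+ 2 :> R.
  have : (l1norm y) ^+ 2 <= n%:R * \sum_i `|y i 0| ^+ 2.
    have := sqr_sum_le predT (fun i => `|y i 0|).
    by rewrite sum_nat_const card_ord muln1.
  rewrite e; under eq_bigr do rewrite real_normK ?num_real //.
  apply: le_trans; rewrite -natrX (ler_nat _ 1) expn_gt0 K0 //.
have : (nalive (x + y))%:R <= (nalive x)%:R :> R by rewrite ler_nat.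
lra.
Qed.

(** A big row is orthogonal to the step and keeps discrepancy 0. When it is first found small, the
    present point becomes the witness of [row_ok]; coordinates frozen there never move again. *)
Lemma inv_outcome l x y : walk_inv l.+1 x -> total_rate x != 0 -> outcome x y -> walk_inv l (x + y).
Proof.
move=> [xc pot rows] tx oy; split; first exact: outcome_cube oy.
  have := outcome_remaining xc tx oy; move: pot; rewrite -natr1; lra.
move=> r rm; have [d0|[z [zc dz bz fz]]] := rows r rm.
  have [br|br] := boolP (big x r).
    by left; rewrite addrAC dotDr d0 (outcome_big xc oy rm br) addr0.
  by right; exists x; split => // i al; rewrite mxE (outcome_dead xc oy al) addr0.
right; exists z; split=> // i al; have e := fz i al.
have al' : ~~ alive x i by rewrite /alive e.
by rewrite mxE (outcome_dead xc oy al') addr0.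
Qed.

Lemma inv_stay l x : walk_inv l.+1 x -> total_rate x == 0 -> walk_inv l x.
Proof.
move=> [xc pot rows] /eqP tx; split=> //.
have : nalive x = 0%N.
  by apply/eqP; rewrite eqn0Ngt; apply/negP => /(total_gt0 xc K_large); rewrite tx ltxx.
by rewrite /remaining => ->; rewrite addr0 ler0n.
Qed.

Lemma step_avg_le l F H x : walk_inv l.+1 x -> (forall y, walk_inv l y -> F y <= H y) ->
  step_avg F x <= step_avg H x.
Proof.
move=> ix FH; have [tx|tx] := boolP (total_rate x == 0).
  by rewrite /step_avg tx; apply: FH; apply: inv_stay tx.
have [xc _ _] := ix; rewrite !step_avgE //; apply: step_mean_le => // y oy.
by apply: FH; apply: inv_outcome oy.
Qed.

Lemma iter_avg_le L F H x : walk_inv L x -> (forall y, walk_inv 0 y -> F y <= H y) ->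
  iter L step_avg F x <= iter L step_avg H x.
Proof.
move=> ix FH; elim: L x ix => [|L IH] x ix /=; first exact: FH.
by apply: (step_avg_le ix) => y; apply: IH.
Qed.

Lemma eq_iter_avg L F H x : walk_inv L x -> (forall y, walk_inv 0 y -> F y = H y) ->
  iter L step_avg F x = iter L step_avg H x.
Proof.
by move=> ix FH; apply/eqP; rewrite eq_le !iter_avg_le // => y /FH ->.
Qed.

(** [Phi l] is the potential with [l] steps still to go. *)
Lemma iter_avg_supermartingale L (Phi : nat -> 'cV[R]_n -> R) x : walk_inv L x ->
  (forall l y, (l < L)%N -> walk_inv l.+1 y -> step_avg (Phi l) y <= Phi l.+1 y) ->
  iter L step_avg (Phi 0%N) x <= Phi L x.
Proof.
elim: L x => [|L IH] x ix H //=; apply: le_trans (H L x (ltnSn _) ix).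
apply: (step_avg_le ix) => y iy; apply: IH => // l z lL; apply: H.
exact: ltnW.
Qed.

Lemma iter_avg_lin L (g : 'cV[R]_n) r x : walk_inv L x ->
  iter L step_avg (fun y => dot g y + r) x = dot g x + r.
Proof.
elim: L x => [//|L IH] x ix /=.
have e F : (forall y, walk_inv L y -> F y = dot g y + r) -> step_avg F x = dot g x + r.
  move=> HF; rewrite (_ : step_avg F x = step_avg (fun y => dot g y + r) x); last first.
    by apply/eqP; rewrite eq_le !(step_avg_le ix) // => y /HF ->.
  have [xc _ _] := ix; have [tx|tx] := boolP (total_rate x == 0).
    by rewrite /step_avg tx.
  rewrite step_avgE // (eq_step_mean xc (H := fun y => dot g y + (dot g x + r))).
    by rewrite step_meanD step_mean_lin // step_mean_cst // add0r.
  by move=> y _; rewrite dotDr; ring.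
by apply: e => y; apply: IH.
Qed.

(** The energy term of [remaining] is nonnegative, so the bound 0 leaves no alive coordinate. *)
Lemma inv0_integral x : walk_inv 0 x -> exists X : {ffun 'I_n -> bool}, x = vec01 R X.
Proof.
case=> xc pot _; have na : nalive x = 0%N.
  apply/eqP; rewrite eqn0Ngt; apply/negP => h; move: pot; apply/negP; rewrite -ltNge.
  rewrite /remaining; apply: ltr_pwDl; first by rewrite ltr0n.
  by case: ifP => _ //; rewrite mulr_ge0 // subr_ge0 energy_le.
exists [ffun i => x i 0 == 1]; apply/colP => i; rewrite mxE ffunE.
have al : alive x i = false.
  by apply/negbTE/negP => h; move: na; rewrite /nalive (bigD1 i) //= h.
move: al (xc i); rewrite /alive => /negbT; rewrite negb_and -!leNgt.
case/orP=> h /andP[h1 h2].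
  have -> : x i 0 = 0 by apply/eqP; rewrite eq_le h h1.
  by rewrite eq_sym oner_eq0.
have -> : x i 0 = 1 by apply/eqP; rewrite eq_le h h2.
by rewrite eqxx.
Qed.

(** Since the witness [y] the row has only felt coordinates alive at [y], each displaced by at most
    1, so its discrepancy is at most its mass there. *)
Lemma inv_discrepancy l x r : walk_inv l x -> (r < m)%N ->
  `|dot (a r) (x - x0)| <= t / (1 - delta).
Proof.
have d1 : 0 < 1 - delta by rewrite subr_gt0.
move=> [xc _ rows] rm; case: (rows r rm) => [->|[y [yc dy]]].
  by rewrite normr0 divr_ge0 // ltW.
rewrite /big negbK ler_pdivlMr // => small fz; apply: le_trans small.
rewrite ler_pM2r //.
have -> : x - x0 = (y - x0) + (x - y) by rewrite [RHS]addrC addrA addrNK.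
rewrite dotDr dy add0r; apply: le_trans (ler_norm_sum _ _ _) _.
rewrite [X in _ <= X]big_mkcond; apply: ler_sum => i _; rewrite normrM !mxE.
case: ifP => [al|/negbT/fz ->]; last by rewrite subrr normr0 mulr0.
rewrite ler_piMr //; have /andP[h1 h2] := xc i; have /andP[h3 h4] := yc i.
by rewrite ler_norml; apply/andP; split; lra.
Qed.

(** The initial value is at most [n + n^2 / 4]; [n (n + 1)] is a larger number that two nested loops
    can count. *)
Lemma inv_start : cube x0 -> walk_inv (n * n.+1) x0.
Proof.
move=> xc; split=> //; last first.
  by move=> r _; left; rewrite subrr /dot big1 // => i _; rewrite mxE mulr0.
have e0 : 0 <= energy x0 by apply: sumr_ge0 => i _; apply: sqr_ge0.
have h1 : (nalive x0)%:R <= n%:R :> R by rewrite ler_nat nalive_le.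
have n0 : 0 <= n%:R :> R by [].
have nn0 : 0 <= n%:R * n%:R :> R by rewrite mulr_ge0.
have ne0 : 0 <= n%:R * energy x0 by rewrite mulr_ge0.
rewrite /remaining natrM -[n.+1%:R]natr1; case: ifP => _; lra.
Qed.

(** * Exponential moments of the walk *)

Section Potential.
Variables (h : 'cV[R]_n) (theta M : R).
Hypotheses (delta_gt0 : 0 < delta) (K_delta : 4 / delta <= K%:R).
Hypotheses (theta0 : 0 <= theta) (hM : forall i, `|h i 0| <= M).
Hypothesis thetaM : theta * M * (36 * K%:R) <= 1.

(** It ranges from [18 K] to [36 K] over [cap] steps. The 18 is 16 times 9/8: the second moment
    costs [16 K], and 8/9 of the quadratic drop is available to pay for it. *)
Definition coef (l : nat) : R := 18 * K%:R * (1 + l%:R / cap%:R).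

Definition potential l x : R :=
  expR (theta * dot h x + theta ^+ 2 * coef l * \sum_i h i 0 ^+ 2 * variance x i).

(** From [exp (- u) >= 1 - u] one gets [exp u <= 1 / (1 - u)], and [(1 + u + 2 u^2) (1 - u) >= 1]
    for [u <= 1 / 2]. *)
Lemma expR_le_quad (u : R) : u <= 1 / 2 -> expR u <= 1 + u + 2 * u ^+ 2.
Proof.
move=> hu; have h1 := expR_ge1Dx (- u); have e0 := expR_gt0 u.
have e1 : expR u * expR (- u) = 1 by rewrite -expRD subrr expR0.
have h2 : expR u * (1 - u) <= 1 by rewrite -[leRHS]e1 ler_wpM2l // ltW.
have u1 : 0 < 1 - u by lra.
rewrite -(ler_pM2r u1); apply: le_trans h2 _.
have -> : (1 + u + 2 * u ^+ 2) * (1 - u) = 1 + u ^+ 2 * (1 - 2 * u) by ring.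
by rewrite lerDl mulr_ge0 ?sqr_ge0 //; lra.
Qed.

Lemma cube_dev (y : 'cV[R]_n) i : cube y -> `|1 - 2 * y i 0| <= 1.
Proof.
move=> /(_ i) /andP[]; move: (y i 0) => z z0 z1.
by rewrite ler_norml; apply/andP; split; lra.
Qed.

(** The drop [- y_i^2] in the variances pays for the main part of the second-order term of the
    exponential; the increase [18 K / cap] of the coefficient pays for the error term of
    [step_mean_sqr_le]. *)
Lemma potential_step l x : (l < cap)%N -> walk_inv l.+1 x ->
  step_avg (potential l) x <= potential l.+1 x.
Proof.
move=> lcap ix; have [xc _ _] := ix.
have c_gt0 : 0 < cap%:R :> R by rewrite ltr0n; apply: leq_ltn_trans lcap.
have K1 : 1 <= K%:R :> R by rewrite (ler_nat _ 1).
set S := \sum_i h i 0 ^+ 2 * variance x i.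
have S0 : 0 <= S.
  by apply: sumr_ge0 => i _; rewrite mulr_ge0 ?sqr_ge0 ?variance_ge0.
have coefS : coef l.+1 = coef l + 18 * K%:R / cap%:R.
  by rewrite /coef -natr1; field; rewrite gt_eqF.
have potS : potential l.+1 x =
    potential l x * expR (theta ^+ 2 * (18 * K%:R / cap%:R) * S).
  by rewrite /potential -/S -expRD coefS; congr expR; ring.
have gain0 : 0 <= theta ^+ 2 * (18 * K%:R / cap%:R) * S.
  by rewrite !mulr_ge0 ?sqr_ge0 ?invr_ge0 ?(ltW c_gt0) //; lra.
have [tx|tx] := boolP (total_rate x == 0).
  rewrite /step_avg tx potS ler_peMr ?expR_ge0 //.
  by rewrite -[leLHS]expR0 ler_expR.
have na := nalive_gt0 tx xc.
have [c cE] : {c | c = coef l} by exists (coef l).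
have lc : l%:R / cap%:R <= 1 :> R by rewrite ler_pdivrMr // mul1r ler_nat ltnW.
have lc0 : 0 <= l%:R / cap%:R :> R by rewrite divr_ge0 // ltW.
have c1 : 18 * K%:R <= c by rewrite cE /coef ler_peMr //; lra.
have c2 : c <= 36 * K%:R.
  have -> : 36 * K%:R = 18 * K%:R * 2 :> R by ring.
  by rewrite cE /coef ler_wpM2l //; lra.
have c0 : 0 <= c by lra.
have M0 : 0 <= M.
  have [i _|none] := pickP (fun _ : 'I_n => true); first exact: le_trans (hM i).
  by move: na; rewrite /nalive big_pred0.
(* Linear and quadratic parts of the change in the exponent under a move [y]: the variance of
   coordinate [i] changes by [(1 - 2 x_i) y_i - y_i^2]. *)
pose g : 'cV[R]_n := \col_i (theta * h i 0 + theta ^+ 2 * c * h i 0 ^+ 2 * (1 - 2 * x i 0)).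
pose Q (y : 'cV[R]_n) := theta ^+ 2 * c * \sum_i h i 0 ^+ 2 * y i 0 ^+ 2.
have potD y : potential l (x + y) = potential l x * expR (dot g y - Q y).
  rewrite /potential -expRD; congr expR; rewrite -cE /Q /dot !mulr_sumr -!sumrB.
  rewrite -!big_split /=; apply: eq_bigr => i _; rewrite /variance !mxE; ring.
have g_le i : `|g i 0| <= 2 * (theta * `|h i 0|).
  have -> : g i 0 = theta * h i 0 * (1 + theta * c * h i 0 * (1 - 2 * x i 0)).
    by rewrite mxE; ring.
  rewrite normrM [`|theta * _|]normrM (ger0_norm theta0) mulrC ler_wpM2r ?mulr_ge0 //.
  apply: le_trans (ler_normD _ _) _; rewrite normr1 -[leRHS]/(1 + 1) lerD2l.
  rewrite 2!normrM [`|theta * c|]ger0_norm ?mulr_ge0 //.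
  have x1 := cube_dev i xc.
  apply: le_trans (_ : theta * c * `|h i 0| * 1 <= _).
    by rewrite ler_wpM2l // !mulr_ge0.
  rewrite mulr1; apply: le_trans thetaM; rewrite [leRHS]mulrAC.
  by apply: ler_pM; rewrite ?mulr_ge0 // ler_wpM2l.
have g_sqr i : g i 0 ^+ 2 <= 4 * theta ^+ 2 * h i 0 ^+ 2.
  rewrite -real_normK ?num_real // -[h i 0 ^+ 2]real_normK ?num_real //.
  have -> : 4 * theta ^+ 2 * `|h i 0| ^+ 2 = (2 * (theta * `|h i 0|)) ^+ 2 by ring.
  by rewrite lerXn2r ?nnegrE ?mulr_ge0.
(* The quadratic term satisfies [2 (g.y - Q)^2 <= 4 (g.y)^2 + 4 Q^2], and [Q <= 1 / 36] makes
   [4 Q^2] at most [Q / 9], which leaves [- 8 / 9 Q]. *)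
have small y : outcome x y -> expR (dot g y - Q y) <=
    1 + dot g y + 4 * dot g y ^+ 2 - 8 / 9 * Q y.
  move=> oy; have yK := outcome_l1 xc oy.
  have y1 i : `|y i 0| <= 1.
    have [al|al] := boolP (alive x i); first exact/ltW/(outcome_lt1 xc oy al).
    by rewrite (outcome_dead xc oy al) normr0.
  have thM0 : 0 <= theta * M by rewrite mulr_ge0.
  have u : theta * M * l1norm y <= 1 / 36.
    apply: (@le_trans _ _ (theta * M * K%:R)); first by rewrite ler_wpM2l.
    have e : theta * M * (36 * K%:R) = theta * M * K%:R * 36 by ring.
    by rewrite ler_pdivlMr // -e.
  have L1 : dot g y <= 2 * (theta * M * l1norm y).
    rewrite /dot /l1norm !mulr_sumr; apply: ler_sum => i _.
    apply: le_trans (ler_norm _) _; rewrite normrM !mulrA ler_wpM2r //.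
    by apply: le_trans (g_le i) _; rewrite -!mulrA ler_wpM2l // ler_wpM2l.
  have Q0 : 0 <= Q y.
    rewrite /Q !mulr_ge0 ?sqr_ge0 //; apply: sumr_ge0 => i _.
    by rewrite mulr_ge0 ?sqr_ge0.
  have Q1 : Q y <= theta ^+ 2 * c * (M ^+ 2 * l1norm y).
    rewrite /Q ler_wpM2l ?mulr_ge0 ?sqr_ge0 // /l1norm mulr_sumr.
    apply: ler_sum => i _; apply: ler_pM; rewrite ?sqr_ge0 //.
      by rewrite -real_normK ?num_real // lerXn2r ?nnegrE.
    by rewrite -real_normK ?num_real // expr2 ler_piMr.
  have Q2 : Q y <= 1 / 36.
    apply: le_trans Q1 _; have -> : theta ^+ 2 * c * (M ^+ 2 * l1norm y) =
      (theta * M * c) * (theta * M * l1norm y) by ring.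
    apply: le_trans u; rewrite ler_piMl ?mulr_ge0 ?l1norm_ge0 //.
    by apply: le_trans thetaM; rewrite ler_wpM2l.
  apply: le_trans (expR_le_quad _) _; first lra.
  have : 0 <= (dot g y + Q y) ^+ 2 by apply: sqr_ge0.
  have : Q y * Q y <= Q y * (1 / 36) by rewrite ler_wpM2l.
  rewrite !expr2 !mulrDr !mulrDl; lra.
rewrite step_avgE // potS.
apply: (@le_trans _ _ (step_mean x (fun y => potential l x *
    (1 + (dot g y + (4 * dot g y ^+ 2 + (- (8 / 9)) * Q y)))))).
  apply: step_mean_le => // y oy; rewrite potD ler_wpM2l ?expR_ge0 //.
  by apply: le_trans (small y oy) _; lra.
rewrite step_meanZ ler_wpM2l ?expR_ge0 //.
rewrite !step_meanD step_mean_cst // step_mean_lin // !step_meanZ step_mean_sum add0r.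
set Y := fun i => step_mean x (fun y => y i 0 ^+ 2).
have -> : \sum_i step_mean x (fun y => h i 0 ^+ 2 * y i 0 ^+ 2) =
    \sum_i h i 0 ^+ 2 * Y i by apply: eq_bigr => i _; rewrite step_meanZ.
have Y0 i : 0 <= Y i.
  have <- : step_mean x (fun=> 0) = 0 by rewrite step_mean_cst.
  by apply: step_mean_le => // y _; apply: sqr_ge0.
have sumY0 : 0 <= \sum_i h i 0 ^+ 2 * Y i.
  by apply: sumr_ge0 => i _; rewrite mulr_ge0 ?sqr_ge0.
have := step_mean_sqr_le xc K_large g delta_gt0 K_delta na.
set G1 := \sum_i g i 0 ^+ 2 * Y i.
set G2 := \sum_i g i 0 ^+ 2 * variance x i => sq.
have G1le : G1 <= 4 * theta ^+ 2 * \sum_i h i 0 ^+ 2 * Y i.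
  by rewrite mulr_sumr; apply: ler_sum => i _; rewrite mulrA ler_wpM2r.
have G2le : G2 <= 4 * theta ^+ 2 * S.
  by rewrite mulr_sumr; apply: ler_sum => i _; rewrite mulrA ler_wpM2r ?variance_ge0.
have B1 : K%:R * G1 <= K%:R * (4 * theta ^+ 2 * \sum_i h i 0 ^+ 2 * Y i).
  by rewrite ler_wpM2l.
have B2 : K%:R / (2 * cap%:R) * G2 <= K%:R / (2 * cap%:R) * (4 * theta ^+ 2 * S).
  by rewrite ler_wpM2l // divr_ge0 ?mulr_ge0 // ltW.
have B3 : theta ^+ 2 * (18 * K%:R) * (\sum_i h i 0 ^+ 2 * Y i) <=
    theta ^+ 2 * c * (\sum_i h i 0 ^+ 2 * Y i).
  by rewrite ler_wpM2r // ler_wpM2l ?sqr_ge0.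
have e2 : K%:R / (2 * cap%:R) * (4 * theta ^+ 2 * S) =
    (theta ^+ 2 * (18 * K%:R / cap%:R) * S) / 9.
  by field; rewrite gt_eqF.
apply: le_trans (expR_ge1Dx _); rewrite lerD2l.
rewrite e2 in B2; lra.
Qed.

Lemma iter_exp_moment x : walk_inv cap x ->
  iter cap step_avg (fun y => expR (theta * dot h y)) x <=
  expR (theta * dot h x + theta ^+ 2 * (36 * K%:R) * \sum_i h i 0 ^+ 2 * variance x i).
Proof.
move=> ix; have [xc _ _] := ix; have S0 (y : 'cV[R]_n) : cube y ->
    0 <= \sum_i h i 0 ^+ 2 * variance y i.
  by move=> yc; apply: sumr_ge0 => i _; rewrite mulr_ge0 ?sqr_ge0 ?variance_ge0.
have k0 : 0 <= K%:R :> R by [].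
apply: le_trans (_ : iter cap step_avg (potential 0) x <= _).
  apply: iter_avg_le ix _ => y [yc _ _]; rewrite ler_expR lerDl.
  by rewrite !mulr_ge0 ?sqr_ge0 ?S0 // mul0r addr0.
apply: le_trans (iter_avg_supermartingale ix _) _.
  by move=> l y lc; apply: potential_step.
rewrite ler_expR lerD2l ler_wpM2r ?S0 // ler_wpM2l ?sqr_ge0 // /coef.
have [->|c0] := eqVneq cap 0%N; first by rewrite invr0 mulr0 addr0; lra.
by rewrite mulfV ?pnatr_eq0 //; lra.
Qed.

End Potential.
End Iteration.
End Step.

(** * The program *)

Definition rconst k := ROfI (ICst k).
Definition rsub e1 e2 := RAdd e1 (ROpp e2).
Definition rdiv e1 e2 := RMul e1 (RInv e2).
Definition scalar a := RGet a (ICst 0) (ICst 0).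
Definition set_scalar a e := PReal a (ICst 0) (ICst 0) e.
Definition vget a v := RGet a (IVar v) (ICst 0).
Definition vset a v e := PReal a (IVar v) (ICst 0) e.
Definition forn v b := PFor v 1 0 b.

(* Registers: 2, 3, 4, 6, 7, 8, 9, 12, 13 are loop variables, 5 counts the alive
   coordinates, 10 is the chosen direction and 11 receives the coins.
   Arrays: 4 is the current point, 5 the constraint rows, 6 the projection, 7
   the multiplicities, 8 a vector and 9 an accumulator; 10 and 11 are the
   forward and backward step sizes and 12 the running total of the rates. *)
Section Program.
Variable eK : iexp.

Definition alive_b v :=
  BAnd (BNot (RLe (vget 4 v) (rconst 0))) (BNot (RLe (rconst 1) (vget 4 v))).

Definition p_count := PSeq (PInt 5 (ICst 0))
  (forn 2 (PIf (alive_b 2) (PInt 5 (IAdd (IVar 5) (ICst 1))) PNop)).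

Definition add_abs e := PIf (RLe (rconst 0) e)
  (set_scalar 9 (RAdd (scalar 9) e)) (set_scalar 9 (RAdd (scalar 9) (ROpp e))).

Definition entryA := RGet 0 (IVar 4) (IVar 2).

Definition p_mass := PSeq (set_scalar 9 (rconst 0))
  (forn 2 (PIf (alive_b 2) (add_abs entryA) PNop)).

Definition p_row := PSeq p_mass
  (forn 2 (PIf (RLe (RMul (scalar 9) (rsub (rconst 1) (scalar 3))) (scalar 2))
     (PReal 5 (IVar 4) (IVar 2) (rconst 0)) (PReal 5 (IVar 4) (IVar 2) entryA))).

Definition p_last := forn 2 (PIf (ILe (IVar 5) eK)
  (PReal 5 (IVar 0) (IVar 2) (rconst 0))
  (PReal 5 (IVar 0) (IVar 2) (rsub (vget 4 2) (RInv (rconst 2))))).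

Definition p_constraints := PSeq p_count (PSeq (PFor 4 0 0 p_row) p_last).

Definition e_weight v :=
  rdiv (vget 7 v) (RMul (vget 4 v) (rsub (rconst 1) (vget 4 v))).

Definition p_diag := forn 2 (forn 3
  (PIf (BAnd (ILe (IVar 2) (IVar 3)) (ILe (IVar 3) (IVar 2)))
     (PReal 6 (IVar 2) (IVar 3) (RInv (e_weight 2)))
     (PReal 6 (IVar 2) (IVar 3) (rconst 0)))).

Definition p_mulvec := forn 2 (PSeq (vset 8 2 (rconst 0))
  (forn 3 (vset 8 2 (RAdd (vget 8 2)
     (RMul (RGet 6 (IVar 2) (IVar 3)) (RGet 5 (IVar 4) (IVar 3))))))).

Definition p_dot := PSeq (set_scalar 9 (rconst 0))
  (forn 2 (set_scalar 9 (RAdd (scalar 9) (RMul (RGet 5 (IVar 4) (IVar 2)) (vget 8 2))))).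

Definition p_rank1 := forn 2 (forn 3 (PReal 6 (IVar 2) (IVar 3)
  (rsub (RGet 6 (IVar 2) (IVar 3))
        (RMul (RInv (scalar 9)) (RMul (vget 8 2) (vget 8 3)))))).

Definition p_downdate := PSeq p_mulvec (PSeq p_dot p_rank1).

Definition p_proj := PSeq p_diag (PFor 4 0 1 p_downdate).

(** Natural-number registers have no multiplication, so [n (n + 1)] is formed as a real, like the
    multiplicities it is compared with. *)
Definition e_cap := RMul (ROfI (IVar 1)) (ROfI (IAdd (IVar 1) (ICst 1))).

Definition p_raise := forn 2 (PIf
  (BAnd (BNot (RLe (rdiv (scalar 3) (rconst 4))
                   (RMul (e_weight 2) (RGet 6 (IVar 2) (IVar 2)))))
        (BNot (RLe e_cap (vget 7 2))))
  (vset 7 2 (RAdd (vget 7 2) (rconst 1))) PNop).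

Definition p_sweep := PSeq p_proj p_raise.

(** A loop bound is a dimension plus a constant, so [n * cap] sweeps with [cap = n (n + 1)] take
    three nested loops. The last [p_proj] recomputes the projection for the final multiplicities. *)
Definition p_mult := PSeq (forn 2 (vset 7 2 (rconst 1)))
  (PSeq (forn 6 (forn 7 (PFor 8 1 1 p_sweep))) p_proj).

Definition set_min a e := PIf (RLe (scalar a) e) PNop (set_scalar a e).

Definition p_l1 v := PSeq (set_scalar 9 (rconst 0))
  (forn 2 (add_abs (RGet 6 (IVar 2) (IVar v)))).

Definition p_hits v := let e := RGet 6 (IVar 2) (IVar v) in
  forn 2 (PIf (BNot (RLe e (rconst 0)))
    (PSeq (set_min 10 (rdiv (rsub (rconst 1) (vget 4 2)) e))
          (set_min 11 (ROpp (rdiv (vget 4 2) (ROpp e)))))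
    (PIf (BNot (RLe (rconst 0) e))
      (PSeq (set_min 10 (ROpp (rdiv (vget 4 2) e)))
            (set_min 11 (rdiv (rsub (rconst 1) (vget 4 2)) (ROpp e))))
      PNop)).

Definition p_sizes v := PSeq (p_l1 v)
  (PSeq (set_scalar 10 (rdiv (ROfI eK) (scalar 9)))
  (PSeq (set_scalar 11 (rdiv (ROfI eK) (scalar 9))) (p_hits v))).

Definition p_rate := PSeq (p_sizes 9)
  (PSeq (set_scalar 9 (rdiv (e_weight 9) (RMul (scalar 10) (scalar 11))))
        (set_scalar 12 (RAdd (scalar 12) (scalar 9)))).

(** Weighted reservoir sampling: a direction replaces the current choice with probability its rate
    over the sum of the rates so far, so one pass suffices and the individual rates are not
    stored. *)
Definition p_pick := PSeq p_rate
  (PSeq (PFlip 11 (rdiv (scalar 9) (scalar 12)))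
        (PIf (ILe (ICst 1) (IVar 11)) (PInt 10 (IVar 9)) PNop)).

Definition p_choose := PSeq (set_scalar 12 (rconst 0))
  (PSeq (PInt 10 (ICst 0)) (forn 9 p_pick)).

Definition p_fwd := forn 2 (vset 4 2 (RAdd (vget 4 2)
  (RMul (scalar 10) (RGet 6 (IVar 2) (IVar 10))))).

Definition p_bwd := forn 2 (vset 4 2 (rsub (vget 4 2)
  (RMul (scalar 11) (RGet 6 (IVar 2) (IVar 10))))).

Definition p_move := PSeq (p_sizes 10)
  (PSeq (PFlip 11 (rdiv (scalar 11) (RAdd (scalar 10) (scalar 11))))
        (PIf (ILe (ICst 1) (IVar 11)) p_fwd p_bwd)).

Definition p_step := PSeq p_constraints (PSeq p_mult (PSeq p_choose p_move)).

Definition p_main := PSeq (forn 2 (vset 4 2 (vget 1 2)))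
  (forn 12 (PFor 13 1 1 p_step)).

End Program.

(** * Invariant rules for loops *)

Section Loops.
Variable R : realType.
Implicit Types (s : state R).

Definition arrays := nat -> nat -> nat -> R.

Lemma den_seq p q s : den (PSeq p q) s = den q (den p s).
Proof. by []. Qed.

Lemma den_if b p q s :
  den (PIf b p q) s = if beval s b then den p s else den q s.
Proof. by []. Qed.

Lemma den_real v i j e s i' j' : arr (den (PReal v i j e) s) v i' j' =
  if (i' == ieval s i) && (j' == ieval s j) then reval s e else arr s v i' j'.
Proof. by rewrite /= eqxx. Qed.

Lemma den_fold (Q : nat -> arrays -> Prop) v r c b s :
  v \notin mod_reg b ->
  Q 0%N (arr s) ->
  (forall k s', (k < reg s r + c)%N -> frame (v :: mod_reg b) (mod_arr b) s s' ->
     reg s' v = k -> Q k (arr s') -> Q k.+1 (arr (den b s'))) ->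
  Q (reg s r + c)%N (arr (den (PFor v r c b) s)).
Proof.
move=> vb Q0 Qs; apply: (den_for (P := fun k s' => Q k (arr s'))) => //.
Qed.

(** For loops that fill one cell per iteration: pass [k] must establish [Q k] and preserve the
    earlier ones. *)
Lemma den_fill (Q : nat -> arrays -> Prop) v r c b s :
  v \notin mod_reg b ->
  (forall k s', (k < reg s r + c)%N -> frame (v :: mod_reg b) (mod_arr b) s s' ->
     reg s' v = k ->
     Q k (arr (den b s')) /\
     (forall j, (j < k)%N -> Q j (arr s') -> Q j (arr (den b s')))) ->
  forall k, (k < reg s r + c)%N -> Q k (arr (den (PFor v r c b) s)).
Proof.
move=> vb Qs.
apply: (den_fold (Q := fun k A => forall j, (j < k)%N -> Q j A)) => // k s' kN fr rk IH j.
have [h1 h2] := Qs k s' kN fr rk.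
by rewrite ltnS leq_eqVlt => /orP[/eqP -> //|jk]; apply: h2 => //; apply: IH.
Qed.

Lemma sum_ord_ltS n k (f : 'I_n -> R) (hk : (k < n)%N) :
  \sum_(i < n | (i < k.+1)%N) f i = \sum_(i < n | (i < k)%N) f i + f (Ordinal hk).
Proof.
rewrite (bigD1 (Ordinal hk)) //= addrC; congr (_ + _); apply: eq_bigl => i.
by rewrite ltnS [in RHS]ltn_neqAle andbC.
Qed.

Lemma sum_ord_lt0 n (f : 'I_n -> R) : \sum_(i < n | (i < 0)%N) f i = 0.
Proof. by rewrite big_pred0. Qed.

Lemma sum_ord_lt_all n (f : 'I_n -> R) : \sum_(i < n | (i < n)%N) f i = \sum_i f i.
Proof. by apply: eq_bigl => i; rewrite ltn_ord. Qed.

Lemma sum_ord_ltS_nat n k (f : 'I_n -> nat) (hk : (k < n)%N) :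
  (\sum_(i < n | (i < k.+1)%N) f i = \sum_(i < n | (i < k)%N) f i + f (Ordinal hk))%N.
Proof.
rewrite (bigD1 (Ordinal hk)) //= addnC; congr (_ + _)%N; apply: eq_bigl => i.
by rewrite ltnS [in RHS]ltn_neqAle andbC.
Qed.

End Loops.

(** * The program performs one step of the walk *)

Section Spec.
Variables (R : realType) (m n : nat) (a : nat -> 'cV[R]_n) (t delta : R).
Variables (K : nat) (eK : iexp).
Hypothesis eKE : forall s : state R, reg s 1 = n -> ieval s eK = K.
Let cap := (n * n.+1)%N.

Definition base (s : state R) :=
  [/\ reg s 0 = m, reg s 1 = n,
      forall r i, (r < m)%N -> arr s 0 r (nat_of_ord i) = a r i 0,
      arr s 2 0 0 = t & arr s 3 0 0 = delta].

Definition at_point (s : state R) (x : 'cV[R]_n) :=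
  forall i : 'I_n, arr s 4 i 0 = x i 0.

Lemma base_frame rs ars s s' : frame rs ars s s' ->
  all (fun r => r \notin rs) [:: 0; 1]%N ->
  all (fun r => r \notin ars) [:: 0; 2; 3]%N -> base s -> base s'.
Proof.
case=> fr fa /and3P[r0 r1 _] /and4P[a0 a2 a3 _] [h0 h1 h2 h3 h4].
by split; rewrite ?fr ?fa.
Qed.

Lemma den_base p s : all (fun r => r \notin mod_reg p) [:: 0; 1]%N ->
  all (fun r => r \notin mod_arr p) [:: 0; 2; 3]%N -> base s -> base (den p s).
Proof. exact: base_frame (den_frame p s). Qed.

Lemma at_point_frame rs ars s s' x : frame rs ars s s' -> 4 \notin ars ->
  at_point s x -> at_point s' x.
Proof. by case=> _ fa h4 h i; rewrite fa. Qed.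

Variable x : 'cV[R]_n.

Lemma beval_alive v s (i : 'I_n) : at_point s x -> reg s v = i ->
  beval s (alive_b v) = alive x i.
Proof. by move=> hx hv; rewrite /= hv hx -!ltNge /alive. Qed.

Lemma count_spec s : base s -> at_point s x -> reg (den p_count s) 5 = nalive x.
Proof.
case=> _ h1 _ _ _ hx; rewrite /p_count den_seq.
set s1 := den _ s; have r1 : reg s1 1 = n by [].
pose Q k (s' : state R) := reg s' 5 = (\sum_(i < n | (i < k)%N) alive x i)%N.
have : Q (reg s1 1 + 0)%N (den (forn 2 (PIf (alive_b 2)
   (PInt 5 (IAdd (IVar 5) (ICst 1))) PNop)) s1).
  apply: den_for => //; first by rewrite /Q /= big_pred0.
  move=> k s'; rewrite addn0 r1 => kn fr rk; rewrite /Q => IH.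
  rewrite (sum_ord_ltS_nat _ kn) -IH den_if (@beval_alive _ _ (Ordinal kn)) //; last first.
    by apply: at_point_frame fr _ _.
  by case: ifP => _ /=; rewrite ?addn0.
rewrite /Q addn0 r1 => ->; rewrite /nalive.
by apply: eq_bigl => i; rewrite ltn_ord.
Qed.

Lemma add_abs_spec e (s : state R) : arr (den (add_abs e) s) 9 0 0 = arr s 9 0 0 + `|reval s e|.
Proof.
rewrite /add_abs den_if.
have -> : beval s (RLe (rconst 0) e) = (0 <= reval s e) by [].
case: ifP => h; rewrite /= ?(ger0_norm h) //.
by rewrite ltr0_norm // ltNge h.
Qed.

Lemma mass_spec s r : base s -> at_point s x -> reg s 4 = r -> (r < m)%N ->
  arr (den p_mass s) 9 0 0 = \sum_(i | alive x i) `|a r i 0|.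
Proof.
case=> _ h1 h2 _ _ hx hr rm; rewrite /p_mass den_seq.
set s1 := den _ s; have r1 : reg s1 1 = n by [].
pose Q k (A : arrays R) :=
  A 9%N 0%N 0%N = \sum_(i < n | (i < k)%N) (if alive x i then `|a r i 0| else 0).
have : Q (reg s1 1 + 0)%N (arr (den (forn 2 (PIf (alive_b 2) (add_abs entryA) PNop)) s1)).
  apply: den_fold => //; first by rewrite /Q sum_ord_lt0.
  move=> k s'; rewrite addn0 r1 => kn fr rk; rewrite /Q => IH.
  rewrite (sum_ord_ltS _ kn) -IH den_if (@beval_alive _ _ (Ordinal kn)) //; last first.
    by apply: at_point_frame fr _ _.
  case: ifP => _; last by rewrite /= addr0.
  have [frr fra] := fr; have e4 : reg s' 4 = r by rewrite frr.
  by rewrite add_abs_spec /= rk e4 (fra 0%N) // /s1 den_arr // (h2 r (Ordinal kn)).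
rewrite /Q addn0 r1 sum_ord_lt_all => ->.
by rewrite -big_mkcond.
Qed.

Lemma row_spec s r (i : 'I_n) : base s -> at_point s x -> reg s 4 = r -> (r < m)%N ->
  arr (den p_row s) 5 r i = constraint m a t delta K x r i 0 /\
  (forall r', r' != r -> arr (den p_row s) 5 r' = arr s 5 r').
Proof.
move=> bs hx hr rm; have hm := mass_spec bs hx hr rm; have [_ h1 h2 h3 h4] := bs.
rewrite /p_row den_seq; set s1 := den p_mass s in hm *.
have r1 : reg s1 1 = n by rewrite den_reg.
have r4 : reg s1 4 = r by rewrite den_reg.
have a0 : arr s1 0 = arr s 0 by rewrite den_arr.
have a2 : arr s1 2 = arr s 2 by rewrite den_arr.
have a3 : arr s1 3 = arr s 3 by rewrite den_arr.
have a5 : arr s1 5 = arr s 5 by rewrite den_arr.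
split; last first.
  move=> r' ne; set b := PIf _ _ _.
  have := @den_fold R (fun _ A => A 5 r' = arr s 5 r') 2 1 0 b s1 isT.
  apply; first by rewrite a5.
  move=> k s' _ fr _ <-; have [fr4 _] := fr; rewrite /b den_if.
  by case: ifP => _; rewrite /= fr4 // r4; case: eqP ne => // ->; rewrite eqxx.
pose Q k (A : arrays R) := forall hk : (k < n)%N,
  A 5 r k = constraint m a t delta K x r (Ordinal hk) 0.
set b := PIf _ _ _.
have := @den_fill R Q 2 1 0 b s1 isT.
rewrite r1 addn0 => /(_ _ i (ltn_ord i)) H.
rewrite H; first by congr (constraint _ _ _ _ _ _ _ _ _); apply: val_inj.
move=> k s' kn fr rk; have [fr4 fra] := fr.
have e4 : reg s' 4 = r by rewrite fr4.
have cond : beval s' (RLe (RMul (scalar 9) (rsub (rconst 1) (scalar 3))) (scalar 2)) =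
   ((\sum_(i | alive x i) `|a r i 0|) * (1 - delta) <= t).
  by rewrite /= !fra // hm a3 a2 h3 h4.
rewrite /Q /b den_if cond /constraint; split.
  rewrite rm => hk; case: ifP => _ /=; rewrite e4 rk !eqxx /= ?mxE // fra //.
  by rewrite a0 -h2.
move=> j jk IH hj; rewrite /= -(IH hj).
have kj : (j == k) = false by apply/negbTE; rewrite ltn_eqF.
by case: ifP => _ /=; rewrite e4 rk kj !andbF.
Qed.

Lemma last_spec s (i : 'I_n) : base s -> at_point s x -> reg s 5 = nalive x ->
  arr (den (p_last eK) s) 5 m i = constraint m a t delta K x m i 0 /\
  (forall r', r' != m -> arr (den (p_last eK) s) 5 r' = arr s 5 r').
Proof.
move=> bs hx hc; have [h0 h1 _ _ _] := bs; rewrite /p_last; set b := PIf _ _ _.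
split; last first.
  move=> r' ne; have := @den_fold R (fun _ A => A 5 r' = arr s 5 r') 2 1 0 b s isT.
  apply => // k s' _ fr _ <-; have [fr0 _] := fr; rewrite /b den_if.
  by case: ifP => _; rewrite /= fr0 // h0; case: eqP ne => // ->; rewrite eqxx.
pose Q k (A : arrays R) := forall hk : (k < n)%N,
  A 5 m k = constraint m a t delta K x m (Ordinal hk) 0.
have := @den_fill R Q 2 1 0 b s isT.
rewrite h1 addn0 => /(_ _ i (ltn_ord i)) H.
rewrite H; first by congr (constraint _ _ _ _ _ _ _ _ _); apply: val_inj.
move=> k s' kn fr rk; have [fr0 fra] := fr.
have e0 : reg s' 0 = m by rewrite fr0.
have cond : beval s' (ILe (IVar 5) eK) = (nalive x <= K)%N.
  by rewrite /= eKE ?fr0 // hc.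
rewrite /Q /b den_if cond /constraint; split.
  rewrite ltnn => hk; case: ifP => _ /=; rewrite e0 rk !eqxx /= ?mxE // fra //.
  by rewrite (hx (Ordinal hk)).
move=> j jk IH hj; rewrite /= -(IH hj).
have kj : (j == k) = false by apply/negbTE; rewrite ltn_eqF.
by case: ifP => _ /=; rewrite e0 rk kj !andbF.
Qed.

Lemma constraints_spec s r (i : 'I_n) : base s -> at_point s x -> (r <= m)%N ->
  arr (den (p_constraints eK) s) 5 r i = constraint m a t delta K x r i 0.
Proof.
move=> bs hx rm; rewrite /p_constraints !den_seq.
have hc := count_spec bs hx; set s1 := den p_count s in hc *.
have b1 : base s1 by apply: den_base bs.
have hx1 : at_point s1 x by move=> j; rewrite den_arr.
set s2 := den _ s1.
have b2 : base s2 by apply: den_base b1.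
have hx2 : at_point s2 x by move=> j; rewrite den_arr.
have hc2 : reg s2 5 = nalive x by rewrite den_reg.
have [e1 e2] := last_spec i b2 hx2 hc2.
move: rm; rewrite leq_eqVlt => /orP[/eqP -> //|rm].
rewrite e2; last by rewrite ltn_eqF.
pose Q k (A : arrays R) := (k < m)%N -> A 5 k i = constraint m a t delta K x k i 0.
have := @den_fill R Q 4 0 0 p_row s1 isT.
have [r0 r1 _ _ _] := b1; rewrite r0 addn0; apply=> // k s' km fr rk.
have bs' : base s' by apply: base_frame fr _ _ b1.
have hx' : at_point s' x by apply: at_point_frame fr _ hx1.
have [e3 e4] := row_spec i bs' hx' rk km; split=> // j jk IH jm.
by rewrite e4 ?IH // ltn_eqF.
Qed.

Definition has_mult (s : state R) (c : {ffun 'I_n -> nat}) :=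
  forall i : 'I_n, arr s 7 i 0 = (c i)%:R.

Section Weights.
Variable c : {ffun 'I_n -> nat}.

Lemma weight_spec s v (i : 'I_n) : at_point s x -> has_mult s c -> reg s v = i ->
  reval s (e_weight v) = weight x c i.
Proof. by move=> hx hc hv; rewrite /= hv hx hc. Qed.

Definition has_matrix (s : state R) (P : 'M[R]_n) :=
  forall i j : 'I_n, arr s 6 i j = P i j.

(** The body may assume that the entry it is about to write still has its initial value, as the
    in-place rank-one update requires. *)
Lemma fill_matrix (F : nat -> nat -> R) b s :
  reg s 1 = n -> mod_reg b = [::] ->
  (forall s' k l, (k < n)%N -> (l < n)%N ->
     frame [:: 2; 3]%N (mod_arr b) s s' -> reg s' 2 = k -> reg s' 3 = l ->
     arr s' 6 k l = arr s 6 k l ->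
     forall i j, arr (den b s') 6 i j =
       if (i == k) && (j == l) then F k l else arr s' 6 i j) ->
  forall i j, (i < n)%N -> (j < n)%N ->
    arr (den (forn 2 (forn 3 b)) s) 6 i j = F i j.
Proof.
move=> h1 mr H; rewrite /forn; set inner := PFor 3 1 0 b.
have mri : mod_reg inner = [:: 3%N] by rewrite /= mr.
pose Q k (A : arrays R) := forall i j, (j < n)%N ->
  A 6 i j = if (i < k)%N then F i j else arr s 6 i j.
suff HQ : Q (reg s 1 + 0)%N (arr (den (PFor 2 1 0 inner) s)).
  by move=> i j hi hj; rewrite HQ // addn0 h1 hi.
apply: den_fold => //; first by rewrite mri.
rewrite mri addn0 h1 => k s1 kn fr1 rk IH1.
pose Q2 l (A : arrays R) := forall i j, (j < n)%N -> A 6 i j =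
  if (i < k)%N || (i == k) && (j < l)%N then F i j else arr s 6 i j.
have r1 : reg s1 1 = n by case: fr1 => ->.
suff HQ2 : Q2 (reg s1 1 + 0)%N (arr (den inner s1)).
  move=> i j hj; rewrite HQ2 // addn0 r1 hj andbT.
  by have -> : (i < k)%N || (i == k) = (i < k.+1)%N by lia.
apply: (@den_fold _ Q2 3 1 0 b s1); first by rewrite mr.
  by move=> i j hj; rewrite /= IH1 // ltn0 andbF orbF.
rewrite mr addn0 r1 => l s2 ln fr2 rl IH2.
have fr : frame [:: 2; 3]%N (mod_arr b) s s2.
  case: fr1 fr2 => f1 g1 [f2 g2]; split=> q hq; last by rewrite g2 ?g1.
  have q3 : q \notin [:: 3%N] by apply: contra hq; rewrite !inE => ->; rewrite orbT.
  by rewrite (f2 _ q3) (f1 _ hq).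
have rk2 : reg s2 2 = k by case: fr2 => ->.
have old : arr s2 6 k l = arr s 6 k l by rewrite IH2 // ltnn eqxx ltnn.
move=> i j hj; rewrite (H s2 k l kn ln fr rk2 rl old) IH2 //.
case: (altP (i =P k)) => [->|ik] /=; last by rewrite orbF.
rewrite ltnn /= ltnS [(j <= l)%N]leq_eqVlt.
by case: (altP (j =P l)) => [->|jl].
Qed.

Lemma diag_spec s : base s -> at_point s x -> has_mult s c ->
  has_matrix (den p_diag s) (ker_proj (weight x c) (constraint m a t delta K x) 0).
Proof.
move=> bs hx hc i j; have [_ h1 _ _ _] := bs.
pose F k l : R := if insub k is Some i' then
  if k == l then (weight x c i')^-1 else 0 else 0.
rewrite /p_diag (fill_matrix (F := F)) // => [|s' k l kn ln fr rk rl _ i' j'].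
  rewrite /F valK /= !mxE -val_eqE; by case: eqP => _; rewrite ?mulr1n ?mulr0n.
have hx' : at_point s' x by apply: at_point_frame fr _ _.
have hc' : has_mult s' c by move=> q; have [_ ->] := fr.
rewrite den_if; have -> : beval s' (BAnd (ILe (IVar 2) (IVar 3)) (ILe (IVar 3) (IVar 2)))
  = (k == l) by rewrite /= rk rl -eqn_leq.
rewrite /F insubT; case: ifP => kl.
  have wk : reval s' (e_weight 2) = weight x c (Ordinal kn) by exact: weight_spec.
  have e : reval s' (RInv (e_weight 2)) = (reval s' (e_weight 2))^-1 by [].
  by rewrite den_real e wk [ieval _ _]rk [ieval _ _]rl.
by rewrite /= rk rl.
Qed.

Lemma mulvec_spec s r P (C : 'cV[R]_n) (i : 'I_n) : reg s 1 = n -> has_matrix s P ->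
  reg s 4 = r -> (forall j : 'I_n, arr s 5 r j = C j 0) ->
  arr (den p_mulvec s) 8 i 0 = (P *m C) i 0.
Proof.
move=> h1 hP hr hC; rewrite /p_mulvec /forn.
set b := PSeq _ _.
pose Q k (A : arrays R) := forall hk : (k < n)%N, A 8%N k 0%N = (P *m C) (Ordinal hk) 0.
have := @den_fill R Q 2 1 0 b s isT.
rewrite h1 addn0 => /(_ _ i (ltn_ord i)) H.
rewrite H; first by congr (fun_of_matrix _ _ _); apply: val_inj.
move=> k s' kn fr rk; rewrite /b den_seq; set s1 := den _ s'.
have r1 : reg s1 1 = n by rewrite den_reg //; case: fr => ->.
have r4 : reg s1 4 = r by rewrite den_reg //; case: fr => ->.
have r2 : reg s1 2 = k by rewrite den_reg.
set b2 := vset 8 2 _.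
split=> [hk|j jk IH hj].
  pose Q2 l (A : arrays R) := A 8%N k 0%N = \sum_(q < n | (q < l)%N) P (Ordinal hk) q * C q 0.
  have : Q2 (reg s1 1 + 0)%N (arr (den (PFor 3 1 0 b2) s1)).
    apply: den_fold => //; first by rewrite /Q2 sum_ord_lt0 /s1 /= rk !eqxx.
    move=> l s2; rewrite addn0 r1 => ln fr2 rl; rewrite /Q2 => IH.
    rewrite (sum_ord_ltS _ ln) -IH /b2 /=; have [fr2r fr2a] := fr2.
    rewrite !(fr2r 2%N) // !(fr2r 4%N) // r2 r4 rl !eqxx /= (fr2a 5%N) // (fr2a 6%N) //.
    have [_ fra] := fr; rewrite /s1 !den_arr // (fra 5%N) // (fra 6%N) //.
    by rewrite (hP (Ordinal hk) (Ordinal ln)) (hC (Ordinal ln)).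
  by rewrite /Q2 addn0 r1 sum_ord_lt_all mxE => ->.
rewrite -(IH hj); have kj : (j == k) = false by apply/negbTE; rewrite ltn_eqF.
have e1 : arr s1 8 j 0 = arr s' 8 j 0 by rewrite /s1 /= rk kj.
rewrite -e1; apply: (@den_fold R (fun _ A => A 8%N j 0%N = arr s1 8 j 0) 3 1 0 b2 s1) => //.
move=> l s2 _ fr2 _ <-; have [fr2r _] := fr2.
by rewrite /b2 /= fr2r // r2 kj.
Qed.

Lemma dot_spec s r (y C : 'cV[R]_n) : reg s 1 = n -> reg s 4 = r ->
  (forall i : 'I_n, arr s 8 i 0 = y i 0) -> (forall j : 'I_n, arr s 5 r j = C j 0) ->
  arr (den p_dot s) 9 0 0 = (C^T *m y) 0 0.
Proof.
move=> h1 hr hy hC; rewrite /p_dot den_seq; set s1 := den _ s.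
have r1 : reg s1 1 = n by [].
pose Q k (A : arrays R) := A 9%N 0%N 0%N = \sum_(i < n | (i < k)%N) C i 0 * y i 0.
set b := set_scalar _ _.
have : Q (reg s1 1 + 0)%N (arr (den (forn 2 b) s1)).
  apply: den_fold => //; first by rewrite /Q sum_ord_lt0.
  move=> k s'; rewrite addn0 r1 => kn fr rk; rewrite /Q => IH.
  rewrite (sum_ord_ltS _ kn) -IH /b /=; have [frr fra] := fr.
  rewrite frr // rk (fra 5%N) // (fra 8%N) // /s1 !den_arr // [reg _ 4]hr.
  by rewrite (hC (Ordinal kn)) (hy (Ordinal kn)).
rewrite /Q addn0 r1 sum_ord_lt_all => ->.
by rewrite mxE; apply: eq_bigr => i _; rewrite mxE.
Qed.

Lemma downdateE (P : 'M[R]_n) (C : 'cV[R]_n) i j :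
  downdate P C i j = P i j -
    ((C^T *m (P *m C)) 0 0)^-1 * ((P *m C) i 0 * (P *m C) j 0).
Proof.
rewrite /downdate mulmxA mxE; congr (_ + _); rewrite [LHS]mxE; congr (- _).
by rewrite [LHS]mxE; congr (_ * _); rewrite mxE big_ord1 [_^T _ _]mxE.
Qed.

Lemma downdate_spec s r P (C : 'cV[R]_n) : reg s 1 = n -> has_matrix s P ->
  reg s 4 = r -> (forall j : 'I_n, arr s 5 r j = C j 0) ->
  has_matrix (den p_downdate s) (downdate P C).
Proof.
move=> h1 hP hr hC i j; rewrite /p_downdate !den_seq.
have hy k := mulvec_spec k h1 hP hr hC; set s1 := den p_mulvec s in hy *.
have r1 : reg s1 1 = n by rewrite den_reg.
have r4 : reg s1 4 = r by rewrite den_reg.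
have hC1 k : arr s1 5 r (nat_of_ord k) = C k 0 by rewrite den_arr.
have hs := dot_spec r1 r4 hy hC1; set s2 := den p_dot s1 in hs *.
have hP2 : has_matrix s2 P by move=> k l; rewrite !den_arr.
have hy2 (k : 'I_n) : arr s2 8 k 0 = (P *m C) k 0 by rewrite /s2 den_arr.
pose F k l : R := arr s2 6 k l - (arr s2 9 0 0)^-1 * (arr s2 8 k 0 * arr s2 8 l 0).
rewrite /p_rank1 (fill_matrix (F := F)) //.
- by rewrite /F hP2 hs !hy2 downdateE.
- by rewrite den_reg.
move=> s' k l kn ln fr rk rl old i' j'; have [_ fra] := fr.
by rewrite /= rk rl old (fra 8%N) ?(fra 9%N).
Qed.

Lemma proj_spec s : base s -> at_point s x -> has_mult s c ->
  (forall r (i : 'I_n), (r <= m)%N -> arr s 5 r i = constraint m a t delta K x r i 0) ->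
  has_matrix (den p_proj s) (proj m a t delta K x c).
Proof.
move=> bs hx hc hC; have [h0 h1 _ _ _] := bs; rewrite /p_proj den_seq.
have hd := diag_spec bs hx hc; set s1 := den p_diag s in hd *.
pose Q k (A : arrays R) := forall i j : 'I_n,
  A 6%N i j = ker_proj (weight x c) (constraint m a t delta K x) k i j.
have r0 : reg s1 0 = m by rewrite den_reg.
have : Q (reg s1 0 + 1)%N (arr (den (PFor 4 0 1 p_downdate) s1)).
  apply: den_fold => // k s' ; rewrite r0 addn1 => km fr rk IH.
  apply: (downdate_spec (r := k)) => //; first by case: fr => -> //; rewrite den_reg.
  by move=> j; have [_ ->] := fr; rewrite // den_arr // hC.
by rewrite r0 addn1.
Qed.

Lemma raise_spec s (P : 'M[R]_n) : base s -> at_point s x -> has_mult s c ->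
  has_matrix s P ->
  has_mult (den p_raise s)
    [ffun i => if (weight x c i * P i i < delta / 4) && (c i < cap)%N
               then (c i).+1 else c i].
Proof.
move=> bs hx hc hP i; have [h0 h1 _ _ h4] := bs; rewrite /p_raise; set b := PIf _ _ _.
set c' := finfun _.
pose Q2 k (A : arrays R) := forall j : 'I_n, A 7%N j 0%N =
  if (j < k)%N then (c' j)%:R else (c j)%:R.
have : Q2 (reg s 1 + 0)%N (arr (den (forn 2 b) s)).
  apply: den_fold => // k s'; rewrite addn0 h1 => kn fr rk IH j.
  have [frr fra] := fr; have hx' : at_point s' x by apply: at_point_frame fr _ _.
  have ck : arr s' 7 k 0 = (c (Ordinal kn))%:R by rewrite (IH (Ordinal kn)) /= ltnn.
  have wk : reval s' (e_weight 2) = weight x c (Ordinal kn).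
    by rewrite /= rk ck (hx' (Ordinal kn)).
  rewrite /b den_if; set cond := beval _ _.
  have -> : cond = (weight x c (Ordinal kn) * P (Ordinal kn) (Ordinal kn) < delta / 4)
     && (c (Ordinal kn) < cap)%N.
    rewrite /cond; move: (e_weight 2) wk => e wk; rewrite /= wk rk ck.
    rewrite -!ltNge !fra // h4 (hP (Ordinal kn) (Ordinal kn)) frr // h1.
    by rewrite addn1 -natrM ltr_nat.
  have -> : (j < k.+1)%N = (j == Ordinal kn) || (j < k)%N by rewrite ltnS leq_eqVlt.
  case: (altP (j =P Ordinal kn)) => [->|jk] /=.
    rewrite /c' ffunE; case: ifP => _; last by rewrite ck.
    by rewrite /= rk !eqxx /= ck natr1.
  have jk' : (nat_of_ord j == k) = false by apply/negbTE.
  by case: ifP => _; rewrite -IH // /= rk jk'.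
by rewrite addn0 h1 => /(_ i); rewrite ltn_ord.
Qed.

End Weights.

Definition ready (s : state R) := [/\ base s, at_point s x &
  forall r (i : 'I_n), (r <= m)%N -> arr s 5 r i = constraint m a t delta K x r i 0].

Lemma ready_frame rs ars s s' : frame rs ars s s' ->
  all (fun r => r \notin rs) [:: 0; 1]%N ->
  all (fun r => r \notin ars) [:: 0; 2; 3; 4; 5]%N -> ready s -> ready s'.
Proof.
move=> fr hr /and5P[h0 h2 h3 h4 /andP[h5 _]] [bs hx hC]; split.
- by apply: base_frame fr hr _ bs; rewrite /= h0 h2 h3.
- exact: at_point_frame fr h4 hx.
- by move=> r i rm; have [_ ->] := fr; rewrite ?hC.
Qed.

Lemma loop_mult v k b (f : {ffun 'I_n -> nat} -> {ffun 'I_n -> nat}) :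
  (1 < v)%N -> v \notin mod_reg b -> all (fun r => r \notin mod_reg b) [:: 0; 1]%N ->
  all (fun r => r \notin mod_arr b) [:: 0; 2; 3; 4; 5]%N ->
  (forall s c, ready s -> has_mult s c -> has_mult (den b s) (f c)) ->
  forall s c, ready s -> has_mult s c ->
    has_mult (den (PFor v 1 k b) s) (iter (n + k) f c).
Proof.
move=> v1 vb rb ab H s c rs hc; have [[_ h1 _ _ _] _ _] := rs.
pose Q j (A : arrays R) := forall i : 'I_n, A 7%N i 0%N = (iter j f c i)%:R.
have : Q (reg s 1 + k)%N (arr (den (PFor v 1 k b) s)).
  apply: den_fold => // j s' jn fr rj IH; apply: H => //.
  apply: ready_frame fr _ ab rs; move: rb => /and3P[r0 r1 _] /=.
  by rewrite !inE !negb_or r0 r1 !andbT; apply/andP; split; apply/eqP; lia.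
by rewrite h1.
Qed.

Let mu := mult m a t delta K cap x.

Lemma sweep_spec s c : ready s -> has_mult s c ->
  has_mult (den p_sweep s) (sweep m a t delta K cap x c).
Proof.
move=> [bs hx hC] hc; rewrite /p_sweep den_seq.
have hP := proj_spec bs hx hc hC; set s1 := den p_proj s in hP *.
apply: raise_spec hP => //; first exact: den_base bs.
  by move=> i; rewrite den_arr.
by move=> i; rewrite den_arr.
Qed.

Lemma mult_spec s : ready s ->
  has_mult (den p_mult s) mu /\
  has_matrix (den p_mult s) (proj m a t delta K x mu).
Proof.
move=> rs; rewrite /p_mult !den_seq; set s1 := den _ s.
have rs1 : ready s1 by apply: ready_frame (den_frame _ _) _ _ rs.
have hc1 : has_mult s1 [ffun=> 1%N].
  move=> i; rewrite ffunE; pose Q k (A : arrays R) := A 7%N k 0%N = 1.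
  have [[_ h1 _ _ _] _ _] := rs.
  have := @den_fill R Q 2 1 0 (vset 7 2 (rconst 1)) s isT.
  rewrite h1 addn0; apply=> // k s' kn fr rk; rewrite /Q /= rk !eqxx; split=> // j jk ->.
  by case: ifP.
set s2 := den _ s1.
have rs2 : ready s2 by apply: ready_frame (den_frame _ _) _ _ rs1.
have hc2 : has_mult s2 mu.
  have -> : mu = iter (n + 0) (iter (n + 0) (iter (n + 1)
      (sweep m a t delta K cap x))) [ffun=> 1%N].
    by rewrite /mu /mult addn0 addn1 -!iterM mulnA.
  apply: loop_mult => // s3 c3 rs3 hc3; apply: loop_mult => // s4 c4 rs4 hc4.
  by apply: loop_mult => // s5 c5; apply: sweep_spec.
have [b2 x2 C2] := rs2; split; last exact: proj_spec.
have e7 : arr (den p_proj s2) 7 = arr s2 7 by apply: den_arr.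
by move=> i; rewrite e7 hc2.
Qed.

(** State of a running minimum after [k] coordinates, started from the cap [c0]; at [k = n] these
    are the hypotheses of [step_size_unique]. *)
Definition run_min k (c0 : R) (d : 'cV[R]_n) (r : R) :=
  [/\ r <= c0, forall i : 'I_n, (i < k)%N -> d i 0 != 0 -> r <= hit_time x d i &
      r = c0 \/ exists2 i, d i 0 != 0 & r = hit_time x d i].

Lemma run_min_step k c0 (d : 'cV[R]_n) r (kn : (k < n)%N) : d (Ordinal kn) 0 != 0 ->
  run_min k c0 d r ->
  run_min k.+1 c0 d (if r <= hit_time x d (Ordinal kn) then r
                     else hit_time x d (Ordinal kn)).
Proof.
move=> dk [h1 h2 h3]; have lt (i : nat) : (i < k.+1)%N = (i == k) || (i < k)%N by lia.
case: (leP r (hit_time x d (Ordinal kn))) => hr; split=> //.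
- move=> i; rewrite lt => /orP[/eqP ik|ik]; last exact: h2.
  by rewrite (_ : i = Ordinal kn) //; apply: val_inj.
- by apply: le_trans h1; apply: ltW.
- move=> i; rewrite lt => /orP[/eqP ik|ik] di.
    by rewrite (_ : i = Ordinal kn) //; apply: val_inj.
  by apply: le_trans (ltW hr) _; apply: h2.
- by right; exists (Ordinal kn).
Qed.

Lemma run_min_skip k c0 (d : 'cV[R]_n) r (kn : (k < n)%N) : d (Ordinal kn) 0 = 0 ->
  run_min k c0 d r -> run_min k.+1 c0 d r.
Proof.
move=> dk [h1 h2 h3]; split=> // i; have -> : (i < k.+1)%N = (nat_of_ord i == k) || (i < k)%N by lia.
case/orP=> [/eqP ik|ik]; last exact: h2.
by rewrite (_ : i = Ordinal kn) ?dk ?eqxx //; apply: val_inj.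
Qed.

Lemma set_min_spec v e (s : state R) : arr (den (set_min v e) s) v 0 0 =
  if arr s v 0 0 <= reval s e then arr s v 0 0 else reval s e.
Proof. by rewrite /set_min den_if /=; case: ifP => _ //=; rewrite !eqxx. Qed.

Lemma l1_spec v s (d : 'cV[R]_n) : v != 2 -> reg s 1 = n ->
  (forall i : 'I_n, arr s 6 i (reg s v) = d i 0) ->
  arr (den (p_l1 v) s) 9 0 0 = l1norm d.
Proof.
move=> v2 h1 hd; have v2' : v \notin [:: 2%N] by rewrite inE.
rewrite /p_l1 den_seq; set s1 := den _ s.
have r1 : reg s1 1 = n by [].
pose Q k (A : arrays R) := A 9%N 0%N 0%N = \sum_(i < n | (i < k)%N) `|d i 0|.
have : Q (reg s1 1 + 0)%N (arr (den (forn 2 (add_abs (RGet 6 (IVar 2) (IVar v)))) s1)).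
  apply: den_fold => //; first by rewrite /Q sum_ord_lt0.
  move=> k s'; rewrite addn0 r1 => kn fr rk; rewrite /Q => IH.
  have [frr fra] := fr; have rv : reg s' v = reg s v by apply: frr; exact: v2'.
  rewrite (sum_ord_ltS _ kn) -IH add_abs_spec /= rk rv (fra 6%N) // /s1 den_arr //.
  by rewrite (hd (Ordinal kn)).
by rewrite /Q addn0 r1 sum_ord_lt_all.
Qed.

Lemma sizes_spec v s (d : 'cV[R]_n) : v != 2 -> base s -> at_point s x ->
  (forall i : 'I_n, arr s 6 i (reg s v) = d i 0) ->
  arr (den (p_sizes eK v) s) 10 0 0 = step_size K%:R x d /\
  arr (den (p_sizes eK v) s) 11 0 0 = step_size K%:R x (- d).
Proof.
move=> v2 bs hx hd; have [_ h1 _ _ _] := bs.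
have v2' : v \notin [:: 2%N] by rewrite inE.
rewrite /p_sizes !den_seq.
have hl := l1_spec v2 h1 hd; set s1 := den (p_l1 v) s in hl *.
set s2 := den _ s1; set s3 := den _ s2.
have k1 : ieval s1 eK = K by apply: eKE; rewrite /s1 den_reg.
have k2 : ieval s2 eK = K by apply: eKE; rewrite /s2 /s1 !den_reg.
have h9 : arr s2 9 0 0 = l1norm d by rewrite /s2 den_arr.
have h10 : arr s3 10 0 0 = K%:R / l1norm d.
  rewrite /s3 den_arr // /s2 /set_scalar den_real.
  by rewrite -[in RHS]hl -[in RHS]k1.
have h11 : arr s3 11 0 0 = K%:R / l1norm (- d).
  rewrite l1normN /s3 /set_scalar den_real.
  by rewrite -[in RHS]h9 -[in RHS]k2.
have r1 : reg s3 1 = n by rewrite /s3 /s2 /s1 !den_reg.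
have rv : reg s3 v = reg s v.
  by rewrite /s3 /s2 /s1 den_reg // den_reg // den_reg //; exact: v2'.
have x3 : at_point s3 x by move=> i; rewrite /s3 /s2 /s1 !den_arr.
have d3 (i : 'I_n) : arr s3 6 i (reg s3 v) = d i 0.
  by rewrite rv /s3 /s2 /s1 !den_arr.
pose Q k (A : arrays R) := run_min k (K%:R / l1norm d) d (A 10%N 0%N 0%N) /\
   run_min k (K%:R / l1norm (- d)) (- d) (A 11%N 0%N 0%N).
suff : Q (reg s3 1 + 0)%N (arr (den (p_hits v) s3)).
  rewrite r1 addn0 => -[[p1 p2 p3] [q1 q2 q3]].
  by split; apply: step_size_unique => // i; [apply: p2 | apply: q2].
rewrite /p_hits; set e := RGet _ _ _; set b := PIf _ _ _.
apply: den_fold => //; first by split; split=> //; [rewrite h10 | left|rewrite h11|left].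
move=> k s'; rewrite addn0 r1 => kn fr rk [Q1 Q2]; have [frr fra] := fr.
have ed : reval s' e = d (Ordinal kn) 0.
  have rv' : reg s' v = reg s3 v by apply: frr; exact: v2'.
  by rewrite /= rk (fra 6%N) // rv' (d3 (Ordinal kn)).
have ex : reval s' (vget 4 2) = x (Ordinal kn) 0.
  by rewrite /= rk (fra 4%N) // (x3 (Ordinal kn)).
have dN : (- d) (Ordinal kn) 0 = - d (Ordinal kn) 0 by rewrite mxE.
have two w1 w2 e1 e2 : w1 = 10%N -> w2 = 11%N ->
   reval (den (set_min w1 e1) s') e2 = reval s' e2 ->
   arr (den (PSeq (set_min w1 e1) (set_min w2 e2)) s') 10 0 0 =
     (if arr s' 10 0 0 <= reval s' e1 then arr s' 10 0 0 else reval s' e1) /\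
   arr (den (PSeq (set_min w1 e1) (set_min w2 e2)) s') 11 0 0 =
     (if arr s' 11 0 0 <= reval s' e2 then arr s' 11 0 0 else reval s' e2).
  move=> -> -> he; rewrite den_seq; split; first by rewrite den_arr // set_min_spec.
  by rewrite set_min_spec he den_arr.
have pos : beval s' (BNot (RLe e (rconst 0))) = (0 < d (Ordinal kn) 0).
  by rewrite ltNge -ed.
have neg : beval s' (BNot (RLe (rconst 0) e)) = (d (Ordinal kn) 0 < 0).
  by rewrite ltNge -ed.
rewrite /Q /b den_if pos; have [dpos|dneg|d0] := ltrgt0P (d (Ordinal kn) 0).
- have [|-> ->] := @two 10%N 11%N (rdiv (rsub (rconst 1) (vget 4 2)) e)
    (ROpp (rdiv (vget 4 2) (ROpp e))) erefl erefl.
    by rewrite /= /set_min; case: ifP.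
  have e1 : reval s' (rdiv (rsub (rconst 1) (vget 4 2)) e) = hit_time x d (Ordinal kn).
    by rewrite /hit_time dpos -ed -ex.
  have e2 : reval s' (ROpp (rdiv (vget 4 2) (ROpp e))) = hit_time x (- d) (Ordinal kn).
    by rewrite /hit_time dN oppr_gt0 (lt_gtF dpos) -ed -ex.
  by rewrite e1 e2; split; apply: run_min_step => //; rewrite ?dN ?oppr_eq0 gt_eqF.
- rewrite den_if neg ?dneg ?ifT //.
  have [|-> ->] := @two 10%N 11%N (ROpp (rdiv (vget 4 2) e))
    (rdiv (rsub (rconst 1) (vget 4 2)) (ROpp e)) erefl erefl.
    by rewrite /= /set_min; case: ifP.
  have e1 : reval s' (ROpp (rdiv (vget 4 2) e)) = hit_time x d (Ordinal kn).
    by rewrite /hit_time (lt_gtF dneg) -ed -ex.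
  have e2 : reval s' (rdiv (rsub (rconst 1) (vget 4 2)) (ROpp e)) =
      hit_time x (- d) (Ordinal kn).
    by rewrite /hit_time dN oppr_gt0 dneg -ed -ex.
  by rewrite e1 e2; split; apply: run_min_step => //; rewrite ?dN ?oppr_eq0 lt_eqF.
- rewrite den_if neg d0 ltxx ?ifF // [den _ _]/=.
  by split; apply: run_min_skip; rewrite ?dN ?d0 ?oppr0.
Qed.

Definition prepared (s : state R) := [/\ base s, at_point s x, has_mult s mu &
  has_matrix s (proj m a t delta K x mu)].

Lemma prepared_frame rs ars s s' : frame rs ars s s' ->
  all (fun r => r \notin rs) [:: 0; 1]%N ->
  all (fun r => r \notin ars) [:: 0; 2; 3; 4; 6; 7]%N -> prepared s -> prepared s'.
Proof.
move=> fr hr /and5P[h0 h2 h3 h4 /and3P[h6 h7 _]] [bs hx hc hP]; have [_ fra] := fr.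
split.
- by apply: base_frame fr hr _ bs; rewrite /= h0 h2 h3.
- exact: at_point_frame fr h4 hx.
- by move=> i; rewrite fra.
- by move=> i j; rewrite fra.
Qed.

Local Notation rate_x := (rate m a t delta K cap x).
Local Notation total_x := (total_rate m a t delta K cap x).
Local Notation dir_x := (dir m a t delta K cap x).
Local Notation fwd_x := (fwd m a t delta K cap x).
Local Notation bwd_x := (bwd m a t delta K cap x).

Lemma prepared_sizes v s k : v != 2 -> prepared s -> reg s v = k ->
  forall kn : (k < n)%N,
  arr (den (p_sizes eK v) s) 10 0 0 = fwd_x (Ordinal kn) /\
  arr (den (p_sizes eK v) s) 11 0 0 = bwd_x (Ordinal kn).
Proof.
move=> v2 [bs hx hc hP] rv kn; apply: sizes_spec => // i.
by rewrite rv (hP i (Ordinal kn)) dirE.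
Qed.

Lemma rate_spec s k (kn : (k < n)%N) : prepared s -> reg s 9 = k ->
  arr (den (p_rate eK) s) 9 0 0 = rate_x (Ordinal kn) /\
  arr (den (p_rate eK) s) 12 0 0 = arr s 12 0 0 + rate_x (Ordinal kn).
Proof.
move=> ps rk; have [h1 h2] := prepared_sizes (isT : 9%N != 2%N) ps rk kn.
rewrite /p_rate !den_seq; set s1 := den _ s in h1 h2 *.
have ps1 : prepared s1 by apply: prepared_frame (den_frame _ _) _ _ ps.
have [_ x1 c1 _] := ps1.
have rk1 : reg s1 9 = Ordinal kn by rewrite den_reg.
have wk := weight_spec x1 c1 rk1.
set s2 := den _ s1.
have e9 : arr s2 9 0 0 = rate_x (Ordinal kn).
  by rewrite /s2 /set_scalar den_real /rate_x /rate -h1 -h2 -wk.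
split; first by rewrite den_arr.
have e12 : arr s2 12 = arr s 12 by rewrite /s2 /s1 !den_arr.
rewrite /set_scalar den_real; transitivity (arr s2 12 0 0 + arr s2 9 0 0) => //.
by rewrite e12 e9.
Qed.

Lemma clamp01_id (r : R) : 0 <= r <= 1 -> clamp01 r = r.
Proof.
by move=> /andP[r0 r1]; rewrite /clamp01 (min_idPr r1) (max_idPr r0).
Qed.

Lemma sum_ord_geS k (f : 'I_n -> R) (hk : (k < n)%N) :
  \sum_(i < n | (k <= i)%N) f i = f (Ordinal hk) + \sum_(i < n | (k.+1 <= i)%N) f i.
Proof.
rewrite (bigD1 (Ordinal hk)) //=; congr (_ + _); apply: eq_bigl => i.
by rewrite [in RHS]ltn_neqAle andbC eq_sym.
Qed.

Hypotheses (xc : cube x) (K0 : (0 < K)%N).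

Lemma rate_prefix_ge0 k : 0 <= \sum_(i < n | (i < k)%N) rate_x i.
Proof. by apply: sumr_ge0 => i _; apply: rate_ge0. Qed.

(** Prefix sums dominate the rates, so clamping changes nothing. The first equality also covers
    [T = 0], where the rate vanishes with [T]. *)
Lemma pick_coin k (kn : (k < n)%N) :
  let T := \sum_(i < n | (i < k.+1)%N) rate_x i in
  clamp01 (rate_x (Ordinal kn) / T) * T = rate_x (Ordinal kn) /\
  clamp01 (rate_x (Ordinal kn) / T) = rate_x (Ordinal kn) / T.
Proof.
move=> T; have r0 : 0 <= rate_x (Ordinal kn) by apply: rate_ge0.
have T0 : 0 <= T by apply: rate_prefix_ge0.
have rT : rate_x (Ordinal kn) <= T.
  by rewrite /T (sum_ord_ltS _ kn) lerDr rate_prefix_ge0.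
have -> : clamp01 (rate_x (Ordinal kn) / T) = rate_x (Ordinal kn) / T.
  apply: clamp01_id; rewrite divr_ge0 //=.
  have [->|Tn] := eqVneq T 0; first by rewrite invr0 mulr0.
  by rewrite ler_pdivrMr ?mul1r // lt_neqAle eq_sym Tn.
split=> //; have [T00|Tn] := eqVneq T 0; last by rewrite divfK.
by rewrite T00 mulr0; apply/eqP; rewrite eq_le r0 -T00 rT.
Qed.

Lemma wp_seq p q (g : state R -> R) s : wp (PSeq p q) g s = wp p (wp q g) s.
Proof. by []. Qed.

Lemma pick_wp (g : state R -> R) s k (kn : (k < n)%N) : prepared s -> reg s 9 = k ->
  arr s 12 0 0 = \sum_(i < n | (i < k)%N) rate_x i ->
  let q := clamp01 (rate_x (Ordinal kn) / \sum_(i < n | (i < k.+1)%N) rate_x i) in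
  let s1 := den (p_rate eK) s in
  wp (p_pick eK) g s =
    q * g (set_reg (set_reg s1 11 1) 10 k) + (1 - q) * g (set_reg s1 11 0) /\
  arr s1 12 0 0 = \sum_(i < n | (i < k.+1)%N) rate_x i.
Proof.
move=> ps rk hT q s1; have [e9 e12] := rate_spec kn ps rk.
have e12' : arr s1 12 0 0 = \sum_(i < n | (i < k.+1)%N) rate_x i.
  by rewrite e12 hT (sum_ord_ltS _ kn).
split=> //; rewrite /p_pick wp_seq wp_det // -/s1.
have hq : clamp01 (reval s1 (rdiv (scalar 9) (scalar 12))) = q.
  by rewrite /q -e9 -e12'.
have rk1 : reg s1 9 = k by rewrite den_reg.
transitivity (clamp01 (reval s1 (rdiv (scalar 9) (scalar 12))) *
   g (set_reg (set_reg s1 11 1) 10 (reg s1 9)) +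
   (1 - clamp01 (reval s1 (rdiv (scalar 9) (scalar 12)))) * g (set_reg s1 11 0)) => //.
by rewrite hq rk1.
Qed.

(** If all rates vanish, every coin shows 0 and the choice keeps its initial value 0. *)
Lemma choose_spec (g : state R -> R) (g' : nat -> R) s : (0 < n)%N -> prepared s ->
  (forall s', frame (mod_reg (p_choose eK)) (mod_arr (p_choose eK)) s s' ->
     (reg s' 10 < n)%N -> g s' = g' (reg s' 10)) ->
  wp (p_choose eK) g s =
    if total_x == 0 then g' 0%N else \sum_(k < n) rate_x k / total_x * g' k.
Proof.
move=> n0 ps hg; rewrite /p_choose !wp_seq.
set s1 := set_reg (set_arr s 12 0 0 (0%:R : R)) 10 0.
have -> : wp (set_scalar 12 (rconst 0)) (wp (PInt 10 (ICst 0)) (wp (forn 9 (p_pick eK)) g)) s =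
  wp (forn 9 (p_pick eK)) g s1 by [].
set Rs := mod_reg _ in hg; set As := mod_arr _ in hg.
have fr1 : frame Rs As s (set_reg s1 9 0).
  apply: (@frame_trans _ _ _ _ s1); last by apply: frame_reg.
  apply: (@frame_trans _ _ _ _ (set_arr s 12 0 0 0%:R)); first exact: frame_arr.
  exact: frame_reg.
have [[_ h1 _ _ _] _ _ _] := ps.
pose F (h : state R -> R) s' := wp (p_pick eK) (fun s2 => h (next_iter 9 s2)) s'.
have -> : wp (forn 9 (p_pick eK)) g s1 = iter n F g (set_reg s1 9 0).
  by rewrite -[in RHS]h1 -[in RHS](addn0 (reg s 1)).
pose T k := \sum_(i < n | (i < k)%N) rate_x i.
have Tn : T n = total_x by rewrite /T sum_ord_lt_all.
(* The current choice survives the coins [j] to [n - 1] with probability [T j / T n], a telescoping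
   product. *)
have key i j s' : (i + j)%N = n -> frame Rs As s s' -> reg s' 9 = j ->
    (reg s' 10 < n)%N -> arr s' 12 0 0 = T j ->
    iter i F g s' = if total_x == 0 then g' (reg s' 10) else
      T j / total_x * g' (reg s' 10) +
      \sum_(k < n | (j <= k)%N) rate_x k / total_x * g' k.
  elim: i j s' => [|i IH] j s' eij fr rj cj aj.
    rewrite /= hg // (_ : j = n) // Tn big_pred0 => [|k]; last by rewrite leqNgt ltn_ord.
    by case: eqP => // /eqP h; rewrite addr0 mulfV // mul1r.
  have jn : (j < n)%N by lia.
  have psj : prepared s' by apply: prepared_frame fr _ _ ps.
  have -> : iter i.+1 F g s' =
    wp (p_pick eK) (fun s2 => iter i F g (next_iter 9 s2)) s' by [].
  have [-> e12] := pick_wp (fun s2 => iter i F g (next_iter 9 s2)) jn psj rj aj.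
  set s2 := den _ s' in e12 *.
  have fr2 : frame Rs As s s2.
    by apply: (frame_trans fr); apply: frame_sub (den_frame (p_rate eK) s') => q qi;
      rewrite /Rs /As /=; move: qi; rewrite /= !inE; lia.
  have r10 : reg s2 10 = reg s' 10 by rewrite den_reg.
  have rj2 : reg s2 9 = j by rewrite den_reg.
  have eij' : (i + j.+1)%N = n by rewrite -eij addnS.
  have frA : frame Rs As s (next_iter 9 (set_reg (set_reg s2 11 1) 10 j)).
    by rewrite /next_iter; do 3!(apply: frame_trans; last by apply: frame_reg).
  have frB : frame Rs As s (next_iter 9 (set_reg s2 11 0)).
    by rewrite /next_iter; do 2!(apply: frame_trans; last by apply: frame_reg).
  have rA : reg (next_iter 9 (set_reg (set_reg s2 11 1) 10 j)) 9 = j.+1.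
    by rewrite /= rj2.
  have rB : reg (next_iter 9 (set_reg s2 11 0)) 9 = j.+1 by rewrite /= rj2.
  have cB : (reg (next_iter 9 (set_reg s2 11 0)) 10 < n)%N by rewrite /= r10.
  rewrite (IH _ _ eij' frA rA jn e12) (IH _ _ eij' frB rB cB e12).
  have -> : reg (next_iter 9 (set_reg (set_reg s2 11 1) 10 j)) 10 = j by [].
  have -> : reg (next_iter 9 (set_reg s2 11 0)) 10 = reg s' 10 by rewrite -r10.
  have [qT qE] := pick_coin jn; set q := clamp01 _ in qT qE *.
  have TS : T j.+1 = T j + rate_x (Ordinal jn) by rewrite /T (sum_ord_ltS _ jn).
  rewrite -/(T j.+1) in qT qE.
  case: eqP => [Z0|_].
    have r0 : rate_x (Ordinal jn) = 0.
      have /eqP := Z0; rewrite /total_rate psumr_eq0 => [/allP h|k _]; last exact: rate_ge0.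
      by apply/eqP; apply: h; rewrite mem_index_enum.
    by rewrite qE r0 mul0r mul0r subr0 mul1r add0r.
  rewrite (sum_ord_geS _ jn); set S := \sum_(_ < _ | _) _.
  transitivity (q * T j.+1 / total_x * g' j +
    (T j.+1 - q * T j.+1) / total_x * g' (reg s' 10) + S); first by ring.
  by rewrite qT TS /=; ring.
rewrite (key n 0%N) //= ?addn0 //; last by rewrite /T sum_ord_lt0.
by case: eqP => // _; rewrite /T sum_ord_lt0 mul0r mul0r add0r.
Qed.

Lemma update_spec e s (y : 'cV[R]_n) : reg s 1 = n ->
  (forall s' (k : nat) (kn : (k < n)%N), frame [:: 2%N] [:: 4%N] s s' -> reg s' 2 = k ->
     arr s' 4 k 0 = arr s 4 k 0 -> reval s' e = y (Ordinal kn) 0) ->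
  at_point (den (forn 2 (vset 4 2 e)) s) y.
Proof.
move=> h1 He i.
pose Q k (A : arrays R) := forall j : 'I_n, A 4%N j 0%N =
  if (j < k)%N then y j 0 else arr s 4 j 0.
have : Q (reg s 1 + 0)%N (arr (den (forn 2 (vset 4 2 e)) s)).
  apply: den_fold => // k s'; rewrite addn0 h1 => kn fr rk IH j.
  have old : arr s' 4 k 0 = arr s 4 k 0 by rewrite (IH (Ordinal kn)) /= ltnn.
  rewrite /vset den_real (He s' k kn fr rk old) [ieval _ _]rk andbT IH.
  have -> : (j < k.+1)%N = (j == k :> nat) || (j < k)%N by rewrite ltnS leq_eqVlt.
  case: (eqVneq (nat_of_ord j) k) => //= jk.
  by congr (y _ 0); apply: val_inj.
by rewrite addn0 h1 => /(_ i); rewrite ltn_ord.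
Qed.

Lemma addZE (y z : 'cV[R]_n) r i : (y + r *: z) i 0 = y i 0 + r * z i 0.
Proof. by rewrite !mxE. Qed.

Lemma move_spec (g : state R -> R) (G : 'cV[R]_n -> R) s k (kn : (k < n)%N) :
  prepared s -> reg s 10 = k ->
  (forall s' y, base s' -> at_point s' y -> cube y -> g s' = G y) ->
  let l := Ordinal kn in
  wp (p_move eK) g s = if fwd_x l + bwd_x l == 0 then G x else
    bwd_x l / (fwd_x l + bwd_x l) * G (x + fwd_x l *: dir_x l) +
    fwd_x l / (fwd_x l + bwd_x l) * G (x - bwd_x l *: dir_x l).
Proof.
move=> ps rk hg l; have [h1 h2] := prepared_sizes (isT : 10%N != 2%N) ps rk kn.
rewrite /p_move wp_seq wp_det //; set s1 := den _ s in h1 h2 *.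
have ps1 : prepared s1 by apply: prepared_frame (den_frame _ _) _ _ ps.
have rk1 : reg s1 10 = k by rewrite den_reg.
set q := clamp01 (bwd_x l / (fwd_x l + bwd_x l)).
have f0 : 0 <= fwd_x l by apply: fwd_ge0.
have b0 : 0 <= bwd_x l by apply: bwd_ge0.
have KR0 : 0 < K%:R :> R by rewrite ltr0n.
have dd : forall i, ~~ alive x i -> dir_x l i 0 = 0 by apply: dir_dead.
have ddN : forall i, ~~ alive x i -> (- dir_x l) i 0 = 0.
  by move=> i /dd h; rewrite mxE h oppr0.
have cubeF : cube (x + fwd_x l *: dir_x l) by apply: step_size_cube.
have cubeB : cube (x - bwd_x l *: dir_x l).
  by rewrite -scalerN; apply: step_size_cube.
have stF b : prepared (set_reg s1 11 b).
  by apply: (@prepared_frame [:: 11%N] [::] s1) => //; apply: frame_reg.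
have valF : g (den p_fwd (set_reg s1 11 1)) = G (x + fwd_x l *: dir_x l).
  have [bs2 x2 c2 P2] := stF 1%N; apply: hg => //; first exact: den_base bs2.
  apply: update_spec => [|s' i ni fr ri old]; first by case: bs2.
  have [frr fra] := fr; rewrite /= ri old (fra 10%N) // (fra 6%N) // frr //.
  rewrite [reg _ 10]rk1 (P2 (Ordinal ni) l) (x2 (Ordinal ni)) -dirE [arr _ 10 0 0]h1.
  by rewrite addZE.
have valB : g (den p_bwd (set_reg s1 11 0)) = G (x - bwd_x l *: dir_x l).
  have [bs2 x2 c2 P2] := stF 0%N; apply: hg => //; first exact: den_base bs2.
  apply: update_spec => [|s' i ni fr ri old]; first by case: bs2.
  have [frr fra] := fr; rewrite /= ri old (fra 11%N) // (fra 6%N) // frr //.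
  rewrite [reg _ 10]rk1 (P2 (Ordinal ni) l) (x2 (Ordinal ni)) -dirE [arr _ 11 0 0]h2.
  by rewrite -scaleNr addZE mulNr.
have -> : wp (PSeq (PFlip 11 (rdiv (scalar 11) (RAdd (scalar 10) (scalar 11))))
     (PIf (ILe (ICst 1) (IVar 11)) p_fwd p_bwd)) g s1 =
   q * g (den p_fwd (set_reg s1 11 1)) + (1 - q) * g (den p_bwd (set_reg s1 11 0)).
  rewrite /q -h1 -h2 wp_seq.
  transitivity (clamp01 (reval s1 (rdiv (scalar 11) (RAdd (scalar 10) (scalar 11)))) *
     wp p_fwd g (set_reg s1 11 1) +
     (1 - clamp01 (reval s1 (rdiv (scalar 11) (RAdd (scalar 10) (scalar 11))))) *
     wp p_bwd g (set_reg s1 11 0)) => //.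
  by rewrite !wp_det.
rewrite valF valB.
have [z|z] := eqVneq (fwd_x l + bwd_x l) 0.
  have bz : bwd_x l = 0 by lra.
  have fz : fwd_x l = 0 by lra.
  by rewrite bz fz !scale0r subr0 addr0; ring.
have qE : q = bwd_x l / (fwd_x l + bwd_x l).
  apply: clamp01_id; rewrite divr_ge0 ?addr_ge0 //= ler_pdivrMr; first by rewrite mul1r lerDr.
  by rewrite lt_neqAle eq_sym z addr_ge0.
by rewrite qE; congr (_ + _ * _); field.
Qed.

Lemma step_spec (g : state R -> R) (G : 'cV[R]_n -> R) s : (0 < n)%N ->
  base s -> at_point s x ->
  (forall s' y, base s' -> at_point s' y -> cube y -> g s' = G y) ->
  wp (p_step eK) g s = step_avg m a t delta K cap G x.
Proof.
move=> n0 bs hx hg; have -> : wp (p_step eK) g s = wp (p_constraints eK)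
  (wp p_mult (wp (p_choose eK) (wp (p_move eK) g))) s by [].
rewrite (wp_det (p := p_constraints eK)) // (wp_det (p := p_mult)) //.
set s1 := den (p_constraints eK) s.
have rs1 : ready s1.
  split; first exact: den_base bs.
    by move=> i; rewrite den_arr.
  by move=> r i rm; exact: (constraints_spec i bs hx rm).
have [hc hP] := mult_spec rs1; set s2 := den _ s1 in hc hP *.
have ps : prepared s2.
  have [b1 x1 _] := rs1; split=> //; first exact: den_base b1.
  by move=> i; rewrite den_arr.
pose val k := if insub k is Some l then
   (if fwd_x l + bwd_x l == 0 then G x else
    bwd_x l / (fwd_x l + bwd_x l) * G (x + fwd_x l *: dir_x l) +
    fwd_x l / (fwd_x l + bwd_x l) * G (x - bwd_x l *: dir_x l)) else 0.
rewrite (choose_spec (g' := val) n0 ps) => [|s' fr kn]; last first.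
  have ps' : prepared s' by apply: prepared_frame fr _ _ ps.
  by rewrite (move_spec kn ps' erefl hg) /val insubT.
rewrite /step_avg; case: eqP => [Z0|_]; last first.
  apply: eq_bigr => l _; rewrite /val valK; case: eqP => // z.
  have f0 : 0 <= fwd_x l by apply: fwd_ge0.
  have b0 : 0 <= bwd_x l by apply: bwd_ge0.
  have fz : fwd_x l = 0 by lra.
  have -> : rate_x l = 0 by rewrite /rate fz mul0r invr0 mulr0.
  by rewrite !mul0r.
(* With total rate 0 the program still moves along direction 0; that direction is null, as its rate
   would be positive otherwise, so the point stays. *)
rewrite /val insubT /=; set l := Ordinal n0.
have r0 : rate_x l = 0.
  have /eqP := Z0; rewrite /total_rate psumr_eq0 => [/allP h|k _]; last exact: rate_ge0.
  by apply/eqP; apply: h; rewrite mem_index_enum.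
have dl0 : dir_x l = 0.
  by apply/eqP; apply: contraT => /(rate_gt0 K0 xc); rewrite r0 ltxx.
have -> : fwd_x l = 0 by rewrite /fwd step_size0.
have -> : bwd_x l = 0 by rewrite /bwd step_size0 // dl0 oppr0.
by rewrite addr0 eqxx.
Qed.

End Spec.

(** * The whole program performs the walk *)

Section Main.
Variables (R : realType) (m n : nat) (a : nat -> 'cV[R]_n) (t delta : R).
Variables (K : nat) (eK : iexp).
Let step := step_avg m a t delta K (n * n.+1).

(** [p] acts as [L] steps of the walk on observables of the current point; the quantification over
    all of them lets the property compose along loops. *)
Definition averages (p : prg) L := forall (g : state R -> R) (G : 'cV[R]_n -> R),
  (forall s y, base m a t delta s -> at_point s y -> cube y -> g s = G y) ->
  forall s y, base m a t delta s -> at_point s y -> cube y ->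
    wp p g s = iter L step G y.

Lemma averages_for v k p L : (1 < v)%N -> averages p L ->
  averages (PFor v 1 k p) ((n + k) * L).
Proof.
move=> v1 H g G hg s y bs hy yc; have [_ h1 _ _ _] := bs.
have base_set s' w q : (1 < w)%N -> base m a t delta s' ->
    base m a t delta (set_reg s' w q).
  move=> w1; apply: (@base_frame _ _ _ _ _ _ [:: w] [::]) => //.
    by apply: frame_reg; rewrite inE.
  by rewrite /= !inE andbT; apply/andP; split; apply/eqP; lia.
rewrite [wp _ _ _]/= h1.
have : base m a t delta (set_reg s v 0) by apply: base_set.
have : at_point (set_reg s v 0) y by [].
elim: (n + k)%N (set_reg s v 0) y yc {hy} => [|i IH] s1 y yc hy b1 /=; first exact: hg.
rewrite mulSn iterD; apply: H => // s2 z b2 hz zc.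
by apply: IH => //; apply: base_set.
Qed.

Hypothesis step_ok : (0 < n)%N -> averages (p_step eK) 1.

Lemma main_spec (g : state R -> R) (G : 'cV[R]_n -> R) s (y : 'cV[R]_n) :
  (forall s y, base m a t delta s -> at_point s y -> cube y -> g s = G y) ->
  base m a t delta s -> (forall i : 'I_n, arr s 1 i 0 = y i 0) -> cube y ->
  wp (p_main eK) g s = iter (n * n.+1) step G y.
Proof.
move=> hg bs hy yc; rewrite /p_main wp_seq wp_det //.
set s1 := den _ s; have [_ h1 _ _ _] := bs.
have b1 : base m a t delta s1 by apply: den_base bs.
have y1 : at_point s1 y.
  apply: update_spec => // s' k kn fr rk _; have [_ fra] := fr.
  by rewrite /= rk fra // (hy (Ordinal kn)).
(* For [n = 0] there is no direction to choose and [step_ok] says nothing; the outer loop is then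
   empty. *)
have [n0|n0] := posnP n.
  have h : averages (forn 12 (PFor 13 1 1 (p_step eK))) (n * n.+1).
    move=> g' G' hg' s' y' bs' hy' yc'; have e : (n * n.+1 = 0)%N by lia.
    have [_ h1' _ _ _] := bs'; have e' : (reg s' 1 + 0 = 0)%N by rewrite h1' n0.
    rewrite e /forn /= e' /=.
    by apply: hg' => //; apply: (@base_frame _ _ _ _ _ _ [:: 12%N] [::]) bs' => //;
      apply: frame_reg.
  exact: (h g G hg s1 y).
have -> : (n * n.+1 = (n + 0) * ((n + 1) * 1))%N by lia.
exact: (averages_for (v := 12%N) 0 isT (averages_for (v := 13%N) 1 isT (step_ok n0)) hg b1 y1 yc).
Qed.

End Main.

(** * The law of the output *)

Section Linearity.
Variables (R : realType) (m n : nat) (a : nat -> 'cV[R]_n) (t delta : R).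
Variables (K cap : nat).
Let step := step_avg m a t delta K cap.

Lemma step_avg_ext F H x : (forall y, F y = H y) -> step F x = step H x.
Proof.
move=> FH; rewrite /step /step_avg; case: ifP => _; first exact: FH.
by apply: eq_bigr => k _; rewrite !FH.
Qed.

Lemma step_avg_comb (I : finType) (G : I -> 'cV[R]_n -> R) (c : I -> R) x :
  step (fun y => \sum_i G i y * c i) x = \sum_i step (G i) x * c i.
Proof.
rewrite /step /step_avg; case: ifP => _ //.
under [RHS]eq_bigr do rewrite mulr_suml.
rewrite [RHS]exchange_big /=; apply: eq_bigr => k _.
rewrite !mulr_sumr -big_split /= mulr_sumr; apply: eq_bigr => i _; ring.
Qed.

Lemma iter_avg_comb L (I : finType) (G : I -> 'cV[R]_n -> R) (c : I -> R) x :
  iter L step (fun y => \sum_i G i y * c i) x = \sum_i iter L step (G i) x * c i.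
Proof.
elim: L x => [//|L IH] x /=.
by rewrite (step_avg_ext _ IH) step_avg_comb.
Qed.

End Linearity.

Lemma vec01_inj (R : realType) n : injective (@vec01 R n).
Proof.
move=> X Y /colP XY; apply/ffunP => i; have := XY i; rewrite !mxE.
by case: (X i); case: (Y i) => // /eqP; rewrite ?oner_eq0 // eq_sym oner_eq0.
Qed.

Lemma le_mx_norm (R : realType) m n (A : 'M[R]_(m, n)) i j : `|A i j| <= mx_norm A.
Proof.
rewrite mx_normE -[leLHS]nngE num_le; exact: (le_bigmax _ _ (i, j)).
Qed.

Lemma mx_norm_le (R : realType) m n (A : 'M[R]_(m, n)) c : 0 <= c ->
  (forall i j, `|A i j| <= c) -> mx_norm A <= c.
Proof.
move=> c0 h; have [->//|/mx_norm_neq0[ij ->]] := eqVneq (mx_norm A) 0.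
exact: h.
Qed.

(** The minimiser of [- theta s + 36 K V theta^2] is [s / (72 K V)]. Adding [36 K M s] to the
    denominator enforces the bound on [theta M], and still [36 K V theta <= s / 2], so half of
    [theta s] survives. *)
Lemma bernstein_exponent (R : realType) (delta K V M s : R) :
  0 < delta -> 0 < K -> K * delta <= 5 -> 0 <= V -> 0 < M -> 0 < s ->
  let theta := s / (72 * K * V + 36 * K * M * s) in
  [/\ 0 <= theta, theta * M * (36 * K) <= 1 &
      - (theta * s) + theta ^+ 2 * (36 * K) * V <=
      - ((s ^+ 2 / (540 / delta)) / (2 * (V + M * s / 3)))].
Proof.
move=> d0 K0 Kd V0 M0 s0 theta; set D := 72 * K * V + 36 * K * M * s in theta *.
have KV : 0 <= K * V by rewrite mulr_ge0 // ltW.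
have KMs : 0 < K * M * s by rewrite !mulr_gt0.
have D0 : 0 < D by rewrite /D; lra.
have th0 : 0 <= theta by rewrite divr_ge0 // ltW.
have thD : theta * D = s by rewrite /theta divfK // gt_eqF.
split=> //.
  have -> : theta * M * (36 * K) = (36 * K * M * s) / D by rewrite /theta; ring.
  by rewrite ler_pdivrMr // mul1r /D; lra.
have W0 : 0 < V + M * s / 3.
  have : 0 < M * s by rewrite mulr_gt0.
  lra.
have h1 : theta * (theta * (36 * K * V)) <= theta * (s / 2).
  rewrite ler_wpM2l // -thD; have : 0 <= theta * (K * M * s) by rewrite mulr_ge0 // ltW.
  rewrite /D; lra.
(* With [K delta <= 5] one has [D delta <= 360 V + 180 M s]; 540 is three times 180, because of the
   factor 1/3 in [M s / 3]. *)
have h2 : (s ^+ 2 / (540 / delta)) / (2 * (V + M * s / 3)) <= theta * s / 2.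
  rewrite invf_div ler_pdivrMr; last by rewrite mulr_gt0.
  have -> : theta * s / 2 * (2 * (V + M * s / 3)) = theta * (s * (V + M * s / 3)).
    by field.
  have -> : s ^+ 2 * (delta / 540) = theta * (s * (D * delta / 540)).
    transitivity ((theta * D) * (s * (delta / 540))); last by ring.
    by rewrite thD; ring.
  rewrite ler_wpM2l // ler_wpM2l ?(ltW s0) // ler_pdivrMr //.
  have KV5 : K * delta * V <= 5 * V by rewrite ler_wpM2r.
  have KM5 : K * delta * (M * s) <= 5 * (M * s).
    by rewrite ler_wpM2r // mulr_ge0 // ltW.
  have Ms : 0 <= M * s by rewrite mulr_ge0 // ltW.
  rewrite /D; lra.
have -> : theta ^+ 2 * (36 * K) * V = theta * (theta * (36 * K * V)) by ring.
lra.
Qed.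

(** * Law of the output: means, discrepancy and concentration *)

Section Law.
Variables (R : realType) (m n : nat) (A : 'M[R]_(m, n)) (x : 'cV[R]_n) (t delta : R).
Variables (K : nat) (eK : iexp).
Hypothesis eKE : forall s : state R, reg s 1 = n -> ieval s eK = K.
Hypotheses (delta0 : 0 <= delta) (delta1 : delta < 1) (K0 : (0 < K)%N).
Hypothesis K_large : forall q, (K < q <= n)%N -> 4 <= delta * q%:R.
Hypothesis At : max_col_l1 A <= t.
Hypothesis xc : forall i, 0 <= x i 0 <= 1.

Definition row_of r : 'cV[R]_n := if insub r is Some j then (row j A)^T else 0.

Let T := (n * n.+1)%N.
Let step := step_avg m row_of t delta K T.
Let mu := @output_law R n (cost_poly (p_main eK)).[(m + n)%N] (compile (p_main eK))
            (input A x t delta).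

Lemma T_gt0 : (0 < n)%N -> (0 < T)%N.
Proof. by rewrite /T; case: (n). Qed.

Lemma row_ofE (j : 'I_m) i : row_of j i 0 = A j i.
Proof. by rewrite /row_of valK !mxE. Qed.

Lemma col_row_of i : \sum_(r < m) `|row_of r i 0| <= t.
Proof.
apply: le_trans At; under eq_bigr do rewrite row_ofE.
exact: (le_bigmax _ (fun j => \sum_(r < m) `|A r j|) i).
Qed.

Lemma bound_ge0 : 0 <= t.
Proof. by apply: le_trans At; apply: bigmax_ge_id. Qed.

Lemma input_base : base m row_of t delta (input A x t delta).
Proof.
split=> // r i rm; rewrite /= valK.
by have -> : r = Ordinal rm by []; rewrite valK row_ofE.
Qed.

Lemma law_iter X : mu X = iter T step (fun y => (y == vec01 R X)%:R) x.
Proof.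
rewrite /mu /output_law cost_polyE.
rewrite (@compile_correct R (p_main eK) (m + n) 0 [::] _
  (fun s => (returns (Some s) X)%:R)) ?addn0 ?leq_addr ?leq_addl //; last first.
  by move=> s' _ [|T'].
apply: (main_spec (a := row_of)) => //; first last.
- by move=> i; rewrite /= valK.
- exact: input_base.
- move=> s y _ hy _; congr (_%:R); congr nat_of_bool.
  apply/forallP/eqP => [h|yX i]; last by rewrite hy yX mxE.
  by apply/colP => i; rewrite -hy mxE; apply/eqP.
move=> n0 g G hg s y bs hy yc.
exact: (step_spec eKE yc K0 n0 bs hy hg).
Qed.

Let walk := walk_inv m row_of t delta K x.

Lemma walk_start : walk T x.
Proof. exact: inv_start. Qed.

(** The walk ends at a 0-1 vector, where [F] is a combination of indicators; the iterated average is
    linear, and its value on an indicator is the law. *)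
Lemma law_mean (F : 'cV[R]_n -> R) :
  \sum_X mu X * F (vec01 R X) = iter T step F x.
Proof.
under eq_bigr do rewrite law_iter.
rewrite -iter_avg_comb.
apply: (eq_iter_avg delta0 delta1 K0 T_gt0 col_row_of K_large bound_ge0 walk_start).
move=> y /inv0_integral[X ->]; rewrite (bigD1 X) //= eqxx mul1r big1 ?addr0 // => Y YX.
by rewrite (inj_eq (@vec01_inj R n)) eq_sym (negbTE YX) mul0r.
Qed.

Lemma iter_cst (c : R) : iter T step (fun=> c) x = c.
Proof.
have d0 y : dot (0 : 'cV[R]_n) y = 0.
  by rewrite /dot big1 // => i _; rewrite mxE mul0r.
have := iter_avg_lin delta0 delta1 K0 T_gt0 col_row_of K_large bound_ge0 0 c walk_start.
rewrite d0 add0r => {2}<-.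
apply: (eq_iter_avg delta0 delta1 K0 T_gt0 col_row_of K_large bound_ge0 walk_start).
by move=> y _; rewrite d0 add0r.
Qed.

Lemma law_ge0 X : 0 <= mu X.
Proof.
rewrite law_iter -[leLHS](iter_cst 0).
by apply: (iter_avg_le delta0 delta1 K0 T_gt0 col_row_of K_large bound_ge0 walk_start).
Qed.

Lemma law_sum1 : \sum_X mu X = 1.
Proof.
rewrite -(iter_cst 1) -law_mean; apply: eq_bigr => X _; by rewrite mulr1.
Qed.

Lemma law_dot g : Ex mu (fun X => dot g (vec01 R X)) = dot g x.
Proof.
rewrite /Ex (law_mean (dot g)).
have := iter_avg_lin delta0 delta1 K0 T_gt0 col_row_of K_large bound_ge0 g 0 walk_start.
rewrite addr0 => e; rewrite -[RHS]e.
apply: (eq_iter_avg delta0 delta1 K0 T_gt0 col_row_of K_large bound_ge0 walk_start).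
by move=> y _; rewrite addr0.
Qed.

Lemma law_coord i : Ex mu (fun X => vec01 R X i 0) = x i 0.
Proof.
have e (y : 'cV[R]_n) : y i 0 = dot (delta_mx i 0) y.
  rewrite /dot (bigD1 i) //= big1 => [|j /negbTE ji]; rewrite mxE ?ji ?mul0r //.
  by rewrite !eqxx mul1r addr0.
by rewrite e -law_dot; apply: eq_bigr => X _; rewrite e.
Qed.

Lemma law_discrepancy :
  Pr mu (fun X => mx_norm (A *m (vec01 R X - x)) <= t / (1 - delta)) = 1.
Proof.
pose F (y : 'cV[R]_n) : R := (mx_norm (A *m (y - x)) <= t / (1 - delta))%R%:R.
rewrite -[RHS](iter_cst 1) /Pr big_mkcond.
transitivity (\sum_X mu X * F (vec01 R X)).
  by apply: eq_bigr => X _ /=; rewrite /F; case: (_ <= _); rewrite /= ?mulr1 ?mulr0.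
rewrite law_mean.
apply: (eq_iter_avg delta0 delta1 K0 T_gt0 col_row_of K_large bound_ge0 walk_start).
move=> y iy; rewrite /F mx_norm_le //.
  by rewrite divr_ge0 ?bound_ge0 // subr_ge0 ltW.
move=> r j; rewrite ord1.
have := inv_discrepancy delta1 bound_ge0 iy (ltn_ord r); rewrite /dot mxE.
by under eq_bigr do rewrite row_ofE.
Qed.

Lemma law_concentrated : 0 < delta -> 4 / delta <= K%:R -> K%:R * delta <= 5 ->
  beta_concentrated mu (540 / delta) x.
Proof.
move=> d_gt0 K4 K5; split; [|exact: law_coord|].
  by rewrite ler_pdivlMr // mul1r (le_trans (ltW delta1)) // ler1n.
move=> h s s0; rewrite law_dot.
set V := \sum_i h i 0 ^+ 2 * (x i 0 - x i 0 ^+ 2).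
have [M0|Mn0] := eqVneq (mx_norm h) 0.
  have h0 : h = 0 by apply: mx_norm_eq0.
  have d0 y : dot h y = 0 by rewrite h0 /dot big1 // => i _; rewrite mxE mul0r.
  rewrite /Pr big_pred0 ?expR_ge0 // => X; rewrite !d0 subr0.
  by apply/negbTE; rewrite -ltNge.
have [[i0 j0] hM] := mx_norm_neq0 Mn0.
have M_gt0 : 0 < mx_norm h.
  by rewrite lt_neqAle eq_sym Mn0 hM normr_ge0.
have VE : \sum_i h i 0 ^+ 2 * variance x i = V.
  by apply: eq_bigr => i _; rewrite /variance; ring.
have V0 : 0 <= V.
  by rewrite -VE; apply: sumr_ge0 => i _; rewrite mulr_ge0 ?sqr_ge0 ?variance_ge0.
have KR0 : 0 < K%:R :> R by rewrite ltr0n.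
have [th0 thM expo] := bernstein_exponent d_gt0 KR0 K5 V0 M_gt0 s0.
set theta := s / _ in th0 thM expo.
have moment := iter_exp_moment delta0 delta1 K0 T_gt0 col_row_of K_large bound_ge0
  d_gt0 K4 th0 (fun i => le_mx_norm h i 0) thM walk_start.
rewrite VE -law_mean in moment.
(* Markov's inequality for the exponential of [theta] times the linear form. *)
apply: (@le_trans _ _ (expR (- (theta * (dot h x + s))) *
    \sum_X mu X * expR (theta * dot h (vec01 R X)))).
  rewrite /Pr big_mkcond mulr_sumr; apply: ler_sum => X _.
  rewrite mulrCA -expRD; case: ifP => hX; last by rewrite mulr_ge0 ?expR_ge0 ?law_ge0.
  rewrite -[leLHS]mulr1 ler_wpM2l ?law_ge0 // -[leLHS]expR0 ler_expR.
  have : 0 <= theta * (dot h (vec01 R X) - dot h x - s).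
    by rewrite mulr_ge0 // subr_ge0.
  lra.
apply: le_trans (ler_wpM2l (expR_ge0 _) moment) _.
rewrite -expRD ler_expR; apply: le_trans expo; lra.
Qed.

End Law.

Theorem theorem3 (R : realType) :
  exists C : R,
  forall delta : R, 0 <= delta -> delta < 1 ->
  exists (prog : cmd) (p : {poly nat}),
  forall (m n : nat) (A : 'M[R]_(m, n)) (x : 'cV[R]_n) (t : R),
    max_col_l1 A <= t ->
    (forall i : 'I_n, 0 <= x i 0 <= 1) ->
    let mu := @output_law R n p.[(m + n)%N] prog (input A x t delta) in
    [/\ is_law mu,
        Pr mu (fun X => mx_norm (A *m (vec01 R X - x)) <= t / (1 - delta)) = 1,
        (forall i : 'I_n, Ex mu (fun X => vec01 R X i 0) = x i 0) &
        (0 < delta -> beta_concentrated mu (C / delta) x)].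
Proof.
exists 540 => delta delta0 delta1.
(* The program may depend on [delta], so for [delta > 0] the bound [K] is a numeral. For
   [delta = 0], [K = n + 1] exceeds the number of alive coordinates: the radial constraint never
   applies and [K_large] is vacuous. *)
pose k := (Num.trunc (4 / delta)).+1.
pose eK := if 0 < delta then ICst k else IAdd (IVar 1) (ICst 1).
exists (compile (p_main eK)), (cost_poly (p_main eK)) => m n A x t At xc mu.
pose K := if 0 < delta then k else n.+1.
have eKE (s : state R) : reg s 1 = n -> ieval s eK = K.
  by rewrite /eK /K; case: ifP => //= _ ->; rewrite addn1.
have K0 : (0 < K)%N by rewrite /K; case: ifP.
have k_gt : 4 / delta < k%:R by apply: truncnS_gt.
have K_large q : (K < q <= n)%N -> 4 <= delta * q%:R.
  rewrite /K; case: ifP => [d0 /andP[kq _]|_]; last by lia.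
  rewrite mulrC -ler_pdivrMr //; apply: le_trans (ltW k_gt) _.
  by rewrite ler_nat ltnW.
split.
- split; first by move=> X; apply: (law_ge0 eKE delta0 delta1 K0 K_large At xc).
  exact: (law_sum1 eKE delta0 delta1 K0 K_large At xc).
- exact: (law_discrepancy eKE delta0 delta1 K0 K_large At xc).
- exact: (law_coord eKE delta0 delta1 K0 K_large At xc).
move=> d0; have KE : K = k by rewrite /K d0.
apply: (law_concentrated eKE delta0 delta1 K0 K_large At xc) => //.
  by rewrite KE ltW.
have d4 : 0 <= 4 / delta by rewrite divr_ge0.
have := truncn_itv d4 => /andP[h _].
(* Here [K delta <= (4 / delta + 1) delta = 4 + delta < 5], the source of the constant 5. *)
have : (Num.trunc (4 / delta))%:R * delta <= 4 by rewrite -ler_pdivlMr.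
by rewrite KE /k -[_.+1%:R]natr1 mulrDl mul1r; lra.
Qed.
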